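(* Let $a,b\in\mathbb{C}$ with $a\neq 0$ and $c\in\mathbb{R}$, and consider on $M=\mathbb{C}^*$ the holomorphic potential $$\xi=\xi_{-1}\,\frac{dz}{z},\qquad \xi_{-1}=\begin{pmatrix} c & a\lambda^{-1}+\bar b\lambda\\ b\lambda^{-1}+\bar a\lambda & -c\end{pmatrix}.$$ If $|a+\bar b|^2+c^2=\tfrac14$ and $ab\in\mathbb{R}$, then the triple $(\xi,\mathrm{Id},0)$ (that is, $\Phi_0=\mathrm{Id}$ and base point $\tilde z_0=0$ in the universal cover $\mathbb{C}$ of $\mathbb{C}^*$) generates the associated family $f_\lambda$ of a Delaunay surface, which at $\lambda=1$ has bulge/neck radius $$\frac{1}{2H}\left(1\pm\sqrt{1-16ab}\right).$$
   Context: Loop groups. $\mathrm{diag}[u,v]$ is the diagonal matrix with entries $u,v$; $\sigma=\mathrm{diag}[1,-1]$. Let $C_r=\{|\lambda|=r\}$, $I_r=\{|\lambda|<r\}$, $A_r=\{r<|\lambda|<1/r\}$ for $r\in(0,1]$. A map $g$ of $\lambda$ is twisted if $\sigma g(-\lambda)\sigma^{-1}=g(\lambda)$. $\Lambda_r\mathrm{SL}(2,\mathbb{C})_\sigma$ is the group of twisted analytic maps $C_r\to\mathrm{SL}(2,\mathbb{C})$. $\Lambda_r^+\mathrm{SL}(2,\mathbb{C})_\sigma$ is the subgroup of those extending holomorphically to $I_r$ with value at $\lambda=0$ in $K=\{\mathrm{diag}[\rho,1/\rho]:\rho>0\}$. $\Lambda_r\mathrm{SU}(2)_\sigma$ is the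 subgroup of those extending holomorphically to $A_r$ with values in $\mathrm{SU}(2)$ on $S^1$ (for $r=1$: twisted analytic maps $S^1\to\mathrm{SU}(2)$). Every $g\in\Lambda_r\mathrm{SL}(2,\mathbb{C})_\sigma$ has a unique (Iwasawa) decomposition $g=FB$ with $F\in\Lambda_r\mathrm{SU}(2)_\sigma$, $B\in\Lambda_r^+\mathrm{SL}(2,\mathbb{C})_\sigma$. DPW construction. Fix a real constant $H\ne0$. Let $\widetilde M$ be the universal cover of a Riemann surface $M$. A holomorphic potential is a holomorphic $1$-form $\xi$ on $\widetilde M$ with values in twisted maps $\mathbb{C}^*\to\mathfrak{sl}(2,\mathbb{C})$ that are holomorphic in $\lambda\in\mathbb{C}^*$ and such that $\lambda\xi$ extends holomorphically to $\lambda=0$. Given a triple $(\xi,\Phi_0,\tilde z_0)$ with $\tilde z_0\in\widetilde M$ and $\Phi_0\in\Lambda_r\mathrm{SL}(2,\mathbb{C})_\sigma$, let $\Phi$ solve $d\Phi=\Phi\xi$, $\Phi(\tilde z_0)=\Phi_0$, and decompose $\Phi=FB$ pointwise (Iwasawa). The associated family generated by the triple is, for $\lambda\in S^1$, $$f_\lambda=-\tfrac1H\left(i\lambda(\partial_\lambda F)F^{-1}+\tfrac i2F\sigma F^{-1}\right):\widetilde M\to\mathfrak{su}(2)\cong\mathbb{R}^3,$$ where $\mathfrak{su}(2)\cong\mathbb{R}^3$ via the orthonormal basis $e_1=\begin{pmatrix} i&0\\0&-i\end{pmatrix}$, $e_2=\begin{pmatrix}0&1\\-1&0\end{pmatrix}$,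 $e_3=\begin{pmatrix}0&i\\i&0\end{pmatrix}$. The maps $f_\lambda$ are conformal with constant mean curvature $H$, and are immersed where the upper right entry of the $\lambda^{-1}$-coefficient of $\xi$ does not vanish. Here $M=\mathbb{C}^*$, with universal covering $\exp:\mathbb{C}\to\mathbb{C}^*$, $\tilde z=\log z$, and deck transformations generated by $\tilde z\mapsto\tilde z+2\pi i$. Delaunay surfaces. These are the constant mean curvature $H$ surfaces of revolution (CMC cylinders, complete immersed surfaces of revolution, whose profile curves are roulettes of conics), comprising unduloids ($ab>0$), nodoids ($ab<0$), and the round cylinder (e.g. $a=b=1/4$); the limiting case $b=0$ (e.g. $a=1/2$, $b=0$) is a round sphere with two points removed. If $r(t)$ is the profile curve (distance to the axis), then $\frac{r}{\sqrt{1+\dot r^2}}-r^2H=\kappa$ is constant along the curve; the bulge and neck radii (where $\dot r=0$) are the two roots of $r(1-rH)=\kappa$, with $r$ counted with sign. *)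

(* Defs.v *)
From Stdlib Require Import Reals.
From Coquelicot Require Import Coquelicot.
Open Scope R_scope.

Record M2 : Type := mkM2 { m11 : C; m12 : C; m21 : C; m22 : C }.

Definition madd (A B : M2) : M2 :=
  mkM2 (m11 A + m11 B)%C (m12 A + m12 B)%C (m21 A + m21 B)%C (m22 A + m22 B)%C.

Definition mscal (k : C) (A : M2) : M2 :=
  mkM2 (k * m11 A)%C (k * m12 A)%C (k * m21 A)%C (k * m22 A)%C.

Definition mmul (A B : M2) : M2 :=
  mkM2 (m11 A * m11 B + m12 A * m21 B)%C (m11 A * m12 B + m12 A * m22 B)%C
       (m21 A * m11 B + m22 A * m21 B)%C (m21 A * m12 B + m22 A * m22 B)%C.

Definition mdet (A : M2) : C := (m11 A * m22 A - m12 A * m21 A)%C.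

Definition mtrace (A : M2) : C := (m11 A + m22 A)%C.

Definition minv (A : M2) : M2 :=
  mscal (/ mdet A)%C (mkM2 (m22 A) (- m12 A)%C (- m21 A)%C (m11 A)).

Definition madj (A : M2) : M2 :=
  mkM2 (Cconj (m11 A)) (Cconj (m21 A)) (Cconj (m12 A)) (Cconj (m22 A)).

Definition mdiag (u v : C) : M2 := mkM2 u 0%C 0%C v.

Definition mid : M2 := mdiag 1%C 1%C.

Definition sigma : M2 := mdiag 1%C (- 1)%C.

Definition in_SU2 (A : M2) : Prop := mmul A (madj A) = mid /\ mdet A = 1%C.

Definition entrywise (P : (M2 -> C) -> Prop) : Prop :=
  P m11 /\ P m12 /\ P m21 /\ P m22.

Definition holo_at (g : C -> C) (x : C) : Prop :=
  locally x (fun w : C => @ex_derive C_AbsRing C_NormedModule g w).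

Definition mholo_at (G : C -> M2) (x : C) : Prop :=
  entrywise (fun m => holo_at (fun w => m (G w)) x).

Definition is_mderive (G : C -> M2) (x : C) (L : M2) : Prop :=
  entrywise (fun m =>
    @is_derive C_AbsRing C_NormedModule
      (fun w => m (G w)) x (m L)).

Definition mderive (G : C -> M2) (x : C) : M2 :=
  mkM2 (C_derive (fun w => m11 (G w)) x) (C_derive (fun w => m12 (G w)) x)
       (C_derive (fun w => m21 (G w)) x) (C_derive (fun w => m22 (G w)) x).

(* A loop on the circle |l| = r is represented by a total function that is
   holomorphic near every point of that circle; only its values on the circle
   (and, for the subgroups below, on the disc or annulus to which it extends)
   are meaningful. *)

Definition twisted_at (g : C -> M2) (l : C) : Prop :=
  mmul (mmul sigma (g (- l)%C)) (minv sigma) = g l.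

Definition LambdaSL (r : R) (g : C -> M2) : Prop :=
  forall l : C, Cmod l = r -> mholo_at g l /\ twisted_at g l /\ mdet (g l) = 1%C.

Definition LambdaPlusSL (r : R) (g : C -> M2) : Prop :=
  LambdaSL r g
  /\ (forall l : C, Cmod l < r -> mholo_at g l)
  /\ exists rho : R, 0 < rho /\ g 0%C = mdiag (RtoC rho) (RtoC (/ rho)).

(* For r = 1 the annulus is empty and the unit circle is the loop's own circle. *)
Definition LambdaSU (r : R) (g : C -> M2) : Prop :=
  LambdaSL r g
  /\ (forall l : C, r < Cmod l < / r -> mholo_at g l)
  /\ (forall l : C, Cmod l = 1 -> in_SU2 (g l)).

Record R3 : Type := mkR3 { cx : R; cy : R; cz : R }.

Definition vadd (p q : R3) : R3 := mkR3 (cx p + cx q) (cy p + cy q) (cz p + cz q).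
Definition vscal (k : R) (p : R3) : R3 := mkR3 (k * cx p) (k * cy p) (k * cz p).
Definition dot (p q : R3) : R := cx p * cx q + cy p * cy q + cz p * cz q.
Definition cross (p q : R3) : R3 :=
  mkR3 (cy p * cz q - cz p * cy q)
       (cz p * cx q - cx p * cz q)
       (cx p * cy q - cy p * cx q).
Definition vnorm (p : R3) : R := sqrt (dot p p).
Definition vdist (p q : R3) : R := vnorm (vadd p (vscal (-1) q)).

Definition e1 : M2 := mkM2 Ci 0%C 0%C (- Ci)%C.
Definition e2 : M2 := mkM2 0%C 1%C (- 1)%C 0%C.
Definition e3 : M2 := mkM2 0%C Ci Ci 0%C.

(* The inner product -tr(XY)/2, for which (e1, e2, e3) is orthonormal. *)
Definition su2_inner (X Y : M2) : R := - Re (mtrace (mmul X Y)) / 2.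

Definition su2_coords (X : M2) : R3 :=
  mkR3 (su2_inner X e1) (su2_inner X e2) (su2_inner X e3).

(* A 1-form on C is represented by its coefficient: [xi z l] is the value at the
   loop parameter [l] of the coefficient of dz.  Joint holomorphy in (z, l) is
   expressed as separate holomorphy (Hartogs). *)
Definition holomorphic_potential (xi : C -> C -> M2) : Prop :=
  (forall z l : C, l <> 0%C ->
     mholo_at (fun w => xi w l) z /\ mholo_at (xi z) l
     /\ mtrace (xi z l) = 0%C /\ twisted_at (xi z) l)
  /\ exists eta : C -> C -> M2,
       (forall z l : C, mholo_at (fun w => eta w l) z /\ mholo_at (eta z) l)
       /\ forall z l : C, l <> 0%C -> eta z l = mscal l (xi z l).

Definition dpw_triple (r : R) (xi : C -> C -> M2) (Phi0 : C -> M2) : Prop :=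
  holomorphic_potential xi /\ LambdaSL r Phi0.

Definition solves (r : R) (xi : C -> C -> M2) (Phi0 : C -> M2) (z0 : C)
    (Phi : C -> C -> M2) : Prop :=
  forall l : C, Cmod l = r ->
    Phi z0 l = Phi0 l
    /\ forall z : C, is_mderive (fun w => Phi w l) z (mmul (Phi z l) (xi z l)).

Definition iwasawa (r : R) (g F B : C -> M2) : Prop :=
  LambdaSU r F /\ LambdaPlusSL r B
  /\ forall l : C, Cmod l = r -> g l = mmul (F l) (B l).

Definition sym_bobenko (H : R) (F : C -> M2) (l : C) : M2 :=
  mscal (RtoC (- (1 / H)))
    (madd (mscal (Ci * l)%C (mmul (mderive F l) (minv (F l))))
          (mscal (Ci / 2)%C (mmul (mmul (F l) sigma) (minv (F l))))).

(* [f l z] is the value at z of the member of the family with parameter l. *)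
Definition dpw_generates (H r : R) (xi : C -> C -> M2) (Phi0 : C -> M2) (z0 : C)
    (f : C -> C -> R3) : Prop :=
  exists Phi F B : C -> C -> M2,
    solves r xi Phi0 z0 Phi
    /\ (forall z : C, iwasawa r (Phi z) (F z) (B z))
    /\ forall l z : C, Cmod l = 1 -> f l z = su2_coords (sym_bobenko H (F z) l).

Definition cexp (z : C) : C := (exp (Re z) * cos (Im z), exp (Re z) * sin (Im z)).

(* Pull-back of X(z) dz under the universal covering z = exp w:
   X(exp w) exp w dw. *)
Definition pullback_exp (X : C -> C -> M2) : C -> C -> M2 :=
  fun w l => mscal (cexp w) (X (cexp w) l).

Definition xi_m1 (a b : C) (c : R) (l : C) : M2 :=
  mkM2 (RtoC c) (a / l + Cconj b * l)%C (b / l + Cconj a * l)%C (RtoC (- c)).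

Definition delaunay_potential (a b : C) (c : R) : C -> C -> M2 :=
  fun z l => mscal (/ z)%C (xi_m1 a b c l).

Definition on_coords (f : C -> R3) : R -> R -> R3 := fun s t => f (s, t).

Definition smooth (X : R -> R -> R3) : Prop :=
  forall (n : nat) (s t : R),
    ex_diff_n (fun s t => cx (X s t)) n s t
    /\ ex_diff_n (fun s t => cy (X s t)) n s t
    /\ ex_diff_n (fun s t => cz (X s t)) n s t.

Definition vDerive (p : R -> R3) (t : R) : R3 :=
  mkR3 (Derive (fun t => cx (p t)) t) (Derive (fun t => cy (p t)) t)
       (Derive (fun t => cz (p t)) t).

Definition Ds (X : R -> R -> R3) : R -> R -> R3 :=
  fun s t => vDerive (fun s => X s t) s.
Definition Dt (X : R -> R -> R3) : R -> R -> R3 :=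
  fun s t => vDerive (fun t => X s t) t.

Definition immersion (X : R -> R -> R3) : Prop :=
  smooth X /\ forall s t, cross (Ds X s t) (Dt X s t) <> mkR3 0 0 0.

(* Unit normal for the orientation (s, t) of the surface and (e1, e2, e3) of space. *)
Definition normal (X : R -> R -> R3) (s t : R) : R3 :=
  let n := cross (Ds X s t) (Dt X s t) in vscal (/ vnorm n) n.

Definition I_ss X s t := dot (Ds X s t) (Ds X s t).
Definition I_st X s t := dot (Ds X s t) (Dt X s t).
Definition I_tt X s t := dot (Dt X s t) (Dt X s t).
Definition II_ss X s t := dot (Ds (Ds X) s t) (normal X s t).
Definition II_st X s t := dot (Ds (Dt X) s t) (normal X s t).
Definition II_tt X s t := dot (Dt (Dt X) s t) (normal X s t).

Definition mean_curvature (X : R -> R -> R3) (s t : R) : R :=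
  (II_ss X s t * I_tt X s t - 2 * II_st X s t * I_st X s t + II_tt X s t * I_ss X s t)
  / (2 * (I_ss X s t * I_tt X s t - I_st X s t ^ 2)).

Definition cmc (H : R) (X : R -> R -> R3) : Prop :=
  forall s t, mean_curvature X s t = H.

Definition conformal (X : R -> R -> R3) : Prop :=
  forall s t, I_ss X s t = I_tt X s t /\ I_st X s t = 0.

(* Coefficient <X_zz, N> of the Hopf differential, where z = s + i t. *)
Definition hopf (X : R -> R -> R3) (s t : R) : C :=
  ((II_ss X s t - II_tt X s t) / 4, - II_st X s t / 2).

(* The X l, |l| = 1, are the associated family of the conformal immersion X 1
   of constant mean curvature H: same metric and mean curvature, Hopf
   differential multiplied by l^-2. *)
Definition associated_family (H : R) (X : C -> R -> R -> R3) : Prop :=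
  forall l : C, Cmod l = 1 ->
    immersion (X l) /\ conformal (X l) /\ cmc H (X l)
    /\ forall s t, I_ss (X l) s t = I_ss (X 1%C) s t
                   /\ hopf (X l) s t = (hopf (X 1%C) s t / (l * l))%C.

(* Every divergent C^1 curve has infinite length.  For a surface invariant under
   t |-> t + 2 pi this is completeness of the universal cover, equivalently of
   the quotient. *)
Definition complete (X : R -> R -> R3) : Prop :=
  forall p q : R -> R,
    (forall t, ex_derive p t /\ continuous (Derive p) t) ->
    (forall t, ex_derive q t /\ continuous (Derive q) t) ->
    is_lim (fun t => Cmod (p t, q t)) p_infty p_infty ->
    is_lim (fun T => RInt (fun t => vnorm (vDerive (fun t => X (p t) (q t)) t)) 0 T)
      p_infty p_infty.

Definition twice_punctured_sphere (X : R -> R -> R3) : Prop :=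
  exists (m p q : R3) (rad : R),
    0 < rad /\ p <> q /\ vdist p m = rad /\ vdist q m = rad
    /\ forall y : R3,
         (exists s t, X s t = y) <-> (vdist y m = rad /\ y <> p /\ y <> q).

(* X is obtained by rotating the profile curve (h, rho) about the axis through o
   in direction u; (u, v, u x v) is a direct orthonormal frame. *)
Definition surface_of_revolution (X : R -> R -> R3) (o u v : R3) (h rho : R -> R)
    : Prop :=
  dot u u = 1 /\ dot v v = 1 /\ dot u v = 0
  /\ (forall (n : nat) (s : R), ex_derive_n h n s /\ ex_derive_n rho n s)
  /\ (forall s, 0 < rho s /\ (Derive h s <> 0 \/ Derive rho s <> 0))
  /\ forall s t,
       X s t = vadd (vadd o (vscal (h s) u))
                    (vscal (rho s) (vadd (vscal (cos t) v) (vscal (sin t) (cross u v)))).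

Definition delaunay (H : R) (X : R -> R -> R3) (o u v : R3) (h rho : R -> R) : Prop :=
  surface_of_revolution X o u v h rho
  /\ immersion X /\ cmc H X
  /\ (complete X \/ twice_punctured_sphere X).

(* Distance to the axis counted with the sign of h'.  Where h' <> 0 the curve is
   a graph over the axis: with t = h and r = sign(h') rho one has
   r / sqrt(1 + (dr/dt)^2) - H r^2 = rho h' / sqrt(h'^2 + rho'^2) - H rho^2,
   and the right-hand side also makes sense at the vertical points of a nodoid. *)
Definition signed_radius (h rho : R -> R) (s : R) : R := sign (Derive h s) * rho s.

Definition profile_constant (H : R) (h rho : R -> R) (kappa : R) : Prop :=
  forall s, rho s * Derive h s / sqrt (Derive h s ^ 2 + Derive rho s ^ 2)
            - H * rho s ^ 2 = kappa.

(* R1, R2 are the two roots of x (1 - x H) = kappa, and the nonzero ones are the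
   signed radii at the critical points of rho; a zero root is the degenerate neck
   of the round sphere, at the deleted points. *)
Definition bulge_neck_radii (H : R) (h rho : R -> R) (R1 R2 : R) : Prop :=
  (exists kappa : R,
     profile_constant H h rho kappa
     /\ forall x : R, x * (1 - x * H) = kappa <-> (x = R1 \/ x = R2))
  /\ forall x : R, x <> 0 ->
       ((x = R1 \/ x = R2) <->
        exists s, Derive rho s = 0 /\ x = signed_radius h rho s).

(* Main.v *)
Require Import Defs.
From Stdlib Require Import Reals Lra Lia ClassicalEpsilon.
From Coquelicot Require Import Coquelicot.
Open Scope R_scope.

(* In the coordinate w = s + i t on the universal cover the potential is A dw with
   A = xi_m1 independent of w, so Phi = exp (w A) = exp (i t A) exp (s A).  On the
   unit circle A is hermitian, so exp (i t A) is unitary and only exp (s A) has to be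
   factorized.  Its Iwasawa factors F, B are found from the Lax matrix L = F^-1 A F:
   writing L = alpha + beta, alpha skew-hermitian on the circle and beta holomorphic at
   l = 0, the equation L' = [L, alpha] is an ODE for (a e^th, b e^-th, q = th' / 2),
   and F' = F alpha, B' = beta B are linear ODEs depending holomorphically on l.  Any other
   Iwasawa factorization agrees with this one on the circle, since a loop which is
   unitary on the circle and extends to the disc with positive diagonal value at 0 is
   trivial by the mean value property.  The frame F then gives the fundamental forms
   of the Sym-Bobenko surface.  At l = 1 the matrix A ^ 2 is 1/4, the surface is
   rotated by exp (i t A) about an axis, and the profile has rho = 2 |a| e^th / |H|
   and h' = (4 / H) (|a|^2 e^(2 th) + a b). *)

(** * Picard iteration *)

(** The factors [F] and [B] come with the hypothesis, so the explicit factorization serves only to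
    identify [F], and only on the unit circle. The Sym-Bobenko formula also contains the derivative
    of [F] in [l]; the values on the circle determine it, since the derivative along the circle is
    [i l] times the complex derivative. Holomorphy of a loop means complex differentiability alone,
    so the mean value property is obtained through Goursat's argument.

    The equation for [(th, q)] has exponential terms and no global Lipschitz bound. Its first
    integral [q^2 + |a|^2 e^(2 th) + |b|^2 e^(-2 th)], the [l^0] coefficient of [- det L], suggests
    a pendulum angle obeying a Lipschitz equation when [b] is not 0, and a closed form when [b = 0].
    It also bounds the coefficients of the linear equations on the whole line.

    The product of [|a| e^th] and [|b| e^-th] is [|a b|], and the second factor is bounded, so the
    radius stays away from 0 unless [b = 0], which is the punctured sphere. Reality of [a b] makes
    the direction of [X_t] independent of [s], which is what produces circular parallels. *)

Lemma RInt_abs_le_primitive (g k G : R -> R) (a b : R) :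
  a <= b -> (forall x, a <= x <= b -> continuous g x) ->
  (forall x, a <= x <= b -> Rabs (g x) <= k x) ->
  (forall x, a <= x <= b -> continuous k x) ->
  (forall x, a <= x <= b -> is_derive G x (k x)) ->
  Rabs (RInt g a b) <= G b - G a.
Proof.
intros hab cg hgk ck dG.
refine (norm_RInt_le g k a b (RInt g a b) (G b - G a) hab hgk _ _).
- apply (RInt_correct g), ex_RInt_continuous.
  intros x; rewrite (Rmin_left a b), (Rmax_right a b) by easy; apply cg.
- apply (is_RInt_derive G k);
    intros x; rewrite (Rmin_left a b), (Rmax_right a b) by easy; auto.
Qed.

(** Integration from 0 gains a factor [1 / k] on the weight [exp (k |x|)], and a large [k] beats any
    Lipschitz constant. *)
Lemma RInt_abs_le_exp (g : R -> R) (D k s : R) :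
  0 < k -> (forall x, continuous g x) ->
  (forall x, Rabs (g x) <= D * exp (k * Rabs x)) ->
  Rabs (RInt g 0 s) <= D / k * exp (k * Rabs s).
Proof.
intros hk cg hg.
assert (hD : 0 <= D).
{ specialize (hg 0); rewrite Rabs_R0, Rmult_0_r, exp_0 in hg.
  pose proof (Rabs_pos (g 0)); lra. }
assert (hDk : 0 <= D / k) by (apply Rdiv_le_0_compat; lra).
destruct (Rle_lt_dec 0 s) as [hs | hs].
- apply Rle_trans with (D / k * exp (k * s) - D / k * exp (k * 0)).
  + apply (RInt_abs_le_primitive g (fun x => D * exp (k * x))
             (fun x => D / k * exp (k * x))); auto.
    * intros x hx; specialize (hg x); rewrite (Rabs_pos_eq x) in hg; lra.
    * intros x _; apply (ex_derive_continuous (fun x => D * exp (k * x))).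
      auto_derive; auto.
    * intros x _; auto_derive; auto; field; lra.
  + rewrite (Rabs_pos_eq s), Rmult_0_r, exp_0 by easy; lra.
- rewrite <- (opp_RInt_swap g) by (apply ex_RInt_continuous; auto); change (opp (RInt g s 0)) with (- RInt g s 0).
  rewrite Rabs_Ropp.
  apply Rle_trans with (- (D / k) * exp (- (k * 0)) - - (D / k) * exp (- (k * s))).
  + apply (RInt_abs_le_primitive g (fun x => D * exp (- (k * x)))
             (fun x => - (D / k) * exp (- (k * x)))); auto.
    * lra.
    * intros x hx; specialize (hg x); rewrite (Rabs_left1 x) in hg by lra.
      rewrite <- Ropp_mult_distr_r in hg; exact hg.
    * intros x _; apply (ex_derive_continuous (fun x => D * exp (- (k * x)))).
      auto_derive; auto.
    * intros x _; auto_derive; auto; field; lra.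
  + rewrite (Rabs_left s), Rmult_0_r, Ropp_0, exp_0, <- Ropp_mult_distr_r by easy.
    lra.
Qed.

Fixpoint picard {I : Type} (f : R -> (I -> R) -> I -> R) (y0 : I -> R) (n : nat)
    (s : R) (i : I) : R :=
  match n with
  | O => y0 i
  | S n => y0 i + RInt (fun t => f t (picard f y0 n t) i) 0 s
  end.

(* The unknown is a family of real functions with arbitrary index type, measured
   in the sup norm; the weight [exp (2 K |s|)] makes the Picard map a contraction
   with ratio 1/2 on the whole line. *)
Lemma picard_lindelof (I : Type) (f : R -> (I -> R) -> I -> R) (y0 : I -> R) (K C : R) :
  1 <= K ->
  (forall s y z d i, (forall j, Rabs (y j - z j) <= d) ->
     Rabs (f s y i - f s z i) <= K * d) ->
  (forall Y : R -> I -> R, (forall j s, continuous (fun s => Y s j) s) ->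
     forall i s, continuous (fun s => f s (Y s) i) s) ->
  (forall s i, Rabs (f s y0 i) <= C) ->
  exists y : R -> I -> R,
    (forall i, y 0 i = y0 i)
    /\ (forall s i, is_derive (fun s => y s i) s (f s (y s) i))
    /\ forall s i, Rabs (y s i - y0 i) <= 2 * C * exp (2 * K * Rabs s).
Proof.
intros hK lip cont hC.
set (p := picard f y0).
set (w := fun s => exp (2 * K * Rabs s)).
assert (w1 : forall s, 1 <= w s).
{ intros s; unfold w; rewrite <- exp_0 at 1.
  destruct (Rle_lt_or_eq_dec 0 (2 * K * Rabs s)) as [h | h].
  - pose proof (Rabs_pos s); nra.
  - left; now apply exp_increasing.
  - rewrite <- h; lra. }
assert (cp : forall n i s, continuous (fun s => p n s i) s).
{ induction n as [|n IH]; intros i s.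
  - apply continuous_const.
  - apply (continuous_plus (fun _ => y0 i)); [apply continuous_const|].
    apply (ex_derive_continuous (fun s => RInt (fun t => f t (p n t) i) 0 s)).
    exists (f s (p n s) i).
    apply (is_derive_RInt (fun t => f t (p n t) i) _ 0).
    + apply filter_forall; intros t; apply (RInt_correct (fun t => f t (p n t) i)).
      apply ex_RInt_continuous; intros; now apply cont.
    + now apply cont. }
assert (iR : forall Y : R -> I -> R, (forall j s, continuous (fun s => Y s j) s) ->
   forall i a b, ex_RInt (fun s => f s (Y s) i) a b).
{ intros Y hY i a b; apply (ex_RInt_continuous (fun s => f s (Y s) i)).
  intros; now apply cont. }
(* The Lipschitz constant [K] meets the gain [1 / (2 K)] of the weight: one application of the
   integral operator halves the weighted distance. *)
assert (Ineq : forall (Y Z : R -> I -> R) D, (forall j s, continuous (fun s => Y s j) s) ->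
   (forall j s, continuous (fun s => Z s j) s) ->
   (forall s j, Rabs (Y s j - Z s j) <= D * w s) ->
   forall s i, Rabs (RInt (fun t => f t (Y t) i) 0 s - RInt (fun t => f t (Z t) i) 0 s)
               <= D / 2 * w s).
{ intros Y Z D cY cZ hD s i.
  change (Rabs (minus (RInt (fun t => f t (Y t) i) 0 s) (RInt (fun t => f t (Z t) i) 0 s))
               <= D / 2 * w s).
  rewrite <- (RInt_minus (V := R_CompleteNormedModule)) by now apply iR.
  replace (D / 2) with (K * D / (2 * K)) by (field; lra).
  apply RInt_abs_le_exp; [lra | |].
  - intros x; apply (continuous_minus (fun t => f t (Y t) i) (fun t => f t (Z t) i));
      now apply cont.
  - intros x; rewrite Rmult_assoc; apply lip; intros j; apply hD. }
assert (step : forall n s i, Rabs (p (S n) s i - p n s i) <= C * (1 / 2) ^ n * w s).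
{ induction n as [|n IH]; intros s i.
  - replace (p 1%nat s i - p 0%nat s i) with (RInt (fun t => f t y0 i) 0 s).
    2: { symmetry; exact (Rplus_minus_l (y0 i) _). }
    assert (hC0 : 0 <= C) by (pose proof (Rabs_pos (f 0 y0 i)); pose proof (hC 0 i); lra).
    apply Rle_trans with (C / (2 * K) * w s).
    + apply RInt_abs_le_exp; [lra | |].
      * intros x; apply (cont (fun _ => y0)); intros; apply continuous_const.
      * intros x; pose proof (w1 x) as h1; unfold w in h1; pose proof (hC x i); nra.
    + apply Rmult_le_compat_r; [pose proof (w1 s); lra|].
      simpl; rewrite Rmult_1_r; apply Rle_div_l; nra.
  - replace (p (S (S n)) s i - p (S n) s i) with
      (RInt (fun t => f t (p (S n) t) i) 0 s - RInt (fun t => f t (p n t) i) 0 s).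
    2: { symmetry; exact (Rminus_plus_l_l (y0 i) _ _). }
    replace (C * (1 / 2) ^ S n) with (C * (1 / 2) ^ n / 2) by (simpl; field).
    apply Ineq; auto. }
set (dd := fun s i n => p (S n) s i - p n s i).
assert (exg : forall c, is_series (fun n => c * (1 / 2) ^ n) (2 * c)).
{ intros c; replace (2 * c) with (scal c (/ (1 - 1 / 2))) by (unfold scal; simpl; unfold mult; simpl; field).
  apply (is_series_scal c (fun n => (1/2) ^ n)).
  apply is_series_geom; rewrite Rabs_pos_eq; lra. }
assert (exd : forall s i, ex_series (dd s i)).
{ intros s i; apply (ex_series_le (dd s i) (fun n => (C * w s) * (1 / 2) ^ n)).
  - intros n; unfold dd; change (Rabs (p (S n) s i - p n s i) <= C * w s * (1 / 2) ^ n).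
    specialize (step n s i); lra.
  - eexists; apply exg. }
set (y := fun s i => y0 i + Series (dd s i)).
assert (part : forall n s i, p n s i = y0 i + sum_n (dd s i) n - dd s i n).
{ intros n s i; induction n as [|n IH].
  - rewrite sum_O; unfold p; simpl; ring.
  - rewrite sum_Sn; change (plus (sum_n (dd s i) n) (dd s i (S n)))
      with (sum_n (dd s i) n + dd s i (S n)).
    unfold dd at 2 3; unfold dd at 2 in IH; lra. }
(* The error is a tail of the telescoping series; the factor 2 is the sum of the geometric series of
   ratio 1/2. *)
assert (rest : forall n s i, Rabs (y s i - p n s i) <= 2 * C * (1 / 2) ^ n * w s).
{ intros n s i.
  assert (E : y s i - p n s i = Series (fun k => dd s i (n + k)%nat)).
  { unfold y; destruct n as [|n].
    - exact (Rplus_minus_l (y0 i) _).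
    - rewrite (Series_incr_n (dd s i) (S n)); [|lia|apply exd].
      rewrite part, sum_Sn, <- sum_n_Reals; simpl pred.
      change (plus (sum_n (dd s i) n) (dd s i (S n)))
        with (sum_n (dd s i) n + dd s i (S n)); ring. }
  rewrite E.
  assert (Hl : forall k, Rabs (dd s i (n + k)%nat) <= (C * (1 / 2) ^ n * w s) * (1 / 2) ^ k).
  { intros k; unfold dd; eapply Rle_trans; [apply step|].
    rewrite pow_add; right; ring. }
  eapply Rle_trans.
  - apply Series_Rabs.
    apply (ex_series_le (fun k => Rabs (dd s i (n + k)%nat)) (fun k => (C * (1 / 2) ^ n * w s) * (1 / 2) ^ k)).
    + intros k; change (Rabs (Rabs (dd s i (n + k)%nat)) <= (C * (1 / 2) ^ n * w s) * (1 / 2) ^ k).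
      rewrite Rabs_Rabsolu; apply Hl.
    + eexists; apply exg.
  - eapply Rle_trans.
    + apply Series_le; [intros k; split; [apply Rabs_pos | apply Hl] | eexists; apply exg].
    + rewrite (is_series_unique _ _ (exg _)); lra. }
assert (small : forall c eps, 0 < eps -> exists n, c * (1 / 2) ^ n < eps).
{ intros c eps he.
  destruct (pow_lt_1_zero (1 / 2)) with (y := eps / (Rabs c + 1)) as [n hn].
  - rewrite Rabs_pos_eq; lra.
  - apply Rdiv_lt_0_compat; auto; pose proof (Rabs_pos c); lra.
  - exists n; specialize (hn n (Nat.le_refl n)).
    pose proof (pow_lt (1 / 2) n ltac:(lra)) as hp.
    rewrite Rabs_pos_eq in hn by lra.
    pose proof (Rabs_pos c); pose proof (Rle_abs c).
    apply Rlt_div_r in hn; nra. }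
(* On the interval of radius 1 around [s] the weight is bounded, so the iterates converge uniformly
   there. *)
assert (cy : forall i s, continuous (fun s => y s i) s).
{ intros i s; apply continuity_pt_filterlim.
  apply (CVU_continuity (fun n t => p n t i) (fun t => y t i) s (mkposreal 1 Rlt_0_1)).
  - intros eps he.
    destruct (small (2 * C * exp (2 * K * (Rabs s + 1))) eps he) as [N hN].
    exists N; intros n t hn ht.
    unfold Boule in ht; simpl in ht.
    eapply Rle_lt_trans; [apply rest|]; eapply Rle_lt_trans; [|apply hN].
    assert (hC0 : 0 <= C) by (pose proof (Rabs_pos (f 0 y0 i)); pose proof (hC 0 i); lra).
    replace (2 * C * exp (2 * K * (Rabs s + 1)) * (1 / 2) ^ N)
      with (2 * C * (1 / 2) ^ N * exp (2 * K * (Rabs s + 1))) by ring.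
    apply Rmult_le_compat.
    + pose proof (pow_lt (1 / 2) n ltac:(lra)); nra.
    + pose proof (w1 t); lra.
    + apply Rmult_le_compat_l; [lra|].
      replace (1 / 2) with (/ 2) by field; rewrite !pow_inv.
      apply Rinv_le_contravar; [apply pow_lt; lra|].
      apply Rle_pow; [lra | exact hn].
    + unfold w; assert (Rabs t <= Rabs s + 1).
      { pose proof (Rabs_triang (t - s) s) as ht'; replace (t - s + s) with t in ht' by ring; lra. }
      destruct (Rle_lt_or_eq_dec (2 * K * Rabs t) (2 * K * (Rabs s + 1))) as [h | h].
      * nra.
      * left; now apply exp_increasing.
      * rewrite h; lra.
  - intros n t _; apply continuity_pt_filterlim, cp.
  - unfold Boule; simpl; rewrite Rminus_diag, Rabs_R0; lra. }
(* Both sides lie within [C (1/2)^n] times the weight of the iterate of rank [n + 1], for every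
   [n]. *)
assert (fix_eq : forall s i, y s i = y0 i + RInt (fun t => f t (y t) i) 0 s).
{ intros s i; apply Rminus_diag_uniq.
  destruct (Req_dec (y s i - (y0 i + RInt (fun t => f t (y t) i) 0 s)) 0) as [h | h]; auto.
  apply Rabs_pos_lt in h.
  destruct (small (2 * C * w s) _ h) as [n hn]; exfalso.
  apply (Rlt_irrefl (Rabs (y s i - (y0 i + RInt (fun t => f t (y t) i) 0 s)))).
  eapply Rle_lt_trans; [|apply hn].
  pose proof (rest (S n) s i) as h1.
  pose proof (Ineq y (p n) (2 * C * (1 / 2) ^ n) (fun j s => cy j s) (cp n) (rest n) s i) as h2.
  change (p (S n) s i) with (y0 i + RInt (fun t => f t (p n t) i) 0 s) in h1.
  simpl pow in h1.
  pose proof (Rabs_triang (y s i - (y0 i + RInt (fun t => f t (p n t) i) 0 s))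
     (RInt (fun t => f t (p n t) i) 0 s - RInt (fun t => f t (y t) i) 0 s)) as h3.
  rewrite (Rabs_minus_sym (RInt (fun t => f t (p n t) i) 0 s)) in h3.
  replace (y s i - (y0 i + RInt (fun t => f t (p n t) i) 0 s) +
     (RInt (fun t => f t (p n t) i) 0 s - RInt (fun t => f t (y t) i) 0 s))
   with (y s i - (y0 i + RInt (fun t => f t (y t) i) 0 s)) in h3 by ring.
  lra. }
exists y; split; [|split].
- intros i; rewrite fix_eq, RInt_point; apply Rplus_0_r.
- intros s i.
  apply (is_derive_ext (fun s => y0 i + RInt (fun t => f t (y t) i) 0 s)).
  + intros t; now rewrite <- fix_eq.
  + rewrite <- (Rplus_0_l (f s (y s) i)).
    apply (is_derive_plus (fun _ => y0 i)); [exact (is_derive_const (y0 i) s)|].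
    apply (is_derive_RInt (fun t => f t (y t) i) _ 0).
    * apply filter_forall; intros t; apply (RInt_correct (fun t => f t (y t) i)).
      now apply iR.
    * now apply cont.
- intros s i; pose proof (rest 0%nat s i) as h; rewrite pow_O, Rmult_1_r in h; exact h.
Qed.

(** * Goursat's theorem and circle means *)

(** The common point is the supremum of the left ends. *)
Lemma nested_intervals (x w : nat -> R) :
  (forall n, 0 <= w n) ->
  (forall n, x n <= x (S n) /\ x (S n) + w (S n) <= x n + w n) ->
  exists l, forall n, x n <= l <= x n + w n.
Proof.
intros hw hx.
assert (mono : forall n k, x n <= x (n + k)%nat /\ x (n + k)%nat + w (n + k)%nat <= x n + w n).
{ intros n; induction k as [|k IH].
  - rewrite Nat.add_0_r; lra.
  - rewrite Nat.add_succ_r; specialize (hx (n + k)%nat); lra. }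
assert (ub : forall n m, x m <= x n + w n).
{ intros n m; destruct (Nat.le_ge_cases n m) as [h | h].
  - replace m with (n + (m - n))%nat by lia.
    pose proof (mono n (m - n)%nat); pose proof (hw (n + (m - n))%nat); lra.
  - replace n with (m + (n - m))%nat by lia.
    pose proof (mono m (n - m)%nat); pose proof (hw (m + (n - m))%nat); lra. }
destruct (completeness (fun y => exists n, y = x n)) as [l [hl1 hl2]].
- exists (x 0%nat + w 0%nat); intros y [n ->]; apply ub.
- now exists (x 0%nat), 0%nat.
- exists l; intros n; split.
  + apply hl1; now exists n.
  + apply hl2; intros y [m ->]; apply ub.
Qed.

(* [P + i Q] is complex differentiable at [x + i y], with derivative [a + i b]. *)
Definition cr_at (P Q : R -> R -> R) (x y : R) : Prop :=
  exists a b : R, forall eps, 0 < eps -> exists d, 0 < d /\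
    forall x' y', Rabs (x' - x) < d -> Rabs (y' - y) < d ->
      Rabs (P x' y' - P x y - (a * (x' - x) - b * (y' - y)))
        <= eps * (Rabs (x' - x) + Rabs (y' - y))
      /\ Rabs (Q x' y' - Q x y - (b * (x' - x) + a * (y' - y)))
        <= eps * (Rabs (x' - x) + Rabs (y' - y)).

Lemma continuous_of_lipschitz_at (f : R -> R) (x K d : R) :
  0 < d -> (forall x', Rabs (x' - x) < d -> Rabs (f x' - f x) <= K * Rabs (x' - x)) ->
  continuous f x.
Proof.
intros hd hf; apply continuity_pt_filterlim; intros eps he.
assert (hK : 0 < Rabs K + 1) by (pose proof (Rabs_pos K); lra).
exists (Rmin d (eps / (Rabs K + 1))); split.
- apply Rmin_pos; [easy | now apply Rdiv_lt_0_compat].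
- intros y [_ hy]; unfold dist in *; simpl in *; unfold R_dist in *.
  pose proof (Rmin_l d (eps / (Rabs K + 1))); pose proof (Rmin_r d (eps / (Rabs K + 1))).
  assert (h1 : Rabs (y - x) < eps / (Rabs K + 1)) by lra.
  apply Rlt_div_r in h1; [|easy].
  specialize (hf y ltac:(lra)); pose proof (Rle_abs K); pose proof (Rabs_pos (y - x)); nra.
Qed.

Lemma cr_at_continuous (P Q : R -> R -> R) (x y : R) :
  cr_at P Q x y -> continuous (fun t => P x t) y /\ continuous (fun t => Q t y) x.
Proof.
intros [a [b h]]; destruct (h 1 Rlt_0_1) as [d [hd hPQ]]; split.
- apply (continuous_of_lipschitz_at _ y (Rabs b + 1) d hd); intros t ht.
  destruct (hPQ x t) as [h1 _]; [rewrite Rminus_diag, Rabs_R0; lra | easy |].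
  rewrite Rminus_diag, Rabs_R0, Rmult_0_r in h1.
  pose proof (Rabs_triang (P x t - P x y - (0 - b * (t - y))) (- b * (t - y))) as h2.
  rewrite (Rabs_mult (- b)), Rabs_Ropp in h2.
  replace (P x t - P x y - (0 - b * (t - y)) + - b * (t - y)) with (P x t - P x y)
    in h2 by ring; lra.
- apply (continuous_of_lipschitz_at _ x (Rabs b + 1) d hd); intros t ht.
  destruct (hPQ t y) as [_ h1]; [easy | rewrite Rminus_diag, Rabs_R0; lra |].
  rewrite Rminus_diag, Rabs_R0, Rmult_0_r in h1.
  pose proof (Rabs_triang (Q t y - Q x y - (b * (t - x) + 0)) (b * (t - x))) as h2.
  rewrite (Rabs_mult b) in h2.
  replace (Q t y - Q x y - (b * (t - x) + 0) + b * (t - x)) with (Q t y - Q x y)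
    in h2 by ring; lra.
Qed.

(* Imaginary part of the integral of [(P + i Q) dz] along the boundary of a rectangle. *)
Definition boundary_integral (P Q : R -> R -> R) (x0 x1 y0 y1 : R) : R :=
  RInt (fun y => P x1 y - P x0 y) y0 y1 - RInt (fun x => Q x y1 - Q x y0) x0 x1.

Definition cr_on (P Q : R -> R -> R) (x0 x1 y0 y1 : R) : Prop :=
  forall x y, x0 <= x <= x1 -> y0 <= y <= y1 -> cr_at P Q x y.

Lemma cr_on_ex_RInt_P (P Q : R -> R -> R) (x0 x1 y0 y1 x x' : R) :
  y0 <= y1 -> cr_on P Q x0 x1 y0 y1 -> x0 <= x <= x1 -> x0 <= x' <= x1 ->
  ex_RInt (fun y => P x' y - P x y) y0 y1.
Proof.
intros hy h hx hx'; apply (ex_RInt_continuous (fun y => P x' y - P x y)).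
intros y; rewrite Rmin_left, Rmax_right by easy; intros hyy.
apply (continuous_minus (fun y => P x' y) (fun y => P x y));
  now apply (cr_at_continuous P Q), h.
Qed.

Lemma cr_on_ex_RInt_Q (P Q : R -> R -> R) (x0 x1 y0 y1 y y' : R) :
  x0 <= x1 -> cr_on P Q x0 x1 y0 y1 -> y0 <= y <= y1 -> y0 <= y' <= y1 ->
  ex_RInt (fun x => Q x y' - Q x y) x0 x1.
Proof.
intros hx h hy hy'; apply (ex_RInt_continuous (fun x => Q x y' - Q x y)).
intros x; rewrite Rmin_left, Rmax_right by easy; intros hxx.
apply (continuous_minus (fun x => Q x y') (fun x => Q x y));
  now apply (cr_at_continuous P Q), h.
Qed.

Lemma RInt_split_diff (f : R -> R -> R) (a b u v m : R) :
  ex_RInt (fun t => f m t - f u t) a b -> ex_RInt (fun t => f v t - f m t) a b ->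
  RInt (fun t => f v t - f u t) a b
  = RInt (fun t => f m t - f u t) a b + RInt (fun t => f v t - f m t) a b.
Proof.
intros h1 h2.
refine (eq_trans _ (RInt_plus (V := R_CompleteNormedModule) _ _ a b h1 h2)).
apply RInt_ext; intros t _; unfold plus; simpl; lra.
Qed.

Lemma boundary_integral_split_x (P Q : R -> R -> R) (x0 xm x1 y0 y1 : R) :
  x0 <= xm <= x1 -> y0 <= y1 -> cr_on P Q x0 x1 y0 y1 ->
  boundary_integral P Q x0 x1 y0 y1
  = boundary_integral P Q x0 xm y0 y1 + boundary_integral P Q xm x1 y0 y1.
Proof.
intros hx hy h; unfold boundary_integral.
rewrite (RInt_split_diff P y0 y1 x0 x1 xm) by
  (apply (cr_on_ex_RInt_P P Q x0 x1); auto; lra).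
rewrite <- (RInt_Chasles (fun x => Q x y1 - Q x y0) x0 xm x1).
- unfold plus; simpl; ring.
- apply (cr_on_ex_RInt_Q P Q x0 xm y0 y1); try lra; intros x y h1 h2; apply h; lra.
- apply (cr_on_ex_RInt_Q P Q xm x1 y0 y1); try lra; intros x y h1 h2; apply h; lra.
Qed.

Lemma boundary_integral_split_y (P Q : R -> R -> R) (x0 x1 y0 ym y1 : R) :
  x0 <= x1 -> y0 <= ym <= y1 -> cr_on P Q x0 x1 y0 y1 ->
  boundary_integral P Q x0 x1 y0 y1
  = boundary_integral P Q x0 x1 y0 ym + boundary_integral P Q x0 x1 ym y1.
Proof.
intros hx hy h; unfold boundary_integral.
rewrite (RInt_split_diff (fun y x => Q x y) x0 x1 y0 y1 ym) by
  (apply (cr_on_ex_RInt_Q P Q x0 x1 y0 y1); auto; lra).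
rewrite <- (RInt_Chasles (fun y => P x1 y - P x0 y) y0 ym y1).
- unfold plus; simpl; ring.
- apply (cr_on_ex_RInt_P P Q x0 x1 y0 ym); try lra; intros x y h1 h2; apply h; lra.
- apply (cr_on_ex_RInt_P P Q x0 x1 ym y1); try lra; intros x y h1 h2; apply h; lra.
Qed.

Lemma RInt_near_const (f : R -> R) (a b c e : R) :
  a <= b -> ex_RInt f a b -> (forall t, a <= t <= b -> Rabs (f t - c) <= e) ->
  Rabs (RInt f a b - c * (b - a)) <= e * (b - a).
Proof.
intros hab hf h.
apply (norm_RInt_le (V := R_NormedModule) (fun t => f t - c) (fun _ => e) a b); auto.
- apply (is_RInt_minus (V := R_NormedModule) f (fun _ => c)).
  + now apply (RInt_correct (V := R_CompleteNormedModule)).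
  + replace (c * (b - a)) with (scal (b - a) c) by (unfold scal; simpl; unfold mult; simpl; ring).
    apply (is_RInt_const (V := R_NormedModule)).
- replace (e * (b - a)) with (scal (b - a) e) by (unfold scal; simpl; unfold mult; simpl; ring).
  apply (is_RInt_const (V := R_NormedModule)).
Qed.

(** The affine part of [P + i Q] contributes [a] times the area to each of the two integrals, and
    these contributions cancel. Only the error term survives, of size [eps] times the half
    perimeter, integrated over the sides. *)
Lemma boundary_integral_small (P Q : R -> R -> R) (x y : R) :
  cr_at P Q x y -> forall eps, 0 < eps -> exists d, 0 < d /\
    forall x0 x1 y0 y1, x0 <= x <= x1 -> y0 <= y <= y1 -> x1 - x0 < d -> y1 - y0 < d ->
      cr_on P Q x0 x1 y0 y1 ->
      Rabs (boundary_integral P Q x0 x1 y0 y1) <= eps * ((x1 - x0) + (y1 - y0)) ^ 2.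
Proof.
intros [a [b h]] eps he.
destruct (h (eps / 2) ltac:(lra)) as [d [hd hPQ]]; clear h.
exists d; split; [easy|]; intros x0 x1 y0 y1 hx hy hdx hdy hcr.
set (s := (x1 - x0) + (y1 - y0)).
assert (est : forall x' y', x0 <= x' <= x1 -> y0 <= y' <= y1 ->
  Rabs (P x' y' - P x y - (a * (x' - x) - b * (y' - y))) <= eps / 2 * s
  /\ Rabs (Q x' y' - Q x y - (b * (x' - x) + a * (y' - y))) <= eps / 2 * s).
{ intros x' y' hx' hy'.
  assert (h1 : Rabs (x' - x) <= x1 - x0) by (apply Rabs_le; lra).
  assert (h2 : Rabs (y' - y) <= y1 - y0) by (apply Rabs_le; lra).
  destruct (hPQ x' y') as [h3 h4]; try lra.
  assert (h5 : eps / 2 * (Rabs (x' - x) + Rabs (y' - y)) <= eps / 2 * s)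
    by (apply Rmult_le_compat_l; unfold s; lra).
  lra. }
assert (h1 : Rabs (RInt (fun y => P x1 y - P x0 y) y0 y1 - a * (x1 - x0) * (y1 - y0))
             <= eps * s * (y1 - y0)).
{ apply RInt_near_const; [lra | apply (cr_on_ex_RInt_P P Q x0 x1); auto; lra |].
  intros t ht.
  destruct (est x1 t ltac:(lra) ht) as [h1 _]; destruct (est x0 t ltac:(lra) ht) as [h2 _].
  apply Rabs_le; apply Rabs_le_between in h1; apply Rabs_le_between in h2; lra. }
assert (h2 : Rabs (RInt (fun x => Q x y1 - Q x y0) x0 x1 - a * (y1 - y0) * (x1 - x0))
             <= eps * s * (x1 - x0)).
{ apply RInt_near_const; [lra | apply (cr_on_ex_RInt_Q P Q x0 x1 y0 y1); auto; lra |].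
  intros t ht.
  destruct (est t y1 ht ltac:(lra)) as [_ h3]; destruct (est t y0 ht ltac:(lra)) as [_ h4].
  apply Rabs_le; apply Rabs_le_between in h3; apply Rabs_le_between in h4; lra. }
unfold boundary_integral; apply Rabs_le.
apply Rabs_le_between in h1; apply Rabs_le_between in h2.
replace (eps * s ^ 2) with (eps * s * (y1 - y0) + eps * s * (x1 - x0)) by (unfold s; ring).
lra.
Qed.

Lemma half_large (u v t : R) : t <= Rabs (u + v) -> t / 2 <= Rabs u \/ t / 2 <= Rabs v.
Proof.
intros h; pose proof (Rabs_triang u v).
destruct (Rle_lt_dec (t / 2) (Rabs u)); [left | right]; lra.
Qed.

(* Bisection: nested rectangles on which the boundary integral keeps at least
   [4^-n] of its size shrink to a point of complex differentiability. *)
Lemma goursat (P Q : R -> R -> R) (x0 x1 y0 y1 : R) :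
  x0 <= x1 -> y0 <= y1 -> cr_on P Q x0 x1 y0 y1 -> boundary_integral P Q x0 x1 y0 y1 = 0.
Proof.
intros hx hy hcr.
set (J := boundary_integral P Q x0 x1 y0 y1).
set (W := x1 - x0); set (H := y1 - y0).
set (w := fun n => W / 2 ^ n); set (h := fun n => H / 2 ^ n).
assert (pow2 : forall n, 0 < 2 ^ n) by (intros; apply pow_lt; lra).
assert (w0 : forall n, 0 <= w n) by (intros; apply Rdiv_le_0_compat; unfold W; auto; lra).
assert (h0 : forall n, 0 <= h n) by (intros; apply Rdiv_le_0_compat; unfold H; auto; lra).
assert (wS : forall n, w n = w (S n) + w (S n)).
{ intros n; unfold w; simpl; pose proof (pow2 n); field; lra. }
assert (hS : forall n, h n = h (S n) + h (S n)).
{ intros n; unfold h; simpl; pose proof (pow2 n); field; lra. }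
set (bad := fun n (p : R * R) =>
  x0 <= fst p /\ fst p + w n <= x1 /\ y0 <= snd p /\ snd p + h n <= y1
  /\ Rabs J / 4 ^ n
     <= Rabs (boundary_integral P Q (fst p) (fst p + w n) (snd p) (snd p + h n))).
set (sub := fun n (p p' : R * R) =>
  fst p <= fst p' /\ fst p' + w (S n) <= fst p + w n
  /\ snd p <= snd p' /\ snd p' + h (S n) <= snd p + h n).
assert (step : forall n p, bad n p -> exists p', bad (S n) p' /\ sub n p p').
{ intros n [x y] (b1 & b2 & b3 & b4 & b5); simpl in b1, b2, b3, b4, b5.
  pose proof (w0 (S n)); pose proof (h0 (S n)); pose proof (wS n); pose proof (hS n).
  pose proof (pow_lt 4 n ltac:(lra)) as p4.
  assert (hcr' : forall a b c d, x0 <= a -> b <= x1 -> y0 <= c -> d <= y1 -> cr_on P Q a b c d)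
    by (intros a b c d h1 h2 h3 h4 s t hs ht; apply hcr; lra).
  (* A cut in [x] and then a cut in [y]: each leaves a half that carries at least half of the
     integral. *)
  rewrite (boundary_integral_split_x P Q x (x + w (S n))) in b5 by (try apply hcr'; lra).
  replace (Rabs J / 4 ^ S n) with (Rabs J / 4 ^ n / 2 / 2) in * by (simpl; field; lra).
  assert (E4 : Rabs J / 4 ^ S n = Rabs J / 4 ^ n / 2 / 2) by (simpl; field; lra).
  apply half_large in b5.
  assert (Hx : exists x', x <= x' /\ x' + w (S n) <= x + w n /\
    Rabs J / 4 ^ n / 2 <= Rabs (boundary_integral P Q x' (x' + w (S n)) y (y + h n))).
  { destruct b5 as [b5 | b5]; [exists x | exists (x + w (S n))]; repeat split; try lra.
    now replace (x + w (S n) + w (S n)) with (x + w n) by lra. }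
  destruct Hx as (x' & hx1 & hx2 & b6).
  rewrite (boundary_integral_split_y P Q x' _ y (y + h (S n))) in b6 by (try apply hcr'; lra).
  apply half_large in b6.
  destruct b6 as [b6 | b6]; [exists (x', y) | exists (x', y + h (S n))]; unfold bad, sub; simpl fst;
    simpl snd; rewrite E4; repeat split; try lra.
  now replace (y + h (S n) + h (S n)) with (y + h n) by lra. }
assert (bad0 : bad 0%nat (x0, y0)).
{ unfold bad, w, h, W, H; simpl.
  replace (x0 + (x1 - x0) / 1) with x1 by field; replace (y0 + (y1 - y0) / 1) with y1 by field.
  fold J; repeat split; try lra. }
(* The choice of a bad subrectangle is made total in [p], so that the sequence can be defined before
   its terms are known to be bad. *)
assert (next : forall n p, {p' | bad n p -> bad (S n) p' /\ sub n p p'}).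
{ intros n p; apply constructive_indefinite_description.
  destruct (classic (bad n p)) as [hb | hb].
  - destruct (step n p hb) as [p' hp']; now exists p'.
  - now exists p. }
set (sq := fix sq n := match n with O => (x0, y0) | S n => proj1_sig (next n (sq n)) end).
assert (sqbad : forall n, bad n (sq n)).
{ induction n as [|n IH]; [easy | exact (proj1 (proj2_sig (next n (sq n)) IH))]. }
assert (sqsub : forall n, sub n (sq n) (sq (S n))).
{ intros n; exact (proj2 (proj2_sig (next n (sq n)) (sqbad n))). }
destruct (nested_intervals (fun n => fst (sq n)) w w0) as [lx hlx].
{ intros n; destruct (sqsub n) as (u1 & u2 & _); auto. }
destruct (nested_intervals (fun n => snd (sq n)) h h0) as [ly hly].
{ intros n; destruct (sqsub n) as (_ & _ & u1 & u2); auto. }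
destruct (Req_dec J 0) as [h1 | h1]; [easy | exfalso].
apply Rabs_pos_lt in h1.
(* With this value the estimate [|J| <= eps (W + H)^2] gives [|J| <= |J| / 2]; the summand 1 keeps
   the denominator positive. *)
set (eps := Rabs J / (2 * ((W + H) ^ 2 + 1))).
assert (hs : 0 < (W + H) ^ 2 + 1) by (pose proof (pow2_ge_0 (W + H)); lra).
assert (he : 0 < eps) by (apply Rdiv_lt_0_compat; lra).
destruct (boundary_integral_small P Q lx ly) with (eps := eps) as [d [hd hsmall]]; auto.
{ destruct (sqbad 0%nat) as (b1 & b2 & b3 & b4 & _).
  specialize (hlx 0%nat); specialize (hly 0%nat); simpl in hlx, hly; apply hcr; lra. }
destruct (pow_lt_1_zero (1 / 2)) with (y := d / (W + H + 1)) as [n hn].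
{ rewrite Rabs_pos_eq; lra. }
{ apply Rdiv_lt_0_compat; unfold W, H; lra. }
specialize (hn n (Nat.le_refl n)).
rewrite Rabs_pos_eq in hn by (apply pow_le; lra).
assert (hWH : 0 <= W /\ 0 <= H) by (unfold W, H; lra).
apply Rlt_div_r in hn; [|lra].
assert (e2 : (1 / 2) ^ n = / 2 ^ n) by (rewrite <- pow_inv; f_equal; lra).
rewrite e2 in hn; pose proof (pow2 n) as p2; pose proof (Rinv_0_lt_compat _ p2) as p2'.
destruct (sqbad n) as (b1 & b2 & b3 & b4 & b5).
specialize (hlx n); specialize (hly n); simpl in hlx, hly.
specialize (hsmall _ _ _ _ hlx hly).
assert (J4 : Rabs J / 4 ^ n <= eps * ((W + H) ^ 2 / 4 ^ n)).
{ eapply Rle_trans; [apply b5|]; eapply Rle_trans; [apply hsmall|].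
  - unfold w, Rdiv; nra.
  - unfold h, Rdiv; nra.
  - intros s t hs' ht; apply hcr; lra.
  - right; unfold w, h; replace (4 ^ n) with (2 ^ n * 2 ^ n)
      by (rewrite <- Rpow_mult_distr; f_equal; lra).
    field; lra. }
pose proof (pow_lt 4 n ltac:(lra)) as p4.
apply Rmult_le_compat_r with (r := 4 ^ n) in J4; [|lra].
replace (Rabs J / 4 ^ n * 4 ^ n) with (Rabs J) in J4 by (field; lra).
replace (eps * ((W + H) ^ 2 / 4 ^ n) * 4 ^ n) with (eps * (W + H) ^ 2) in J4 by (field; lra).
assert (E : eps * ((W + H) ^ 2 + 1) = Rabs J / 2) by (unfold eps; field; lra).
lra.
Qed.

(** * Complex derivatives *)

Definition is_cderive (g : C -> C) (z l : C) : Prop :=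
  @is_derive C_AbsRing C_NormedModule g z l.

Lemma is_cderive_eps (g : C -> C) (z l : C) :
  is_cderive g z l <->
  forall eps, 0 < eps -> exists d, 0 < d /\
    forall w, Cmod (w - z) < d -> Cmod (g w - g z - l * (w - z)) <= eps * Cmod (w - z).
Proof.
split.
- intros [_ h] eps he.
  destruct (h z (fun P hP => hP) (mkposreal eps he)) as [d hd].
  exists d; split; [apply cond_pos|]; intros w hw.
  specialize (hd w hw); rewrite Cmult_comm; exact hd.
- intros h; split; [apply is_linear_scal_l|].
  intros x hx; rewrite <- (is_filter_lim_locally_unique _ _ hx).
  intros eps; destruct (h eps (cond_pos eps)) as [d [hd hw]].
  exists (mkposreal d hd); intros w hwd; specialize (hw w hwd).
  rewrite Cmult_comm in hw; exact hw.
Qed.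

(* Coquelicot gives [C] two normed-module structures over itself, with different
   uniform structures; product and chain rule are only available for this one. *)
Lemma is_cderive_absring (g : C -> C) (z l : C) :
  is_cderive g z l <-> @is_derive C_AbsRing (AbsRing_NormedModule C_AbsRing) g z l.
Proof.
rewrite is_cderive_eps; split.
- intros h; split; [apply is_linear_scal_l|].
  intros x hx; rewrite <- (is_filter_lim_locally_unique _ _ hx).
  intros eps; destruct (h eps (cond_pos eps)) as [d [hd hw]].
  exists (mkposreal d hd); intros w hwd; specialize (hw w hwd).
  rewrite Cmult_comm in hw; exact hw.
- intros [_ h] eps he.
  destruct (h z (fun P hP => hP) (mkposreal eps he)) as [d hd].
  exists d; split; [apply cond_pos|]; intros w hw.
  specialize (hd w hw); rewrite Cmult_comm; exact hd.
Qed.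

Lemma is_derive_eps (f : R -> R) (x l : R) :
  is_derive f x l ->
  forall eps, 0 < eps -> exists d, 0 < d /\
    forall y, Rabs (y - x) < d -> Rabs (f y - f x - l * (y - x)) <= eps * Rabs (y - x).
Proof.
intros [_ h] eps he.
destruct (h x (fun P hP => hP) (mkposreal eps he)) as [d hd].
exists d; split; [apply cond_pos|]; intros w hw.
specialize (hd w hw); rewrite Rmult_comm; exact hd.
Qed.

Lemma C_ext (z w : C) : Re z = Re w -> Im z = Im w -> z = w.
Proof. destruct z, w; simpl; congruence. Qed.

Lemma Im_le_Cmod (z : C) : Rabs (Im z) <= Cmod z.
Proof. eapply Rle_trans; [|apply Rmax_Cmod]; apply Rmax_r. Qed.

Lemma Cmod_le_Re_Im (z : C) : Cmod z <= Rabs (Re z) + Rabs (Im z).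
Proof.
unfold Cmod; apply Rsqr_incr_0_var.
- rewrite Rsqr_sqrt by nra.
  rewrite <- (pow2_abs (fst z)), <- (pow2_abs (snd z)); unfold Rsqr, Re, Im.
  pose proof (Rabs_pos (fst z)); pose proof (Rabs_pos (snd z)); nra.
- pose proof (Rabs_pos (Re z)); pose proof (Rabs_pos (Im z)); lra.
Qed.

Lemma is_cderive_const (k z : C) : is_cderive (fun _ => k) z 0%C.
Proof. exact (is_derive_const (K := C_AbsRing) (V := C_NormedModule) k z). Qed.

Lemma is_cderive_id (z : C) : is_cderive (fun w => w) z 1%C.
Proof. apply is_cderive_absring; exact (is_derive_id (K := C_AbsRing) z). Qed.

Lemma is_cderive_plus (f g : C -> C) (z l m : C) :
  is_cderive f z l -> is_cderive g z m -> is_cderive (fun w => f w + g w)%C z (l + m)%C.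
Proof. exact (is_derive_plus (K := C_AbsRing) (V := C_NormedModule) f g z l m). Qed.

Lemma is_cderive_mult (f g : C -> C) (z l m : C) :
  is_cderive f z l -> is_cderive g z m ->
  is_cderive (fun w => f w * g w)%C z (l * g z + f z * m)%C.
Proof.
rewrite !is_cderive_absring; intros hf hg.
exact (is_derive_mult (K := C_AbsRing) f g z l m hf hg Cmult_comm).
Qed.

Lemma is_cderive_scal (k : C) (f : C -> C) (z l : C) :
  is_cderive f z l -> is_cderive (fun w => k * f w)%C z (k * l)%C.
Proof.
intros h; replace (k * l)%C with (0 * f z + k * l)%C by ring.
exact (is_cderive_mult _ _ z _ _ (is_cderive_const k z) h).
Qed.

Lemma is_cderive_eq (g : C -> C) (z l m : C) : l = m -> is_cderive g z l -> is_cderive g z m.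
Proof. now intros ->. Qed.

Lemma is_cderive_ext (f g : C -> C) (z l : C) :
  (forall w, f w = g w) -> is_cderive f z l -> is_cderive g z l.
Proof. intros h; exact (is_derive_ext (K := C_AbsRing) (V := C_NormedModule) f g z l h). Qed.

Lemma is_cderive_ext_near (f g : C -> C) (z l : C) (d : R) :
  0 < d -> (forall w, Cmod (w - z) < d -> f w = g w) -> is_cderive f z l -> is_cderive g z l.
Proof.
rewrite !is_cderive_eps; intros hd hfg h eps he; destruct (h eps he) as [d' [hd' hw]].
exists (Rmin d d'); split; [now apply Rmin_pos|]; intros w hwd.
pose proof (Rmin_l d d'); pose proof (Rmin_r d d').
rewrite <- !hfg; [apply hw; lra | | lra].
replace (z - z)%C with (RtoC 0) by ring; now rewrite Cmod_0.
Qed.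

Lemma is_cderive_comp (f g : C -> C) (z l m : C) :
  is_cderive f (g z) l -> is_cderive g z m -> is_cderive (fun w => f (g w)) z (m * l)%C.
Proof.
intros hf; rewrite is_cderive_absring.
exact (is_derive_comp (K := C_AbsRing) (V := C_NormedModule) f g z l m hf).
Qed.

Lemma is_cderive_unique (f : C -> C) (z l m : C) :
  is_cderive f z l -> is_cderive f z m -> l = m.
Proof.
intros h1 h2; rewrite <- (is_C_derive_unique f z l h1); exact (is_C_derive_unique f z m h2).
Qed.

Lemma is_cderive_inv (z : C) : z <> 0%C -> is_cderive (fun w => / w)%C z (- (/ z * / z))%C.
Proof.
intros hz; apply is_cderive_eps; intros eps he.
assert (hm : 0 < Cmod z) by now apply Cmod_gt_0.
set (m := Cmod z) in *.
(* The first bound keeps [|w| >= m / 2]; the second compensates the factor [1 / (m m (m / 2))] of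
   the error term. *)
exists (Rmin (m / 2) (eps * m ^ 3 / 2)); split.
{ apply Rmin_pos; [lra|]; assert (0 < m ^ 3) by now apply pow_lt.
  apply Rdiv_lt_0_compat; nra. }
intros w hw.
pose proof (Rmin_l (m / 2) (eps * m ^ 3 / 2)); pose proof (Rmin_r (m / 2) (eps * m ^ 3 / 2)).
assert (hwm : m / 2 <= Cmod w).
{ pose proof (Cmod_triangle (z - w) w) as h; replace (z - w + w)%C with z in h by ring.
  replace (z - w)%C with (- (w - z))%C in h by ring; rewrite Cmod_opp in h; fold m in h; lra. }
assert (hw0 : w <> 0%C) by (apply Cmod_gt_0; lra).
replace (/ w - / z - - (/ z * / z) * (w - z))%C with ((w - z) * ((w - z) * (/ z * / z * / w)))%C
  by (field; auto).
rewrite Cmod_mult, (Rmult_comm eps); apply Rmult_le_compat_l; [apply Cmod_ge_0|].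
rewrite !Cmod_mult, !Cmod_inv by auto; fold m.
apply Rle_trans with (eps * m ^ 3 / 2 * (/ m * / m * / (m / 2))).
- apply Rmult_le_compat; [apply Cmod_ge_0 | | lra |].
  + repeat apply Rmult_le_pos; apply Rlt_le, Rinv_0_lt_compat; lra.
  + apply Rmult_le_compat_l.
    * apply Rmult_le_pos; apply Rlt_le, Rinv_0_lt_compat; lra.
    * apply Rinv_le_contravar; lra.
- right; field; lra.
Qed.

(** * Complex-valued functions of a real variable *)

Definition cder (f : R -> C) (x : R) (l : C) : Prop :=
  is_derive (fun t => Re (f t)) x (Re l) /\ is_derive (fun t => Im (f t)) x (Im l).

Lemma cder_const (k : C) (x : R) : cder (fun _ => k) x 0%C.
Proof. split; apply (is_derive_const (V := R_NormedModule)). Qed.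

Lemma cder_plus (f g : R -> C) (x : R) (l m : C) :
  cder f x l -> cder g x m -> cder (fun t => f t + g t)%C x (l + m)%C.
Proof.
intros [h1 h2] [h3 h4]; split.
- exact (is_derive_plus (V := R_NormedModule) _ _ _ _ _ h1 h3).
- exact (is_derive_plus (V := R_NormedModule) _ _ _ _ _ h2 h4).
Qed.
Arguments cder_plus {_ _ _ _ _}.

Lemma cder_mult (f g : R -> C) (x : R) (l m : C) :
  cder f x l -> cder g x m -> cder (fun t => f t * g t)%C x (l * g x + f x * m)%C.
Proof.
intros [h1 h2] [h3 h4].
assert (mul : forall (u v : R -> R) a b, is_derive u x a -> is_derive v x b ->
  is_derive (fun t => u t * v t) x (a * v x + u x * b)).
{ intros u v a b hu hv; exact (is_derive_mult u v x a b hu hv Rmult_comm). }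
split.
- replace (Re (l * g x + f x * m)%C) with
    ((Re l * Re (g x) + Re (f x) * Re m) - (Im l * Im (g x) + Im (f x) * Im m))
    by (unfold Re, Im; simpl; ring).
  apply (is_derive_minus (V := R_NormedModule) (fun t => Re (f t) * Re (g t))
    (fun t => Im (f t) * Im (g t))); now apply mul.
- replace (Im (l * g x + f x * m)%C) with
    ((Re l * Im (g x) + Re (f x) * Im m) + (Im l * Re (g x) + Im (f x) * Re m))
    by (unfold Re, Im; simpl; ring).
  apply (is_derive_plus (V := R_NormedModule) (fun t => Re (f t) * Im (g t))
    (fun t => Im (f t) * Re (g t))); now apply mul.
Qed.

Lemma cder_scal (k : C) (f : R -> C) (x : R) (l : C) :
  cder f x l -> cder (fun t => k * f t)%C x (k * l)%C.
Proof.
intros h; replace (k * l)%C with (0 * f x + k * l)%C by ring.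
exact (cder_mult _ _ x _ _ (cder_const k x) h).
Qed.

Lemma cder_conj (f : R -> C) (x : R) (l : C) :
  cder f x l -> cder (fun t => Cconj (f t)) x (Cconj l).
Proof.
intros [h1 h2]; split; [exact h1|].
exact (is_derive_opp (V := R_NormedModule) _ _ _ h2).
Qed.
Arguments cder_conj {_ _ _}.

Lemma cder_real (f : R -> R) (x l : R) :
  is_derive f x l -> cder (fun t => RtoC (f t)) x (RtoC l).
Proof. intros h; split; [exact h | exact (is_derive_const (V := R_NormedModule) 0 x)]. Qed.

Lemma cder_eq (f : R -> C) (x : R) (l m : C) : l = m -> cder f x l -> cder f x m.
Proof. now intros ->. Qed.

Lemma cder_ext (f g : R -> C) (x : R) (l : C) :
  (forall t, f t = g t) -> cder f x l -> cder g x l.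
Proof.
intros h [h1 h2]; split.
- apply (is_derive_ext (fun t => Re (f t))); [intros t; now rewrite h | easy].
- apply (is_derive_ext (fun t => Im (f t))); [intros t; now rewrite h | easy].
Qed.

Lemma cder_unique (f : R -> C) (x : R) (l m : C) : cder f x l -> cder f x m -> l = m.
Proof.
intros [h1 h2] [h3 h4]; apply C_ext.
- now rewrite <- (is_derive_unique _ _ _ h1), <- (is_derive_unique _ _ _ h3).
- now rewrite <- (is_derive_unique _ _ _ h2), <- (is_derive_unique _ _ _ h4).
Qed.

Lemma cder_eps (f : R -> C) (x : R) (l : C) :
  cder f x l <->
  forall eps, 0 < eps -> exists d, 0 < d /\ forall t, Rabs (t - x) < d ->
    Cmod (f t - f x - l * RtoC (t - x))%C <= eps * Rabs (t - x).
Proof.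
split.
- intros [h1 h2] eps he.
  destruct (is_derive_eps _ _ _ h1 (eps / 2) ltac:(lra)) as [d1 [hd1 H1]].
  destruct (is_derive_eps _ _ _ h2 (eps / 2) ltac:(lra)) as [d2 [hd2 H2]].
  exists (Rmin d1 d2); split; [now apply Rmin_pos|]; intros t ht.
  pose proof (Rmin_l d1 d2); pose proof (Rmin_r d1 d2).
  specialize (H1 t ltac:(lra)); specialize (H2 t ltac:(lra)).
  eapply Rle_trans; [apply Cmod_le_Re_Im|].
  replace (Re (f t - f x - l * RtoC (t - x))%C) with (Re (f t) - Re (f x) - Re l * (t - x))
    by (unfold Re, Im; simpl; ring).
  replace (Im (f t - f x - l * RtoC (t - x))%C) with (Im (f t) - Im (f x) - Im l * (t - x))
    by (unfold Re, Im; simpl; ring).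
  lra.
- intros h.
  assert (hR : forall (u : R -> R) a, (forall t, Rabs (u t - u x - a * (t - x))
      <= Cmod (f t - f x - l * RtoC (t - x))%C) -> is_derive u x a).
  { intros u a hu; split; [apply is_linear_scal_l|].
    intros y hy; rewrite <- (is_filter_lim_locally_unique _ _ hy).
    intros eps; destruct (h eps (cond_pos eps)) as [d [hd hw]].
    exists (mkposreal d hd); intros w hwd; specialize (hw w hwd).
    eapply Rle_trans; [|exact hw]; eapply Rle_trans; [|apply hu].
    right; rewrite (Rmult_comm a); reflexivity. }
  split; apply hR; intros t.
  + eapply Rle_trans; [|apply re_le_Cmod]; right; f_equal; unfold Re, Im; simpl; ring.
  + eapply Rle_trans; [|apply Im_le_Cmod]; right; f_equal; unfold Re, Im; simpl; ring.
Qed.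

(** A chain rule across two fields, complex outside and real inside, hence proved by direct
    estimates. *)
Lemma cder_comp (g : C -> C) (f : R -> C) (x : R) (l v : C) :
  is_cderive g (f x) l -> cder f x v -> cder (fun t => g (f t)) x (l * v)%C.
Proof.
rewrite is_cderive_eps, !cder_eps; intros hg hf eps he.
set (M := Cmod v + 1).
assert (hM : 0 < M) by (unfold M; pose proof (Cmod_ge_0 v); lra).
set (N := Cmod l + 1).
assert (hN : 0 < N) by (unfold N; pose proof (Cmod_ge_0 l); lra).
destruct (hg (eps / (2 * M))) as [d1 [hd1 H1]]; [apply Rdiv_lt_0_compat; lra|].
destruct (hf 1 Rlt_0_1) as [d2 [hd2 H2]].
destruct (hf (eps / (2 * N))) as [d3 [hd3 H3]]; [apply Rdiv_lt_0_compat; lra|].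
exists (Rmin (Rmin d2 d3) (d1 / M)); split.
{ repeat apply Rmin_pos; auto; now apply Rdiv_lt_0_compat. }
intros t ht.
pose proof (Rmin_l (Rmin d2 d3) (d1 / M)); pose proof (Rmin_r (Rmin d2 d3) (d1 / M)).
pose proof (Rmin_l d2 d3); pose proof (Rmin_r d2 d3).
specialize (H2 t ltac:(lra)); specialize (H3 t ltac:(lra)).
assert (hft : Cmod (f t - f x)%C <= M * Rabs (t - x)).
{ replace (f t - f x)%C with ((f t - f x - v * RtoC (t - x)) + v * RtoC (t - x))%C by ring.
  eapply Rle_trans; [apply Cmod_triangle|]; rewrite Cmod_mult, Cmod_R; unfold M; lra. }
assert (h1 : Rabs (t - x) < d1 / M) by lra.
apply Rlt_div_r in h1; [|easy].
specialize (H1 (f t) ltac:(lra)).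
replace (g (f t) - g (f x) - l * v * RtoC (t - x))%C with
  ((g (f t) - g (f x) - l * (f t - f x)) + l * (f t - f x - v * RtoC (t - x)))%C by ring.
eapply Rle_trans; [apply Cmod_triangle|]; rewrite Cmod_mult.
assert (h2 : eps / (2 * M) * Cmod (f t - f x)%C <= eps / (2 * M) * (M * Rabs (t - x))).
{ apply Rmult_le_compat_l; [|easy]; apply Rlt_le, Rdiv_lt_0_compat; lra. }
assert (h3 : Cmod l * Cmod (f t - f x - v * RtoC (t - x))%C
   <= N * (eps / (2 * N) * Rabs (t - x))).
{ apply Rmult_le_compat; try apply Cmod_ge_0; [unfold N; lra | easy]. }
replace (eps / (2 * M) * (M * Rabs (t - x))) with (eps / 2 * Rabs (t - x)) in h2 by (field; lra).
replace (N * (eps / (2 * N) * Rabs (t - x))) with (eps / 2 * Rabs (t - x)) in h3 by (field; lra).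
lra.
Qed.

Lemma is_derive_zero_const (f : R -> R) : (forall x, is_derive f x 0) -> forall x y, f x = f y.
Proof.
intros h x y.
destruct (MVT_gen f y x (fun _ => 0)) as [c [_ hc]].
- intros t _; apply h.
- intros t _; apply continuity_pt_filterlim, (ex_derive_continuous f); eexists; apply h.
- lra.
Qed.

Lemma cder_zero_const (f : R -> C) : (forall x, cder f x 0%C) -> forall x y, f x = f y.
Proof.
intros h x y; apply C_ext.
- apply (is_derive_zero_const (fun t => Re (f t))); intros t; apply h.
- apply (is_derive_zero_const (fun t => Im (f t))); intros t; apply h.
Qed.

(** The mean value theorem applies to the real and imaginary parts separately, whence the factor
    2. *)
Lemma cder_bounded_increment (f f' : R -> C) (K x y : R) :
  (forall t, cder f t (f' t)) -> (forall t, Rmin x y <= t <= Rmax x y -> Cmod (f' t) <= K) ->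
  Cmod (f y - f x)%C <= 2 * K * Rabs (y - x).
Proof.
intros hf hK.
assert (hR : forall u u' : R -> R, (forall t, is_derive u t (u' t)) ->
  (forall t, Rabs (u' t) <= Cmod (f' t)) -> Rabs (u y - u x) <= K * Rabs (y - x)).
{ intros u u' hu hu'.
  destruct (MVT_gen u x y u') as [c [hc E]].
  - intros t _; apply hu.
  - intros t _; apply continuity_pt_filterlim, (ex_derive_continuous u); eexists; apply hu.
  - rewrite E, Rabs_mult; apply Rmult_le_compat_r; [apply Rabs_pos|].
    eapply Rle_trans; [apply hu' | now apply hK]. }
eapply Rle_trans; [apply Cmod_le_Re_Im|].
pose proof (hR (fun t => Re (f t)) (fun t => Re (f' t)) (fun t => proj1 (hf t))
  (fun t => re_le_Cmod _)) as h1.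
pose proof (hR (fun t => Im (f t)) (fun t => Im (f' t)) (fun t => proj2 (hf t))
  (fun t => Im_le_Cmod _)) as h2.
change (Re (f y - f x)%C) with (Re (f y) - Re (f x)).
change (Im (f y - f x)%C) with (Im (f y) - Im (f x)); lra.
Qed.

(** * The unit circle and the complex exponential *)

Definition cis (t : R) : C := (cos t, sin t).

Lemma Cmod_cis (t : R) : Cmod (cis t) = 1.
Proof.
unfold Cmod, cis; simpl fst; simpl snd.
pose proof (sin2_cos2 t) as h; unfold Rsqr in h.
replace (cos t ^ 2 + sin t ^ 2) with 1 by lra; apply sqrt_1.
Qed.

Lemma cder_cis (t : R) : cder cis t (Ci * cis t)%C.
Proof.
split; unfold cis, Ci, Re, Im; simpl; auto_derive; auto; ring.
Qed.

Lemma unit_circle_angle (x y : R) :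
  x ^ 2 + y ^ 2 = 1 -> exists t, 0 <= t <= 2 * PI /\ cos t = x /\ sin t = y.
Proof.
intros h.
assert (hx : -1 <= x <= 1) by nra.
pose proof (acos_bound x) as hb.
pose proof (cos_acos x hx) as hc.
pose proof (sin_acos x hx) as hs.
replace (1 - x²) with (y²) in hs by (unfold Rsqr; lra).
rewrite sqrt_Rsqr_abs in hs.
destruct (Rle_lt_dec 0 y) as [hy | hy].
- exists (acos x); rewrite Rabs_pos_eq in hs by easy; lra.
- exists (2 * PI - acos x).
  rewrite Rabs_left in hs by easy.
  replace (2 * PI - acos x) with (- acos x + 2 * INR 1 * PI) by (simpl; ring).
  rewrite cos_period, sin_period, cos_neg, sin_neg; simpl; lra.
Qed.

Lemma Cmod_1_cis (z : C) : Cmod z = 1 -> exists t, 0 <= t <= 2 * PI /\ z = cis t.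
Proof.
intros h.
assert (h2 : Re z ^ 2 + Im z ^ 2 = 1) by (rewrite <- Cmod2_alt, h; ring).
destruct (unit_circle_angle _ _ h2) as (t & ht & h3 & h4).
exists t; split; [easy|]; apply C_ext; unfold cis; simpl; auto.
Qed.

Lemma cexp_polar (x y : R) : cexp (x, y) = (RtoC (exp x) * cis y)%C.
Proof. apply C_ext; unfold cexp, cis, Re, Im; simpl; ring. Qed.

Lemma cexp_plus (z w : C) : cexp (z + w)%C = (cexp z * cexp w)%C.
Proof.
apply C_ext; unfold cexp, Re, Im; simpl; rewrite exp_plus, ?cos_plus, ?sin_plus; ring.
Qed.

Lemma Cmod_cexp (x y : R) : Cmod (cexp (x, y)) = exp x.
Proof.
rewrite cexp_polar, Cmod_mult, Cmod_cis, Cmod_R, Rmult_1_r.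
apply Rabs_pos_eq, Rlt_le, exp_pos.
Qed.

Lemma cexp_neq_0 (z : C) : cexp z <> 0%C.
Proof.
destruct z as [x y]; apply Cmod_gt_0; rewrite Cmod_cexp; apply exp_pos.
Qed.

Lemma is_cderive_cexp_0 : is_cderive cexp 0%C 1%C.
Proof.
apply is_cderive_eps; intros eps he.
(* The error terms below add up to at most [9 e m]. The bound [e <= 1] gives [|exp u - 1| <= 2 m]
   and [|sin v| <= 2 m], and taking [m] below [e] makes their product [4 e m]. *)
set (e := Rmin (eps / 16) 1).
assert (he' : 0 < e) by (apply Rmin_pos; lra).
pose proof (Rmin_l (eps / 16) 1) as e1; pose proof (Rmin_r (eps / 16) 1) as e2; fold e in e1, e2; clearbody e.
destruct (is_derive_eps exp 0 1) with (eps := e) as [d1 [hd1 H1]]; auto.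
{ pose proof (is_derive_exp 0) as h; now rewrite exp_0 in h. }
destruct (is_derive_eps sin 0 1) with (eps := e) as [d2 [hd2 H2]]; auto.
{ pose proof (is_derive_sin 0) as h; now rewrite cos_0 in h. }
destruct (is_derive_eps cos 0 0) with (eps := e) as [d3 [hd3 H3]]; auto.
{ pose proof (is_derive_cos 0) as h; now rewrite sin_0, Ropp_0 in h. }
exists (Rmin e (Rmin d1 (Rmin d2 d3))); split; [repeat apply Rmin_pos; auto|].
intros [u v] hw.
pose proof (Rmin_l e (Rmin d1 (Rmin d2 d3))); pose proof (Rmin_r e (Rmin d1 (Rmin d2 d3))).
pose proof (Rmin_l d1 (Rmin d2 d3)); pose proof (Rmin_r d1 (Rmin d2 d3)).
pose proof (Rmin_l d2 d3); pose proof (Rmin_r d2 d3).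
replace ((u, v) - 0)%C with ((u, v) : C) in * by (apply C_ext; simpl; ring).
pose proof (re_le_Cmod (u, v)) as hu; pose proof (Im_le_Cmod (u, v)) as hv.
simpl in hu, hv.
specialize (H1 u); specialize (H2 v); specialize (H3 v).
rewrite Rminus_0_r in H1, H2, H3.
specialize (H1 ltac:(lra)); specialize (H2 ltac:(lra)); specialize (H3 ltac:(lra)).
rewrite exp_0, Rmult_1_l in H1; rewrite sin_0, Rmult_1_l, Rminus_0_r in H2.
rewrite cos_0, Rmult_0_l, Rminus_0_r in H3.
set (m := Cmod (u, v)) in *.
assert (hm : 0 <= m) by apply Cmod_ge_0.
assert (hE : Rabs (exp u - 1) <= 2 * m).
{ pose proof (Rabs_triang (exp u - 1 - u) u) as h; replace (exp u - 1 - u + u) with (exp u - 1)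
    in h by ring; pose proof (Rabs_pos u); nra. }
assert (hS : Rabs (sin v) <= 2 * m).
{ pose proof (Rabs_triang (sin v - v) v) as h; replace (sin v - v + v) with (sin v)
    in h by ring; pose proof (Rabs_pos v); nra. }
eapply Rle_trans; [apply Cmod_le_Re_Im|].
replace (Re (cexp (u, v) - cexp 0 - 1 * (u, v))%C) with
  ((exp u - 1 - u) + (exp u - 1) * (cos v - 1) + (cos v - 1))
  by (unfold cexp, Re, Im; simpl; rewrite exp_0, cos_0; ring).
replace (Im (cexp (u, v) - cexp 0 - 1 * (u, v))%C) with
  ((sin v - v) + (exp u - 1) * sin v)
  by (unfold cexp, Re, Im; simpl; rewrite exp_0, sin_0; ring).
assert (h1 : Rabs ((exp u - 1) * (cos v - 1)) <= 2 * e * m).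
{ rewrite Rabs_mult; replace (2 * e * m) with (2 * (e * m)) by ring.
  pose proof (Rabs_pos (exp u - 1)); pose proof (Rabs_pos (cos v - 1)).
  apply Rmult_le_compat; auto; [lra|].
  pose proof (Rabs_pos v); nra. }
assert (h2 : Rabs ((exp u - 1) * sin v) <= 4 * e * m).
{ rewrite Rabs_mult.
  pose proof (Rabs_pos (exp u - 1)); pose proof (Rabs_pos (sin v)).
  apply Rle_trans with (2 * m * (2 * m)); [now apply Rmult_le_compat | nra]. }
pose proof (Rabs_triang (exp u - 1 - u + (exp u - 1) * (cos v - 1)) (cos v - 1)).
pose proof (Rabs_triang (exp u - 1 - u) ((exp u - 1) * (cos v - 1))).
pose proof (Rabs_triang (sin v - v) ((exp u - 1) * sin v)).
assert (e * Rabs u <= e * m) by (apply Rmult_le_compat_l; lra).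
assert (e * Rabs v <= e * m) by (apply Rmult_le_compat_l; lra).
assert (0 <= e * m) by nra.
assert (16 * (e * m) <= eps * m) by nra.
lra.
Qed.

Lemma is_cderive_cexp (z : C) : is_cderive cexp z (cexp z).
Proof.
apply (is_cderive_ext (fun w => cexp z * cexp (w + - z)))%C.
- intros w; rewrite <- cexp_plus; f_equal; ring.
- apply is_cderive_eq with (cexp z * ((1 + 0) * 1))%C; [ring|].
  apply is_cderive_scal, (is_cderive_comp cexp (fun w => w + - z)%C).
  + replace (z + - z)%C with (RtoC 0) by ring; exact is_cderive_cexp_0.
  + exact (is_cderive_plus _ _ z _ _ (is_cderive_id z) (is_cderive_const (- z)%C z)).
Qed.

Lemma cr_at_of_is_cderive (g : C -> C) (x y : R) (l : C) :
  is_cderive g (x, y) l ->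
  cr_at (fun x y => Re (g (x, y))) (fun x y => Im (g (x, y))) x y.
Proof.
rewrite is_cderive_eps; intros h; exists (Re l), (Im l); intros eps he.
destruct (h eps he) as [d [hd H]]; exists (d / 2); split; [lra|].
intros x' y' hx hy.
assert (hm : Cmod ((x', y') - (x, y))%C <= Rabs (x' - x) + Rabs (y' - y)).
{ exact (Cmod_le_Re_Im ((x', y') - (x, y))%C). }
specialize (H (x', y') ltac:(lra)).
assert (h2 : eps * Cmod ((x', y') - (x, y))%C <= eps * (Rabs (x' - x) + Rabs (y' - y))).
{ apply Rmult_le_compat_l; lra. }
split.
- eapply Rle_trans; [|eapply Rle_trans; [apply H | exact h2]].
  eapply Rle_trans; [|apply re_le_Cmod]; right; f_equal; unfold Re, Im; simpl; ring.
- eapply Rle_trans; [|eapply Rle_trans; [apply H | exact h2]].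
  eapply Rle_trans; [|apply Im_le_Cmod]; right; f_equal; unfold Re, Im; simpl; ring.
Qed.

(** * Means over circles *)

Definition cdiff (g : C -> C) (z : C) : Prop := exists l, is_cderive g z l.

(** Only the real part is kept: on a vertical side in the coordinate [log z], it is the imaginary
    part of the contour integral that [boundary_integral] records. *)
Definition circle_integral (g : C -> C) (rho : R) : R :=
  RInt (fun t => Re (g (RtoC rho * cis t)%C)) 0 (2 * PI).

Lemma continuous_circle (g : C -> C) (rho t : R) :
  cdiff g (RtoC rho * cis t)%C -> continuous (fun t => Re (g (RtoC rho * cis t)%C)) t.
Proof.
intros [l hl].
apply (ex_derive_continuous (fun t => Re (g (RtoC rho * cis t)%C))).
eexists; exact (proj1 (cder_comp g (fun t => RtoC rho * cis t)%C t l _ hl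
  (cder_scal _ _ _ _ (cder_cis t)))).
Qed.

Lemma Cmod_circle (rho t : R) : 0 <= rho -> Cmod (RtoC rho * cis t)%C = rho.
Proof. intros h; rewrite Cmod_mult, Cmod_cis, Cmod_R, Rabs_pos_eq by easy; ring. Qed.

(** The exponential maps a rectangle of height [2 PI] onto the annulus. The horizontal sides cancel
    by periodicity, and the vertical ones give the two circle integrals. *)
Lemma circle_integral_annulus (g : C -> C) (r0 r1 : R) :
  0 < r0 <= r1 -> (forall z, r0 <= Cmod z <= r1 -> cdiff g z) ->
  circle_integral g r1 = circle_integral g r0.
Proof.
intros hr hg.
set (P := fun x y => Re (g (cexp (x, y)))); set (Q := fun x y => Im (g (cexp (x, y)))).
assert (hl : ln r0 <= ln r1).
{ destruct (Rle_lt_or_eq_dec r0 r1) as [h | ->]; [lra | | lra].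
  apply Rlt_le, ln_increasing; lra. }
assert (hex : forall x, ln r0 <= x <= ln r1 -> r0 <= exp x <= r1).
{ intros x hx; rewrite <- (exp_ln r0), <- (exp_ln r1) by lra.
  split.
  - destruct (Rle_lt_or_eq_dec (ln r0) x) as [h | <-]; [lra | left; now apply exp_increasing | lra].
  - destruct (Rle_lt_or_eq_dec x (ln r1)) as [h | ->]; [lra | left; now apply exp_increasing | lra]. }
pose proof PI_RGT_0 as hpi.
assert (hcr : cr_on P Q (ln r0) (ln r1) 0 (2 * PI)).
{ intros x y hx _.
  destruct (hg (cexp (x, y))) as [l hl'].
  - rewrite Cmod_cexp; now apply hex.
  - apply (cr_at_of_is_cderive (fun z => g (cexp z)) x y (cexp (x, y) * l)%C).
    exact (is_cderive_comp g cexp (x, y) l _ hl' (is_cderive_cexp _)). }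
pose proof (goursat P Q (ln r0) (ln r1) 0 (2 * PI) hl ltac:(lra) hcr) as G.
unfold boundary_integral in G.
rewrite (RInt_ext (fun x => Q x (2 * PI) - Q x 0) (fun _ => 0)) in G.
2: { intros x _; unfold Q; rewrite !cexp_polar; unfold cis.
     rewrite cos_2PI, sin_2PI, cos_0, sin_0; apply Rminus_diag. }
rewrite RInt_const in G.
change (scal (ln r1 - ln r0) 0) with ((ln r1 - ln r0) * 0) in G.
rewrite Rmult_0_r, Rminus_0_r in G.
assert (hP : forall rho, r0 <= rho <= r1 -> forall t,
   P (ln rho) t = Re (g (RtoC rho * cis t)%C)).
{ intros rho h t; unfold P; rewrite cexp_polar, exp_ln by lra; reflexivity. }
rewrite (RInt_ext _ (fun t => minus (Re (g (RtoC r1 * cis t)%C)) (Re (g (RtoC r0 * cis t)%C)))) in G.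
2: { intros t _; rewrite !hP by lra; reflexivity. }
rewrite (RInt_minus (V := R_CompleteNormedModule)) in G.
- unfold circle_integral; apply Rminus_diag_uniq.
  exact G.
- apply (ex_RInt_continuous (fun t => Re (g (RtoC r1 * cis t)%C))); intros t _.
  apply continuous_circle, hg; rewrite Cmod_circle; lra.
- apply (ex_RInt_continuous (fun t => Re (g (RtoC r0 * cis t)%C))); intros t _.
  apply continuous_circle, hg; rewrite Cmod_circle; lra.
Qed.

(** The integral does not depend on the radius, and on a small circle of radius [s] the function
    differs from its value at 0 by at most [K s]. *)
Lemma circle_integral_disc (g : C -> C) (rho : R) :
  0 < rho -> (forall z, Cmod z <= rho -> cdiff g z) ->
  circle_integral g rho = 2 * PI * Re (g 0%C).
Proof.
intros hr hg; apply Rminus_diag_uniq.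
set (D := circle_integral g rho - 2 * PI * Re (g 0%C)).
destruct (Req_dec D 0) as [h | h]; [easy | exfalso]; apply Rabs_pos_lt in h.
pose proof PI_RGT_0 as hpi.
destruct (hg 0%C) as [l hl]; [rewrite Cmod_0; lra|].
set (K := Cmod l + 1).
assert (hK : 0 < K) by (unfold K; pose proof (Cmod_ge_0 l); lra).
apply is_cderive_eps with (eps := 1) in hl; [|lra]; destruct hl as [d [hd H]].
(* The last bound makes [2 PI K s] at most [|D| / 2], which contradicts [E] below. *)
set (s := Rmin rho (Rmin (d / 2) (Rabs D / (4 * PI * K)))).
assert (hs : 0 < s).
{ repeat apply Rmin_pos; try lra; apply Rdiv_lt_0_compat; nra. }
pose proof (Rmin_l rho (Rmin (d / 2) (Rabs D / (4 * PI * K)))) as s1.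
pose proof (Rmin_r rho (Rmin (d / 2) (Rabs D / (4 * PI * K)))) as s2.
pose proof (Rmin_l (d / 2) (Rabs D / (4 * PI * K))) as s3.
pose proof (Rmin_r (d / 2) (Rabs D / (4 * PI * K))) as s4.
fold s in s1, s2.
assert (E : Rabs D <= K * s * (2 * PI - 0)).
{ unfold D; rewrite (circle_integral_annulus g s rho) by
    (try lra; intros z hz; apply hg; lra).
  rewrite (Rmult_comm (2 * PI)).
  replace (Re (g 0%C) * (2 * PI)) with (Re (g 0%C) * (2 * PI - 0)) by ring.
  apply RInt_near_const; [lra | |].
  - apply (ex_RInt_continuous (fun t => Re (g (RtoC s * cis t)%C))); intros t _.
    apply continuous_circle, hg; rewrite Cmod_circle; lra.
  - intros t _.
    assert (hm : Cmod (RtoC s * cis t - 0)%C = s).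
    { replace (RtoC s * cis t - 0)%C with (RtoC s * cis t)%C by ring; apply Cmod_circle; lra. }
    specialize (H (RtoC s * cis t)%C); rewrite hm in H; specialize (H ltac:(lra)).
    change (Re (g (RtoC s * cis t)%C) - Re (g 0%C)) with (Re (g (RtoC s * cis t) - g 0)%C).
    eapply Rle_trans; [apply re_le_Cmod|].
    replace (g (RtoC s * cis t) - g 0)%C with
     ((g (RtoC s * cis t) - g 0 - l * (RtoC s * cis t - 0)) + l * (RtoC s * cis t - 0))%C by ring.
    eapply Rle_trans; [apply Cmod_triangle|]; rewrite Cmod_mult, hm; unfold K; lra. }
assert (h1 : s <= Rabs D / (4 * PI * K)) by lra.
apply Rle_div_r in h1; [|nra]; nra.
Qed.

(** The integrals over the two pieces cut at a point are nonnegative with sum 0, so the primitive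
    from [a] vanishes on the interval, and with it the derivative [f]. *)
Lemma RInt_nonneg_zero (f : R -> R) (a b : R) :
  a < b -> (forall t, continuous f t) -> (forall t, 0 <= f t) -> RInt f a b = 0 ->
  forall t, a <= t <= b -> f t = 0.
Proof.
intros hab cf hf h0.
assert (iR : forall u v, ex_RInt f u v) by (intros; apply (ex_RInt_continuous f); auto).
set (F := fun t => RInt f a t).
assert (F0 : forall t, a <= t <= b -> F t = 0).
{ intros t ht.
  pose proof (RInt_Chasles f a t b (iR _ _) (iR _ _)) as h; rewrite h0 in h.
  assert (0 <= RInt f a t) by (apply RInt_ge_0; auto; lra).
  assert (0 <= RInt f t b) by (apply RInt_ge_0; auto; lra).
  unfold plus in h; simpl in h; unfold F; lra. }
assert (dF : forall t, is_derive F t (f t)).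
{ intros t; apply (is_derive_RInt f F a); auto.
  apply filter_forall; intros u; apply (RInt_correct f); auto. }
intros t ht; destruct (Req_dec (f t) 0) as [h | h]; [easy | exfalso].
apply Rabs_pos_lt in h.
destruct (is_derive_eps _ _ _ (dF t) (Rabs (f t) / 2) ltac:(lra)) as [d [hd H]].
(* One difference quotient inside [[a, b]] is enough; the second point lies to the right of [t], or
   to the left when [t = b]. *)
assert (key : forall y, a <= y <= b -> y <> t -> Rabs (y - t) < d -> False).
{ intros y hy hyt hyd; specialize (H y hyd).
  rewrite !F0 in H by easy.
  replace (0 - 0 - f t * (y - t)) with (- (f t * (y - t))) in H by ring.
  rewrite Rabs_Ropp, Rabs_mult in H.
  assert (0 < Rabs (y - t)) by (apply Rabs_pos_lt; lra); nra. }
destruct (Rlt_le_dec t b) as [h1 | h1].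
- pose proof (Rmin_l ((b - t)) (d / 2)); pose proof (Rmin_r ((b - t)) (d / 2)).
  assert (0 < Rmin (b - t) (d / 2)) by (apply Rmin_pos; lra).
  apply (key (t + Rmin (b - t) (d / 2))); try lra.
  rewrite Rabs_pos_eq; lra.
- pose proof (Rmin_l ((t - a)) (d / 2)); pose proof (Rmin_r ((t - a)) (d / 2)).
  assert (0 < Rmin (t - a) (d / 2)) by (apply Rmin_pos; lra).
  apply (key (t - Rmin (t - a) (d / 2))); try lra.
  rewrite Rabs_left; lra.
Qed.

(** The derivative along the circle is [i z] times the complex derivative, and [i z] is not 0. This
    transfers to the derivative in [l] an identity between frames that is known only on the unit
    circle. *)
Lemma is_cderive_circle_unique (f g : C -> C) (z l m : C) :
  Cmod z = 1 -> (forall w, Cmod w = 1 -> f w = g w) ->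
  is_cderive f z l -> is_cderive g z m -> l = m.
Proof.
intros hz hfg hf hg.
assert (z0 : z <> 0%C) by (apply Cmod_gt_0; lra).
assert (hcis0 : cis 0 = 1%C) by (unfold cis; now rewrite cos_0, sin_0).
assert (hc : cder (fun t => z * cis t)%C 0 (z * (Ci * cis 0))%C) by apply cder_scal, cder_cis.
assert (hz0 : (z * cis 0)%C = z) by (rewrite hcis0; ring).
rewrite <- hz0 in hf, hg.
pose proof (cder_comp f _ 0 l _ hf hc) as h1.
pose proof (cder_comp g _ 0 m _ hg hc) as h2.
apply (cder_ext _ (fun t => g (z * cis t)%C)) in h1.
- pose proof (cder_unique _ _ _ _ h1 h2) as E.
  rewrite hcis0 in E.
  assert (hi : (z * (Ci * 1))%C <> 0%C).
  { apply Cmult_neq_0; [easy|]; rewrite Cmult_1_r; intros h.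
    apply (f_equal Im) in h; simpl in h; lra. }
  rewrite <- (Cmult_1_r l), <- (Cinv_r _ hi), Cmult_assoc, E.
  now rewrite <- Cmult_assoc, Cinv_r, Cmult_1_r.
- intros t; apply hfg; rewrite Cmod_mult, hz, Cmod_cis; ring.
Qed.

(** * Linear matrix equations with a parameter *)

Infix "**" := mmul (at level 40, left associativity).
Infix "+++" := madd (at level 50, left associativity).

(** The adjugate: a division-free inverse for matrices of determinant 1, polynomial in the entries
    and therefore easy to differentiate. *)
Definition mcof (A : M2) : M2 := mkM2 (m22 A) (- m12 A)%C (- m21 A)%C (m11 A).

Lemma M2_ext (A B : M2) :
  m11 A = m11 B -> m12 A = m12 B -> m21 A = m21 B -> m22 A = m22 B -> A = B.
Proof. destruct A, B; simpl; congruence. Qed.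

Ltac m2_unfold :=
  unfold mmul, madd, mscal, mcof, mid, Defs.sigma, mdiag, mdet, mtrace;
  cbn [m11 m12 m21 m22].
Ltac entries := refine (conj _ (conj _ (conj _ _))).
Ltac m2_ring := apply M2_ext; m2_unfold; ring.

Lemma mmul_assoc (A B D : M2) : A ** (B ** D) = A ** B ** D.
Proof. m2_ring. Qed.

Lemma mmul_1_l (A : M2) : mid ** A = A.
Proof. m2_ring. Qed.

Lemma mmul_1_r (A : M2) : A ** mid = A.
Proof. m2_ring. Qed.

Lemma mcof_mmul (A B : M2) : mcof (A ** B) = mcof B ** mcof A.
Proof. m2_ring. Qed.

Lemma mcof_mcof (A : M2) : mcof (mcof A) = A.
Proof. m2_ring. Qed.

Lemma mcof_mid : mcof mid = mid.
Proof. m2_ring. Qed.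

Lemma mdet_mmul (A B : M2) : mdet (A ** B) = (mdet A * mdet B)%C.
Proof. m2_unfold; ring. Qed.

Lemma mdet_mcof (A : M2) : mdet (mcof A) = mdet A.
Proof. m2_unfold; ring. Qed.

Lemma mmul_mcof_r (A : M2) : mdet A = 1%C -> A ** mcof A = mid.
Proof.
intros h; replace (A ** mcof A) with (mscal (mdet A) mid) by m2_ring.
rewrite h; m2_ring.
Qed.

Lemma mmul_mcof_l (A : M2) : mdet A = 1%C -> mcof A ** A = mid.
Proof.
intros h; replace (mcof A ** A) with (mscal (mdet A) mid) by m2_ring.
rewrite h; m2_ring.
Qed.

Lemma minv_mcof (A : M2) : mdet A = 1%C -> minv A = mcof A.
Proof.
intros h; unfold minv; rewrite h; replace (/ 1)%C with (RtoC 1).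
- apply M2_ext; m2_unfold; ring.
- apply C_ext; simpl; field.
Qed.

(** For [X' = X M] this turns the derivative of [mcof X] into [- M mcof X]. *)
Lemma mcof_traceless (A : M2) : mtrace A = 0%C -> mcof A = mscal (- (1))%C A.
Proof.
intros h; assert (E : m22 A = (- m11 A)%C).
{ unfold mtrace in h; replace (m22 A) with (m11 A + m22 A - m11 A)%C by ring; rewrite h; ring. }
apply M2_ext; m2_unfold; rewrite ?E; ring.
Qed.

Lemma mmul_add_l (A B D : M2) : (A +++ B) ** D = A ** D +++ B ** D.
Proof. m2_ring. Qed.

Lemma mmul_add_r (A B D : M2) : D ** (A +++ B) = D ** A +++ D ** B.
Proof. m2_ring. Qed.

Lemma mmul_scal_l (k : C) (A B : M2) : mscal k A ** B = mscal k (A ** B).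
Proof. m2_ring. Qed.

Lemma mmul_scal_r (k : C) (A B : M2) : A ** mscal k B = mscal k (A ** B).
Proof. m2_ring. Qed.

Ltac m2_expand :=
  repeat rewrite ?mmul_add_l, ?mmul_add_r, ?mmul_scal_l, ?mmul_scal_r, ?mmul_assoc;
  repeat match goal with |- context [?A ** ?B] => generalize (A ** B); intro end;
  m2_ring.

Lemma mtrace_add (A B : M2) : mtrace (A +++ B) = (mtrace A + mtrace B)%C.
Proof. m2_unfold; ring. Qed.

Lemma mtrace_scal (k : C) (A : M2) : mtrace (mscal k A) = (k * mtrace A)%C.
Proof. m2_unfold; ring. Qed.

Definition mder (G : R -> M2) (x : R) (L : M2) : Prop :=
  entrywise (fun m => cder (fun t => m (G t)) x (m L)).

Lemma mder_const (A : M2) (x : R) : mder (fun _ => A) x (mkM2 0 0 0 0)%C.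
Proof.
exact (conj (cder_const _ x) (conj (cder_const _ x) (conj (cder_const _ x) (cder_const _ x)))).
Qed.

Lemma mder_add (F G : R -> M2) (x : R) (A B : M2) :
  mder F x A -> mder G x B -> mder (fun t => F t +++ G t) x (A +++ B).
Proof.
intros (f1 & f2 & f3 & f4) (g1 & g2 & g3 & g4).
exact (conj (cder_plus f1 g1) (conj (cder_plus f2 g2)
  (conj (cder_plus f3 g3) (cder_plus f4 g4)))).
Qed.
Arguments mder_add {_ _ _ _ _}.

Lemma mder_scal (k : C) (F : R -> M2) (x : R) (A : M2) :
  mder F x A -> mder (fun t => mscal k (F t)) x (mscal k A).
Proof.
intros (f1 & f2 & f3 & f4).
exact (conj (cder_scal _ _ _ _ f1) (conj (cder_scal _ _ _ _ f2)
  (conj (cder_scal _ _ _ _ f3) (cder_scal _ _ _ _ f4)))).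
Qed.

Lemma cder_mult2 (f g h k : R -> C) (x : R) (f' g' h' k' : C) :
  cder f x f' -> cder g x g' -> cder h x h' -> cder k x k' ->
  cder (fun t => f t * g t + h t * k t)%C x
    ((f' * g x + h' * k x) + (f x * g' + h x * k'))%C.
Proof.
intros h1 h2 h3 h4; eapply cder_eq; [|exact (cder_plus
  (cder_mult _ _ _ _ _ h1 h2) (cder_mult _ _ _ _ _ h3 h4))]; ring.
Qed.
Arguments cder_mult2 {_ _ _ _ _ _ _ _ _}.

Lemma mder_mul (F G : R -> M2) (x : R) (A B : M2) :
  mder F x A -> mder G x B -> mder (fun t => F t ** G t) x (A ** G x +++ F x ** B).
Proof.
intros (f1 & f2 & f3 & f4) (g1 & g2 & g3 & g4).
exact (conj (cder_mult2 f1 g1 f2 g3)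
 (conj (cder_mult2 f1 g2 f2 g4)
 (conj (cder_mult2 f3 g1 f4 g3)
   (cder_mult2 f3 g2 f4 g4)))).
Qed.
Arguments mder_mul {_ _ _ _ _}.

Lemma mder_eq (F : R -> M2) (x : R) (A B : M2) : A = B -> mder F x A -> mder F x B.
Proof. now intros ->. Qed.

Lemma cder_opp (f : R -> C) (x : R) (l : C) :
  cder f x l -> cder (fun t => - f t)%C x (- l)%C.
Proof.
intros h; apply (cder_ext (fun t => (- (1)) * f t)%C); [intros; ring|].
apply cder_eq with ((- (1)) * l)%C; [ring | now apply cder_scal].
Qed.
Arguments cder_opp {_ _ _}.

Lemma mder_cof (F : R -> M2) (x : R) (A : M2) :
  mder F x A -> mder (fun t => mcof (F t)) x (mcof A).
Proof.
intros (f1 & f2 & f3 & f4).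
exact (conj f4 (conj (cder_opp f2) (conj (cder_opp f3) f1))).
Qed.
Arguments mder_cof {_ _ _}.

Lemma mder_adj (F : R -> M2) (x : R) (A : M2) :
  mder F x A -> mder (fun t => madj (F t)) x (madj A).
Proof.
intros (f1 & f2 & f3 & f4).
exact (conj (cder_conj f1) (conj (cder_conj f3)
  (conj (cder_conj f2) (cder_conj f4)))).
Qed.
Arguments mder_adj {_ _ _}.

Lemma mder_zero_const (F : R -> M2) :
  (forall x, mder F x (mkM2 0 0 0 0)%C) -> forall x y, F x = F y.
Proof.
intros h x y; apply M2_ext;
 [apply (cder_zero_const (fun t => m11 (F t))) | apply (cder_zero_const (fun t => m12 (F t)))
 |apply (cder_zero_const (fun t => m21 (F t))) | apply (cder_zero_const (fun t => m22 (F t)))];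
 intros t; apply h.
Qed.

Lemma is_mderive_mul (F G : C -> M2) (x : C) (A B : M2) :
  is_mderive F x A -> is_mderive G x B ->
  is_mderive (fun t => F t ** G t) x (A ** G x +++ F x ** B).
Proof.
assert (H : forall f g h k f' g' h' k', is_cderive f x f' -> is_cderive g x g' ->
  is_cderive h x h' -> is_cderive k x k' -> is_cderive (fun t => f t * g t + h t * k t)%C x
    ((f' * g x + h' * k x) + (f x * g' + h x * k'))%C).
{ intros f g h k f' g' h' k' h1 h2 h3 h4.
  eapply is_cderive_eq; [|exact (is_cderive_plus _ _ _ _ _
    (is_cderive_mult _ _ _ _ _ h1 h2) (is_cderive_mult _ _ _ _ _ h3 h4))]; ring. }
intros (f1 & f2 & f3 & f4) (g1 & g2 & g3 & g4).
exact (conj (H _ _ _ _ _ _ _ _ f1 g1 f2 g3) (conj (H _ _ _ _ _ _ _ _ f1 g2 f2 g4)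
 (conj (H _ _ _ _ _ _ _ _ f3 g1 f4 g3) (H _ _ _ _ _ _ _ _ f3 g2 f4 g4)))).
Qed.

Lemma is_mderive_cof (F : C -> M2) (x : C) (A : M2) :
  is_mderive F x A -> is_mderive (fun t => mcof (F t)) x (mcof A).
Proof.
assert (H : forall f l, is_cderive f x l -> is_cderive (fun t => - f t)%C x (- l)%C).
{ intros f l h; apply (is_cderive_ext (fun t => (- (1)) * f t)%C); [intros; ring|].
  apply is_cderive_eq with ((- (1)) * l)%C; [ring | now apply is_cderive_scal]. }
intros (f1 & f2 & f3 & f4).
exact (conj f4 (conj (H _ _ f2) (conj (H _ _ f3) f1))).
Qed.
Arguments is_mderive_cof {_ _ _}.

Lemma is_mderive_unique (F : C -> M2) (x : C) (A B : M2) :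
  is_mderive F x A -> is_mderive F x B -> A = B.
Proof.
intros (f1 & f2 & f3 & f4) (g1 & g2 & g3 & g4).
apply M2_ext; eapply is_cderive_unique; eassumption.
Qed.

Lemma is_mderive_mderive (F : C -> M2) (x : C) (A : M2) : is_mderive F x A -> mderive F x = A.
Proof.
intros (f1 & f2 & f3 & f4); apply M2_ext; unfold mderive; cbn [m11 m12 m21 m22];
  now apply is_C_derive_unique.
Qed.
Arguments is_mderive_mderive {_ _ _}.

Lemma is_mderive_ext_near (F G : C -> M2) (z : C) (A : M2) (d : R) :
  0 < d -> (forall w, Cmod (w - z) < d -> F w = G w) -> is_mderive F z A -> is_mderive G z A.
Proof.
intros hd h (f1 & f2 & f3 & f4).
assert (H : forall m : M2 -> C, is_cderive (fun w => m (F w)) z (m A) ->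
   is_cderive (fun w => m (G w)) z (m A)).
{ intros m; apply (is_cderive_ext_near _ _ _ _ d hd); intros w hw; now rewrite h. }
exact (conj (H _ f1) (conj (H _ f2) (conj (H _ f3) (H _ f4)))).
Qed.

Lemma mholo_at_is_mderive (F : C -> M2) (x : C) : mholo_at F x -> exists A, is_mderive F x A.
Proof.
intros (f1 & f2 & f3 & f4).
assert (H : forall g, holo_at g x -> exists l, is_cderive g x l).
{ intros g h; exact (locally_singleton x _ h). }
destruct (H _ f1) as [l1 h1]; destruct (H _ f2) as [l2 h2].
destruct (H _ f3) as [l3 h3]; destruct (H _ f4) as [l4 h4].
exists (mkM2 l1 l2 l3 l4); exact (conj h1 (conj h2 (conj h3 h4))).
Qed.

(** A sup norm on entries; products then cost a factor 2. *)
Definition mbounded (k : R) (A : M2) : Prop := entrywise (fun m => Cmod (m A) <= k).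

Lemma mbounded_le (k k' : R) (A : M2) : k <= k' -> mbounded k A -> mbounded k' A.
Proof. intros h (a1 & a2 & a3 & a4); entries; simpl; lra. Qed.

Lemma mbounded_nonneg (k : R) (A : M2) : mbounded k A -> 0 <= k.
Proof. intros [h _]; pose proof (Cmod_ge_0 (m11 A)); lra. Qed.

Lemma mbounded_add (k l : R) (A B : M2) :
  mbounded k A -> mbounded l B -> mbounded (k + l) (A +++ B).
Proof.
intros (a1 & a2 & a3 & a4) (b1 & b2 & b3 & b4).
entries; unfold madd; cbn [m11 m12 m21 m22];
  (eapply Rle_trans; [apply Cmod_triangle | lra]).
Qed.

Lemma mbounded_scal (k : R) (c : C) (A : M2) :
  mbounded k A -> mbounded (Cmod c * k) (mscal c A).
Proof.
intros (a1 & a2 & a3 & a4); pose proof (Cmod_ge_0 c).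
entries; unfold mscal; cbn [m11 m12 m21 m22]; rewrite Cmod_mult;
  now apply Rmult_le_compat_l.
Qed.

Lemma mbounded_mul (k l : R) (A B : M2) :
  mbounded k A -> mbounded l B -> mbounded (2 * k * l) (A ** B).
Proof.
intros (a1 & a2 & a3 & a4) (b1 & b2 & b3 & b4).
assert (H : forall x y z w, Cmod x <= k -> Cmod y <= l -> Cmod z <= k -> Cmod w <= l ->
  Cmod (x * y + z * w)%C <= 2 * k * l).
{ intros x y z w hx hy hz hw; eapply Rle_trans; [apply Cmod_triangle|].
  rewrite !Cmod_mult.
  pose proof (Rmult_le_compat _ _ _ _ (Cmod_ge_0 x) (Cmod_ge_0 y) hx hy).
  pose proof (Rmult_le_compat _ _ _ _ (Cmod_ge_0 z) (Cmod_ge_0 w) hz hw). lra. }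
entries; unfold mmul; cbn [m11 m12 m21 m22]; now apply H.
Qed.

Lemma mbounded_cof (k : R) (A : M2) : mbounded k A -> mbounded k (mcof A).
Proof.
intros (a1 & a2 & a3 & a4); entries; unfold mcof; cbn [m11 m12 m21 m22];
  rewrite ?Cmod_opp; auto.
Qed.

Lemma mder_bounded_increment (F F' : R -> M2) (K x y : R) :
  (forall t, mder F t (F' t)) -> (forall t, Rmin x y <= t <= Rmax x y -> mbounded K (F' t)) ->
  mbounded (2 * K * Rabs (y - x)) (F y +++ mscal (- (1))%C (F x)).
Proof.
intros hF hK.
assert (H : forall m : M2 -> C, (forall A B, m (A +++ mscal (- (1)) B) = m A - m B)%C ->
  (forall t, cder (fun t => m (F t)) t (m (F' t))) ->
  (forall A k, mbounded k A -> Cmod (m A) <= k) ->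
  Cmod (m (F y +++ mscal (- (1))%C (F x))) <= 2 * K * Rabs (y - x)).
{ intros m hm dm bm; rewrite hm.
  apply (cder_bounded_increment (fun t => m (F t)) (fun t => m (F' t)) K x y dm); auto. }
refine (conj (H _ _ _ _) (conj (H _ _ _ _) (conj (H _ _ _ _) (H _ _ _ _))));
  try (intros; m2_unfold; ring); try (intros t; apply hF);
  intros A k (b1 & b2 & b3 & b4); auto.
Qed.

(** * Continuity and primitives of matrix functions *)

Definition ccont (f : R -> C) : Prop :=
  forall s, continuous (fun t => Re (f t)) s /\ continuous (fun t => Im (f t)) s.

Definition mcont (F : R -> M2) : Prop := entrywise (fun m => ccont (fun t => m (F t))).

Lemma ccont_const (k : C) : ccont (fun _ => k).
Proof. intros s; split; apply continuous_const. Qed.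

Lemma ccont_plus (f g : R -> C) : ccont f -> ccont g -> ccont (fun t => f t + g t)%C.
Proof.
intros hf hg s; destruct (hf s), (hg s); split.
- now apply (continuous_plus (fun t => Re (f t)) (fun t => Re (g t))).
- now apply (continuous_plus (fun t => Im (f t)) (fun t => Im (g t))).
Qed.

Lemma ccont_mult (f g : R -> C) : ccont f -> ccont g -> ccont (fun t => f t * g t)%C.
Proof.
intros hf hg s; destruct (hf s), (hg s); split.
- apply (continuous_minus (fun t => Re (f t) * Re (g t)) (fun t => Im (f t) * Im (g t)));
    now apply @continuous_mult.
- apply (continuous_plus (fun t => Re (f t) * Im (g t)) (fun t => Im (f t) * Re (g t)));
    now apply @continuous_mult.
Qed.

Lemma cder_ccont (f f' : R -> C) : (forall t, cder f t (f' t)) -> ccont f.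
Proof.
intros h s; destruct (h s); split.
- apply (ex_derive_continuous (fun t => Re (f t))); eexists; eassumption.
- apply (ex_derive_continuous (fun t => Im (f t))); eexists; eassumption.
Qed.

Lemma mder_mcont (F F' : R -> M2) : (forall t, mder F t (F' t)) -> mcont F.
Proof.
intros h.
exact (conj (cder_ccont (fun t => m11 (F t)) (fun t => m11 (F' t)) (fun t => proj1 (h t)))
 (conj (cder_ccont (fun t => m12 (F t)) (fun t => m12 (F' t)) (fun t => proj1 (proj2 (h t))))
 (conj (cder_ccont (fun t => m21 (F t)) (fun t => m21 (F' t))
         (fun t => proj1 (proj2 (proj2 (h t)))))
   (cder_ccont (fun t => m22 (F t)) (fun t => m22 (F' t))
         (fun t => proj2 (proj2 (proj2 (h t)))))))).
Qed.

Lemma mcont_mul (F G : R -> M2) : mcont F -> mcont G -> mcont (fun t => F t ** G t).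
Proof.
intros (f1 & f2 & f3 & f4) (g1 & g2 & g3 & g4).
entries; unfold mmul; cbn [m11 m12 m21 m22];
  apply ccont_plus; now apply ccont_mult.
Qed.

Lemma mcont_add (F G : R -> M2) : mcont F -> mcont G -> mcont (fun t => F t +++ G t).
Proof.
intros (f1 & f2 & f3 & f4) (g1 & g2 & g3 & g4).
entries; unfold madd; cbn [m11 m12 m21 m22]; now apply ccont_plus.
Qed.

Lemma mcont_scal (k : C) (F : R -> M2) : mcont F -> mcont (fun t => mscal k (F t)).
Proof.
intros (f1 & f2 & f3 & f4).
entries; unfold mscal; cbn [m11 m12 m21 m22]; apply ccont_mult; auto;
  apply ccont_const.
Qed.

Lemma is_derive_primitive (f : R -> R) (t : R) :
  (forall s, continuous f s) -> is_derive (fun s => RInt f 0 s) t (f t).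
Proof.
intros hf; apply (is_derive_RInt f _ 0); [|apply hf].
apply filter_forall; intros u; apply (RInt_correct f).
apply (ex_RInt_continuous f); intros; apply hf.
Qed.

Lemma cprimitive (f : R -> C) :
  ccont f -> exists F : R -> C, F 0 = 0%C /\ forall t, cder F t (f t).
Proof.
intros hf; exists (fun s => (RInt (fun t => Re (f t)) 0 s, RInt (fun t => Im (f t)) 0 s)).
split.
- apply C_ext; simpl; now rewrite RInt_point.
- intros t; exact (conj (is_derive_primitive (fun t => Re (f t)) t (fun s => proj1 (hf s)))
    (is_derive_primitive (fun t => Im (f t)) t (fun s => proj2 (hf s)))).
Qed.

Lemma mprimitive (F : R -> M2) :
  mcont F -> exists Z : R -> M2, Z 0 = mkM2 0 0 0 0 /\ forall t, mder Z t (F t).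
Proof.
intros (f1 & f2 & f3 & f4).
destruct (cprimitive _ f1) as (z1 & e1 & h1); destruct (cprimitive _ f2) as (z2 & e2 & h2).
destruct (cprimitive _ f3) as (z3 & e3 & h3); destruct (cprimitive _ f4) as (z4 & e4 & h4).
exists (fun t => mkM2 (z1 t) (z2 t) (z3 t) (z4 t)); split.
- now rewrite e1, e2, e3, e4.
- intros t; exact (conj (h1 t) (conj (h2 t) (conj (h3 t) (h4 t)))).
Qed.

(** * Existence and holomorphic dependence of solutions *)

(** The eight real unknowns of a complex matrix, in the form of a family as [picard_lindelof]
    expects. The three bits are the row, the column and the choice between real and imaginary
    part. *)
Definition of_coords (y : bool * bool * bool -> R) : M2 :=
  mkM2 (y (false, false, false), y (false, false, true))
       (y (false, true, false), y (false, true, true))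
       (y (true, false, false), y (true, false, true))
       (y (true, true, false), y (true, true, true)).

Definition to_coords (A : M2) (i : bool * bool * bool) : R :=
  let '(j, k, im) := i in
  let z := if (j : bool) then (if (k : bool) then m22 A else m21 A)
           else (if (k : bool) then m12 A else m11 A) in
  if (im : bool) then Im z else Re z.

(** The growth bound of [picard_lindelof] for the Lipschitz constant [1 + 4 K]: the inner 1 bounds
    the coordinates of the initial value, and the outer 2 passes from real and imaginary parts to
    the modulus. *)
Definition ode_bound (K s : R) : R := 2 * (1 + 2 * K * exp (2 * (1 + 4 * K) * Rabs s)).

Lemma Re_Im_mul2_bound (x y z w : C) (d K : R) :
  Cmod y <= K -> Cmod w <= K -> Rabs (Re x) <= d -> Rabs (Im x) <= d ->
  Rabs (Re z) <= d -> Rabs (Im z) <= d -> Cmod (x * y + z * w)%C <= 4 * K * d.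
Proof.
intros hy hw h1 h2 h3 h4.
pose proof (Cmod_le_Re_Im x) as hx; pose proof (Cmod_le_Re_Im z) as hz.
eapply Rle_trans; [apply Cmod_triangle|]; rewrite !Cmod_mult.
pose proof (Rmult_le_compat (Cmod x) (2 * d) (Cmod y) K (Cmod_ge_0 _) (Cmod_ge_0 _)
  ltac:(lra) hy).
pose proof (Rmult_le_compat (Cmod z) (2 * d) (Cmod w) K (Cmod_ge_0 _) (Cmod_ge_0 _)
  ltac:(lra) hw).
lra.
Qed.

Lemma linear_ode (M : R -> M2) (K : R) :
  mcont M -> (forall s, mbounded K (M s)) ->
  exists X : R -> M2, X 0 = mid /\ (forall s, mder X s (X s ** M s))
    /\ forall s, mbounded (ode_bound K s) (X s).
Proof.
intros cM bM.
pose proof (mbounded_nonneg _ _ (bM 0)) as hK.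
destruct (picard_lindelof (bool * bool * bool) (fun s y => to_coords (of_coords y ** M s))
  (to_coords mid) (1 + 4 * K) K) as (y & y0 & dy & by_).
- lra.
- intros s y z d [[j k] im] hd.
  assert (hd0 : 0 <= d).
  { specialize (hd (j, k, im)); pose proof (Rabs_pos (y (j, k, im) - z (j, k, im))); lra. }
  set (x := fun i => y i - z i).
  assert (hx : forall i, Rabs (x i) <= d) by apply hd.
  replace (to_coords (of_coords y ** M s) (j, k, im) - to_coords (of_coords z ** M s) (j, k, im))
    with (to_coords (of_coords x ** M s) (j, k, im)).
  2: { unfold x, to_coords, of_coords, mmul, Re, Im; destruct j, k, im; simpl; ring. }
  apply Rle_trans with (4 * K * d); [|nra].
  destruct (bM s) as (b1 & b2 & b3 & b4).
  destruct im; (eapply Rle_trans; [apply Im_le_Cmod || apply re_le_Cmod|]);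
    destruct j, k; apply Re_Im_mul2_bound; simpl; auto.
- intros Y cY i s.
  assert (H : mcont (fun s => of_coords (Y s) ** M s)).
  { apply mcont_mul; [|easy].
    entries; intros t; split; apply cY. }
  destruct H as (h1 & h2 & h3 & h4).
  destruct i as [[[|] [|]] [|]]; [exact (proj2 (h4 s)) | exact (proj1 (h4 s))
   | exact (proj2 (h3 s)) | exact (proj1 (h3 s)) | exact (proj2 (h2 s)) | exact (proj1 (h2 s))
   | exact (proj2 (h1 s)) | exact (proj1 (h1 s))].
- intros s i.
  replace (of_coords (to_coords mid)) with mid by (apply M2_ext; apply C_ext; reflexivity).
  rewrite mmul_1_l; destruct (bM s) as (b1 & b2 & b3 & b4).
  destruct i as [[[|] [|]] [|]]; simpl;
   (eapply Rle_trans; [apply Im_le_Cmod || apply re_le_Cmod|]); easy.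
- exists (fun s => of_coords (y s)); split; [|split].
  + apply M2_ext; apply C_ext; simpl; rewrite y0; reflexivity.
  + intros s; entries; split; apply dy.
  + intros s.
    assert (H : forall i, Rabs (y s i) <= 1 + 2 * K * exp (2 * (1 + 4 * K) * Rabs s)).
    { intros i; specialize (by_ s i).
      assert (Rabs (to_coords mid i) <= 1).
      { destruct i as [[[|] [|]] [|]]; simpl; rewrite ?Rabs_R0, ?Rabs_R1; lra. }
      pose proof (Rabs_triang (y s i - to_coords mid i) (to_coords mid i)) as h.
      replace (y s i - to_coords mid i + to_coords mid i) with (y s i) in h by ring; lra. }
    unfold ode_bound.
    entries; (eapply Rle_trans; [apply Cmod_le_Re_Im|]); simpl;
      match goal with |- Rabs (y s ?i) + Rabs (y s ?j) <= _ =>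
        pose proof (H i); pose proof (H j) end; lra.
Qed.

Lemma ode_bound_le (K K' s s' : R) :
  0 <= K <= K' -> Rabs s <= Rabs s' -> ode_bound K s <= ode_bound K' s'.
Proof.
intros hK hs; unfold ode_bound; pose proof (Rabs_pos s).
assert (exp (2 * (1 + 4 * K) * Rabs s) <= exp (2 * (1 + 4 * K') * Rabs s')).
{ assert (h : 2 * (1 + 4 * K) * Rabs s <= 2 * (1 + 4 * K') * Rabs s') by nra.
  destruct (Rle_lt_or_eq_dec _ _ h) as [h' | ->]; [left; now apply exp_increasing | lra]. }
pose proof (exp_pos (2 * (1 + 4 * K) * Rabs s)); nra.
Qed.

(** Liouville's formula for traceless coefficients: [X mcof X], which is [det X] times the identity,
    has zero derivative. *)
Lemma linear_ode_det (X M : R -> M2) :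
  X 0 = mid -> (forall s, mder X s (X s ** M s)) -> (forall s, mtrace (M s) = 0%C) ->
  forall s, mdet (X s) = 1%C.
Proof.
intros h0 hX ht s.
assert (E : X s ** mcof (X s) = X 0 ** mcof (X 0)).
{ apply (mder_zero_const (fun s => X s ** mcof (X s))); intros t.
  eapply mder_eq; [|exact (mder_mul (hX t) (mder_cof (hX t)))].
  rewrite mcof_mmul, (mcof_traceless (M t)) by easy; m2_ring. }
rewrite h0, mcof_mid, mmul_1_r in E.
replace (mdet (X s)) with (m11 (X s ** mcof (X s))) by (m2_unfold; ring).
now rewrite E.
Qed.

(** A Laurent polynomial in [l] with matrix coefficients when [phi] is [Cinv]; the choice [phi = 0]
    removes the pole at 0. *)
Definition pencil (phi : C -> C) (P Q T : R -> M2) (l : C) (s : R) : M2 :=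
  mscal (phi l) (P s) +++ Q s +++ mscal l (T s).

Lemma pencil_bounded (phi : C -> C) (P Q T : R -> M2) (k : R) (l : C) (s : R) :
  mbounded k (P s) -> mbounded k (Q s) -> mbounded k (T s) ->
  mbounded ((Cmod (phi l) + 1 + Cmod l) * k) (pencil phi P Q T l s).
Proof.
intros hP hQ hT.
apply mbounded_le with (Cmod (phi l) * k + k + Cmod l * k); [lra|].
repeat apply mbounded_add; auto; now apply mbounded_scal.
Qed.

Lemma is_mderive_eps (G : C -> M2) (z : C) (L : M2) :
  (forall eps, 0 < eps -> exists d, 0 < d /\ forall w, Cmod (w - z) < d ->
     mbounded (eps * Cmod (w - z)) (G w +++ mscal (- (1)) (G z) +++ mscal (- (w - z)) L)) ->
  is_mderive G z L.
Proof.
intros h.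
assert (H : forall m : M2 -> C,
  (forall A B D, m (A +++ mscal (- (1)) B +++ D) = m A - m B + m D)%C ->
  (forall k A, m (mscal k A) = k * m A)%C ->
  (forall k A, mbounded k A -> Cmod (m A) <= k) ->
  is_cderive (fun w => m (G w)) z (m L)).
{ intros m m1 m2 m3; apply is_cderive_eps; intros eps he.
  destruct (h eps he) as [d [hd H]]; exists d; split; [easy|]; intros w hw.
  specialize (H w hw); apply m3 in H; rewrite m1, m2 in H.
  replace (m (G w) - m (G z) - m L * (w - z))%C
    with (m (G w) - m (G z) + - (w - z) * m L)%C by ring; exact H. }
refine (conj (H _ _ _ _) (conj (H _ _ _ _) (conj (H _ _ _ _) (H _ _ _ _))));
 try (intros; m2_unfold; ring); intros k A (h1 & h2 & h3 & h4); auto.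
Qed.

(** A solution is chosen for each [l] separately, and holomorphy follows by comparing two
    parameters. The derivative [Y] satisfies the equation differentiated in [l], which the
    Sym-Bobenko formula needs. Traceless coefficients make [mcof X] the inverse of [X]. *)
Lemma ode_family (phi : C -> C) (P Q T : R -> M2) (k : R) :
  mcont P -> mcont Q -> mcont T ->
  (forall s, mbounded k (P s)) -> (forall s, mbounded k (Q s)) -> (forall s, mbounded k (T s)) ->
  (forall s, mtrace (P s) = 0%C) -> (forall s, mtrace (Q s) = 0%C) ->
  (forall s, mtrace (T s) = 0%C) ->
  exists X : C -> R -> M2,
    (forall l, X l 0 = mid /\ (forall s, mder (X l) s (X l s ** pencil phi P Q T l s))
               /\ forall s, mdet (X l s) = 1%C)
    /\ forall l psi, is_cderive phi l psi ->
         exists Y : R -> M2, forall s,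
           is_mderive (fun l => X l s) l (Y s)
           /\ mder Y s (Y s ** pencil phi P Q T l s +++ X l s ** (mscal psi (P s) +++ T s)).
Proof.
intros cP cQ cT bP bQ bT tP tQ tT.
set (M := pencil phi P Q T).
pose proof (mbounded_nonneg _ _ (bP 0)) as hk.
assert (cM : forall l, mcont (M l)).
{ intros l; apply (mcont_add (fun s => mscal (phi l) (P s) +++ Q s)).
  - apply (mcont_add (fun s => mscal (phi l) (P s))); [now apply mcont_scal | easy].
  - now apply mcont_scal. }
set (K := fun l => (Cmod (phi l) + 1 + Cmod l) * k).
assert (bM : forall l s, mbounded (K l) (M l s)) by (intros; now apply pencil_bounded).
assert (X0 : forall l, {X : R -> M2 | X 0 = mid /\ (forall s, mder X s (X s ** M l s))
    /\ forall s, mbounded (ode_bound (K l) s) (X s)}).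
{ intros l; apply constructive_indefinite_description, linear_ode; auto. }
set (X := fun l => proj1_sig (X0 l)).
assert (hX0 : forall l, X l 0 = mid) by (intros l; apply (proj2_sig (X0 l))).
assert (hX : forall l s, mder (X l) s (X l s ** M l s)).
{ intros l; exact (proj1 (proj2 (proj2_sig (X0 l)))). }
assert (hXb : forall l s, mbounded (ode_bound (K l) s) (X l s)).
{ intros l; exact (proj2 (proj2 (proj2_sig (X0 l)))). }
clearbody X.
assert (hdet : forall l s, mdet (X l s) = 1%C).
{ intros l; apply (linear_ode_det (X l) (M l)); auto.
  intros s; unfold M, pencil; rewrite !mtrace_add, !mtrace_scal, tP, tQ, tT; ring. }
exists X; split; [auto|].
intros l psi hphi.
set (N := fun s => mscal psi (P s) +++ T s).
assert (cX : forall l, mcont (X l)).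
{ intros l'; exact (mder_mcont _ _ (hX l')). }
assert (cX' : mcont (fun s => mcof (X l s))).
{ exact (mder_mcont _ _ (fun s => mder_cof (hX l s))). }
assert (cN : mcont N).
{ apply (mcont_add (fun s => mscal psi (P s))); [now apply mcont_scal | easy]. }
(* Variation of constants: [Z X] with [Z' = X N X^-1] solves the equation differentiated in [l]. *)
destruct (mprimitive (fun s => X l s ** N s ** mcof (X l s))) as (Z & Z0 & hZ).
{ apply mcont_mul; [|easy]; now apply mcont_mul. }
exists (fun s => Z s ** X l s).
assert (cancel : forall A s, A ** mcof (X l s) ** X l s = A).
{ intros A s; now rewrite <- mmul_assoc, mmul_mcof_l, mmul_1_r. }
intros s; split.
2: { eapply mder_eq; [|exact (mder_mul (hZ s) (hX l s))].
     rewrite cancel; fold (M l s); rewrite mmul_assoc; fold (N s); m2_expand. }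
(* A bound for the coefficient at every [w] within distance 1 of [l] where the difference quotient
   of [phi] is at most [|psi| + 1]. *)
set (K1 := (Cmod (phi l) + (Cmod psi + 1) + 1 + (Cmod l + 1)) * k).
pose proof (Cmod_ge_0 psi) as psi0; pose proof (Cmod_ge_0 l) as l0.
pose proof (Cmod_ge_0 (phi l)) as phi0.
set (b := ode_bound K1 s).
set (c0 := (Cmod psi + 2) * k).
assert (hc0 : 0 <= c0) by (unfold c0; apply Rmult_le_pos; lra).
assert (hb0 : 0 <= b).
{ unfold b, ode_bound; pose proof (exp_pos (2 * (1 + 4 * K1) * Rabs s)).
  assert (0 <= K1) by (unfold K1; apply Rmult_le_pos; lra).
  assert (0 <= K1 * exp (2 * (1 + 4 * K1) * Rabs s)) by (apply Rmult_le_pos; lra); lra. }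
assert (eb : b = ode_bound K1 s) by reflexivity.
assert (ec0 : c0 = (Cmod psi + 2) * k) by reflexivity.
clearbody b c0.
(* [c1], [C1] and [C2] are read off from the bounds [bD] and [bE] below; the added 1 allows division
   by [C1] and [C2]. *)
set (c1 := 8 * b * b * c0 * Rabs s).
pose proof (Rabs_pos s) as hs0.
assert (hc1 : 0 <= c1) by (unfold c1; repeat apply Rmult_le_pos; lra).
set (C1 := 16 * b * b * b * k * Rabs s + 1).
assert (hC1 : 0 < C1) by (unfold C1; assert (0 <= 16 * b * b * b * k * Rabs s)
  by (repeat apply Rmult_le_pos; lra); lra).
set (C2 := 32 * c1 * c0 * b * b * b * Rabs s + 1).
assert (hC2 : 0 < C2) by (unfold C2; assert (0 <= 32 * c1 * c0 * b * b * b * Rabs s)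
  by (repeat apply Rmult_le_pos; lra); lra).
apply is_mderive_eps; intros eps he.
rewrite is_cderive_eps in hphi.
destruct (hphi 1 Rlt_0_1) as [d1 [hd1 H1]].
set (e1 := eps / (2 * C1)).
assert (he1 : 0 < e1) by (apply Rdiv_lt_0_compat; lra).
destruct (hphi e1 he1) as [d2 [hd2 H2]].
set (d3 := eps / (2 * C2)).
assert (hd3 : 0 < d3) by (apply Rdiv_lt_0_compat; lra).
exists (Rmin (Rmin 1 d1) (Rmin d2 d3)); split.
{ apply Rmin_pos; apply Rmin_pos; lra. }
intros w hw.
pose proof (Rmin_l (Rmin 1 d1) (Rmin d2 d3)); pose proof (Rmin_r (Rmin 1 d1) (Rmin d2 d3)).
pose proof (Rmin_l 1 d1); pose proof (Rmin_r 1 d1).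
pose proof (Rmin_l d2 d3); pose proof (Rmin_r d2 d3).
specialize (H1 w ltac:(lra)); specialize (H2 w ltac:(lra)).
set (h := Cmod (w - l)) in *.
assert (hh : 0 <= h) by apply Cmod_ge_0.
assert (dphi : Cmod (phi w - phi l)%C <= (Cmod psi + 1) * h).
{ replace (phi w - phi l)%C with ((phi w - phi l - psi * (w - l)) + psi * (w - l))%C by ring.
  eapply Rle_trans; [apply Cmod_triangle|]; rewrite Cmod_mult; fold h; lra. }
assert (Kw : 0 <= K w <= K1 /\ 0 <= K l <= K1).
{ assert (Cmod (phi w) <= Cmod (phi l) + (Cmod psi + 1)).
  { replace (phi w) with ((phi w - phi l) + phi l)%C by ring.
    eapply Rle_trans; [apply Cmod_triangle|]; nra. }
  assert (Cmod w <= Cmod l + 1).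
  { replace w with ((w - l) + l)%C by ring.
    eapply Rle_trans; [apply Cmod_triangle|]; fold h; lra. }
  pose proof (Cmod_ge_0 (phi w)); pose proof (Cmod_ge_0 w).
  unfold K, K1; repeat split; (apply Rmult_le_pos; lra) || (apply Rmult_le_compat_r; lra). }
assert (bXw : forall t, Rabs t <= Rabs s -> mbounded b (X w t)).
{ intros t ht; eapply mbounded_le; [|apply hXb]; rewrite eb; now apply ode_bound_le. }
assert (bXl : forall t, Rabs t <= Rabs s -> mbounded b (X l t)).
{ intros t ht; eapply mbounded_le; [|apply hXb]; rewrite eb; now apply ode_bound_le. }
set (dM := fun t => mscal (phi w - phi l) (P t) +++ mscal (w - l) (T t)).
assert (bdM : forall t, mbounded (c0 * h) (dM t)).
{ intros t; apply mbounded_le with (Cmod (phi w - phi l)%C * k + Cmod (w - l)%C * k).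
  - fold h; rewrite ec0; nra.
  - apply mbounded_add; now apply mbounded_scal. }
set (rM := fun t => mscal (phi w - phi l - psi * (w - l)) (P t)).
assert (brM : forall t, mbounded (e1 * h * k) (rM t)).
{ intros t; eapply mbounded_le; [|apply mbounded_scal, bP].
  apply Rmult_le_compat_r; [easy | exact H2]. }
(* [D - 1] is O(|w - l|) and [D - 1 - (w - l) Z] is O(|w - l| ^ 2), because their
   derivatives in [t] are. *)
set (D := fun t => X w t ** mcof (X l t)).
set (D' := fun t => X w t ** dM t ** mcof (X l t)).
assert (hD : forall t, mder D t (D' t)).
{ intros t; eapply mder_eq; [|exact (mder_mul (hX w t) (mder_cof (hX l t)))].
  rewrite mcof_mmul, (mcof_traceless (M l t)).
  - unfold D', dM, M, pencil; m2_expand.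
  - unfold M, pencil; rewrite !mtrace_add, !mtrace_scal, tP, tQ, tT; ring. }
assert (btw : forall t u, Rabs u <= Rabs s -> Rmin 0 u <= t <= Rmax 0 u -> Rabs t <= Rabs s).
{ intros t u hu ht; apply Rle_trans with (Rabs u); [|easy].
  destruct (Rle_lt_dec 0 u).
  - rewrite Rmin_left, Rmax_right in ht by easy; rewrite !Rabs_pos_eq; lra.
  - rewrite Rmin_right, Rmax_left in ht by lra; rewrite !Rabs_left1; lra. }
assert (D0 : D 0 = mid).
{ unfold D; rewrite !hX0, mcof_mid; apply mmul_1_r. }
assert (bD : forall u, Rabs u <= Rabs s -> mbounded (c1 * h) (D u +++ mscal (- (1)) mid)).
{ intros u hu; rewrite <- D0.
  apply mbounded_le with (2 * (2 * (2 * b * (c0 * h)) * b) * Rabs (u - 0)).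
  - rewrite Rminus_0_r; unfold c1.
    replace (8 * b * b * c0 * Rabs s * h) with (2 * (2 * (2 * b * (c0 * h)) * b) * Rabs s) by ring.
    apply Rmult_le_compat_l; [|easy]; repeat apply Rmult_le_pos; lra.
  - apply (mder_bounded_increment D D'); [easy|]; intros t ht.
    apply (btw t u hu) in ht.
    apply mbounded_mul; [apply mbounded_mul|apply mbounded_cof]; auto. }
set (E := fun t => D t +++ mscal (- (w - l)) (Z t)).
set (E' := fun t => ((D t +++ mscal (- (1)) mid) ** X l t ** dM t +++ X l t ** rM t)
                     ** mcof (X l t)).
assert (hE : forall t, mder E t (E' t)).
{ intros t; eapply mder_eq; [|exact (mder_add (hD t) (mder_scal _ _ _ _ (hZ t)))].
  unfold E', D'.
  replace (X w t) with (D t ** X l t) by (unfold D; now rewrite cancel).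
  unfold dM, rM, N; rewrite !mmul_add_l, !mmul_scal_l, !mmul_1_l; m2_expand. }
set (B := 2 * (2 * (2 * (c1 * h) * b) * (c0 * h) + 2 * b * (e1 * h * k)) * b).
assert (bE : mbounded (2 * B * Rabs s) (E s +++ mscal (- (1)) mid)).
{ assert (E0 : E 0 = mid).
  { unfold E; rewrite D0, Z0; m2_ring. }
  rewrite <- E0; replace (Rabs s) with (Rabs (s - 0)) by (f_equal; ring).
  apply (mder_bounded_increment E E' B 0 s hE); intros t ht.
  apply (btw t s (Rle_refl _)) in ht.
  apply mbounded_mul; [apply mbounded_add | now apply mbounded_cof, bXl].
  - apply mbounded_mul; [apply mbounded_mul|]; auto.
  - apply mbounded_mul; auto. }
apply mbounded_le with (2 * (2 * B * Rabs s) * b).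
- unfold B.
  replace (2 * (2 * (2 * (2 * (2 * (c1 * h) * b) * (c0 * h) + 2 * b * (e1 * h * k)) * b)
    * Rabs s) * b) with (h * ((C2 - 1) * h + (C1 - 1) * e1)) by (unfold C1, C2; ring).
  rewrite (Rmult_comm eps); apply Rmult_le_compat_l; [easy|].
  assert (C2 * d3 = eps / 2) by (unfold d3; field; lra).
  assert (C1 * e1 = eps / 2) by (unfold e1; field; lra).
  assert (C2 * h <= C2 * d3) by (apply Rmult_le_compat_l; lra).
  lra.
- replace (X w s +++ mscal (- (1)) (X l s) +++ mscal (- (w - l)) (Z s ** X l s))
    with ((E s +++ mscal (- (1)) mid) ** X l s).
  + apply mbounded_mul; [exact bE | now apply bXl, Rle_refl].
  + unfold E; rewrite <- (cancel (X w s) s) at 1; fold (D s).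
    rewrite !mmul_add_l, !mmul_scal_l, mmul_1_l; m2_expand.
Qed.

(** * The profile equation *)

Ltac rewrite_Derive H :=
  match type of H with is_derive ?f ?x ?l =>
    replace (Derive (fun t : R => f t) x) with l
      by (symmetry; exact (is_derive_unique _ _ _ H))
  end.

(** With [U = A e^th] and [W = B e^-th] this is [U' = 2 q U], [W' = - 2 q W],
    [q' = - 2 (U^2 - W^2)]: the Lax equation for the moduli of the off-diagonal coefficients and the
    diagonal entry. *)
Definition profile_ode (A B c : R) (th q : R -> R) : Prop :=
  th 0 = 0 /\ q 0 = c /\ (forall s, is_derive th s (2 * q s))
  /\ forall s, is_derive q s (-2 * ((A * exp (th s)) ^ 2 - (B * exp (- th s)) ^ 2)).

Lemma sqrt_lipschitz (m x y : R) :
  0 < m -> m <= x -> m <= y -> Rabs (sqrt x - sqrt y) <= Rabs (x - y) / (2 * sqrt m).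
Proof.
intros hm hx hy.
pose proof (sqrt_lt_R0 m hm) as h0.
pose proof (sqrt_le_1 m x ltac:(lra) ltac:(lra) hx) as h1.
pose proof (sqrt_le_1 m y ltac:(lra) ltac:(lra) hy) as h2.
apply Rle_div_r; [lra|].
replace (x - y) with ((sqrt x - sqrt y) * (sqrt x + sqrt y)).
- rewrite Rabs_mult; apply Rmult_le_compat_l; [apply Rabs_pos|].
  rewrite Rabs_pos_eq; lra.
- replace ((sqrt x - sqrt y) * (sqrt x + sqrt y)) with (sqrt x * sqrt x - sqrt y * sqrt y) by ring.
  rewrite !sqrt_sqrt; lra.
Qed.

Lemma sin_lipschitz (x y : R) : Rabs (sin x - sin y) <= Rabs (x - y).
Proof.
destruct (MVT_gen sin y x cos) as [z [_ hz]].
- intros t _; apply is_derive_sin.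
- intros t _; apply continuity_sin.
- rewrite hz, Rabs_mult.
  pose proof (COS_bound z); pose proof (Rabs_pos (x - y)).
  assert (Rabs (cos z) <= 1) by (apply Rabs_le; lra); nra.
Qed.

(* With [A e^th - B e^-th = E sin phi] and [q = E cos phi] the profile equation
   becomes this one, where [m = A B]. *)
Lemma pendulum_ode (m E phi0 : R) :
  0 < m -> exists phi : R -> R, phi 0 = phi0
    /\ forall s, is_derive phi s (2 * sqrt (4 * m + (E * sin (phi s)) ^ 2)).
Proof.
intros hm.
set (f := fun x => 2 * sqrt (4 * m + (E * sin x) ^ 2)).
assert (hm4 : 0 < sqrt (4 * m)) by (apply sqrt_lt_R0; lra).
(* The term [4 m > 0] keeps the square root away from its singularity, which makes [f] globally
   Lipschitz. *)
set (L := E ^ 2 * 2 / sqrt (4 * m)).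
assert (hL : 0 <= L) by (apply Rdiv_le_0_compat; auto; pose proof (pow2_ge_0 E); lra).
assert (lip : forall x y, Rabs (f x - f y) <= L * Rabs (x - y)).
{ intros x y; unfold f.
  rewrite <- Rmult_minus_distr_l, Rabs_mult, (Rabs_pos_eq 2) by lra.
  pose proof (sqrt_lipschitz (4 * m) (4 * m + (E * sin x) ^ 2) (4 * m + (E * sin y) ^ 2)
    ltac:(lra) ltac:(pose proof (pow2_ge_0 (E * sin x)); lra)
    ltac:(pose proof (pow2_ge_0 (E * sin y)); lra)) as h.
  replace (4 * m + (E * sin x) ^ 2 - (4 * m + (E * sin y) ^ 2))
    with (E ^ 2 * ((sin x - sin y) * (sin x + sin y))) in h by ring.
  rewrite !Rabs_mult, (Rabs_pos_eq (E ^ 2)) in h by apply pow2_ge_0.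
  assert (h2 : Rabs (sin x - sin y) * Rabs (sin x + sin y) <= Rabs (x - y) * 2).
  { apply Rmult_le_compat; try apply Rabs_pos; [apply sin_lipschitz|].
    pose proof (SIN_bound x); pose proof (SIN_bound y); apply Rabs_le; lra. }
  assert (h3 : E ^ 2 * (Rabs (sin x - sin y) * Rabs (sin x + sin y)) / (2 * sqrt (4 * m))
     <= E ^ 2 * (Rabs (x - y) * 2) / (2 * sqrt (4 * m))).
  { apply Rmult_le_compat_r; [left; apply Rinv_0_lt_compat; lra|].
    apply Rmult_le_compat_l; [apply pow2_ge_0 | easy]. }
  unfold L.
  replace (E ^ 2 * 2 / sqrt (4 * m) * Rabs (x - y))
    with (2 * (E ^ 2 * (Rabs (x - y) * 2) / (2 * sqrt (4 * m)))) by (field; lra).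
  lra. }
destruct (picard_lindelof unit (fun _ y _ => f (y tt)) (fun _ => phi0) (1 + L) (Rabs (f phi0)))
  as (y & y0 & dy & _).
- lra.
- intros _ y z d _ hd; eapply Rle_trans; [apply lip|].
  specialize (hd tt); pose proof (Rabs_pos (y tt - z tt)); nra.
- intros Y cY _ s.
  apply (continuous_comp (fun s => Y s tt) f); [apply cY|].
  apply (continuous_of_lipschitz_at f _ L 1 Rlt_0_1); intros; apply lip.
- intros; apply Rle_refl.
- exists (fun s => y s tt); split; [apply y0|]; intros s; apply dy.
Qed.

Lemma polar_coordinates (x y : R) :
  exists t, sqrt (x ^ 2 + y ^ 2) * cos t = x /\ sqrt (x ^ 2 + y ^ 2) * sin t = y.
Proof.
assert (h0 : 0 <= x ^ 2 + y ^ 2) by nra.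
destruct (Req_dec (x ^ 2 + y ^ 2) 0) as [h | h].
- exists 0; rewrite h, sqrt_0; split; nra.
- assert (hs : 0 < sqrt (x ^ 2 + y ^ 2)) by (apply sqrt_lt_R0; lra).
  pose proof (sqrt_sqrt _ h0) as h2.
  destruct (unit_circle_angle (x / sqrt (x ^ 2 + y ^ 2)) (y / sqrt (x ^ 2 + y ^ 2)))
    as (t & _ & h3 & h4).
  + apply Rmult_eq_reg_r with (sqrt (x ^ 2 + y ^ 2) * sqrt (x ^ 2 + y ^ 2)); [|nra].
    rewrite h2 at 2; field; lra.
  + exists t; rewrite h3, h4; split; field; lra.
Qed.

Lemma surjective_of_derive_ge (f f' : R -> R) (k : R) :
  0 < k -> (forall s, is_derive f s (f' s)) -> (forall s, k <= f' s) ->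
  forall y, exists s, f s = y.
Proof.
intros hk hf hf' y.
assert (cf : forall s, continuity_pt f s).
{ intros s; apply continuity_pt_filterlim, (ex_derive_continuous f); eexists; apply hf. }
assert (inc : forall s t, s <= t -> k * (t - s) <= f t - f s).
{ intros s t hst; destruct (MVT_gen f s t f') as [c [_ hc]]; auto.
  rewrite hc; apply Rmult_le_compat_r; [lra | apply hf']. }
set (d := Rabs (y - f 0) / k + 1).
assert (hd : Rabs (y - f 0) < k * d).
{ unfold d; rewrite Rmult_plus_distr_l.
  replace (k * (Rabs (y - f 0) / k)) with (Rabs (y - f 0)) by (field; lra); lra. }
assert (hd0 : 0 < d) by (pose proof (Rabs_pos (y - f 0)); nra).
apply Rabs_lt_between in hd.
pose proof (inc 0 d ltac:(lra)); pose proof (inc (- d) 0 ltac:(lra)).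
destruct (IVT_gen f (- d) d y) as (s & _ & hs).
- intros s; apply cf.
- rewrite Rmin_left, Rmax_right by lra; lra.
- now exists s.
Qed.

(** The right-hand side is not globally Lipschitz, so the solution is built from the angle of
    [pendulum_ode]. The speed of this angle is bounded below, hence it reaches both [PI / 2] and
    [- PI / 2]; there [q] vanishes, and these points give the bulge and the neck. *)
Lemma profile_ode_pos (A B c : R) :
  0 < A -> 0 < B -> exists th q, profile_ode A B c th q
    /\ forall e, e = 1 \/ e = -1 -> exists s, q s = 0
         /\ A * exp (th s) - B * exp (- th s) = e * sqrt (c ^ 2 + (A - B) ^ 2).
Proof.
intros hA hB.
destruct (polar_coordinates c (A - B)) as (phi0 & hc & hAB).
set (E := sqrt (c ^ 2 + (A - B) ^ 2)) in *.
set (m := A * B); assert (hm : 0 < m) by (apply Rmult_lt_0_compat; lra).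
destruct (pendulum_ode m E phi0 hm) as (phi & p0 & dphi).
set (Y := fun s => sqrt (4 * m + (E * sin (phi s)) ^ 2)).
assert (Y2 : forall s, Y s * Y s = 4 * m + (E * sin (phi s)) ^ 2).
{ intros s; apply sqrt_sqrt; pose proof (pow2_ge_0 (E * sin (phi s))); lra. }
assert (Ypos : forall s, 0 < Y s).
{ intros s; apply sqrt_lt_R0; pose proof (pow2_ge_0 (E * sin (phi s))); lra. }
(* The positive root of [U (U - E sin phi) = m]. *)
set (U := fun s => (E * sin (phi s) + Y s) / 2).
assert (Upos : forall s, 0 < U s) by (intros s; specialize (Y2 s); specialize (Ypos s); unfold U; nra).
set (th := fun s => ln (U s / A)); set (q := fun s => E * cos (phi s)).
assert (eU : forall s, A * exp (th s) = U s).
{ intros s; unfold th; rewrite exp_ln by (apply Rdiv_lt_0_compat; auto); field; lra. }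
assert (eW : forall s, B * exp (- th s) = (Y s - E * sin (phi s)) / 2).
{ intros s; rewrite exp_Ropp; apply Rmult_eq_reg_r with (U s); [|specialize (Upos s); lra].
  rewrite <- (eU s) at 1.
  replace (B * / exp (th s) * (A * exp (th s))) with m
    by (unfold m; field; apply Rgt_not_eq, exp_pos).
  unfold U; specialize (Y2 s); nra. }
assert (dY : forall s, is_derive Y s (2 * E ^ 2 * sin (phi s) * cos (phi s))).
{ intros s; unfold Y.
  assert (h1 : is_derive (fun s => 4 * m + (E * sin (phi s)) ^ 2) s
     (2 * E ^ 2 * sin (phi s) * cos (phi s) * (2 * Y s))).
  { auto_derive; [eexists; apply dphi|].
    rewrite_Derive (dphi s); fold (Y s); ring. }
  pose proof (is_derive_sqrt _ _ _ h1) as h2; fold (Y s) in h2.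
  replace (2 * E ^ 2 * sin (phi s) * cos (phi s)) with
    (2 * E ^ 2 * sin (phi s) * cos (phi s) * (2 * Y s) / (2 * Y s))
    by (field; apply Rgt_not_eq, Ypos).
  apply h2; pose proof (pow2_ge_0 (E * sin (phi s))); lra. }
exists th, q; split; [split; [|split; [|split]]|].
  unfold th; replace (U 0 / A) with 1; [apply ln_1|].
  unfold U, Y; rewrite p0, hAB.
  replace (4 * m + (A - B) ^ 2) with ((A + B) * (A + B)) by (unfold m; ring).
  rewrite sqrt_square by lra; field; lra.
- unfold q; now rewrite p0.
- intros s; unfold th, U.
  assert (hd : is_derive (fun s => (E * sin (phi s) + Y s) / 2 / A) s (2 * q s * (U s / A))).
  { auto_derive; [repeat split; eexists; [apply dphi | apply dY]|].
    rewrite_Derive (dphi s); rewrite_Derive (dY s); fold (Y s).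
    unfold q, U; field; lra. }
  assert (hp : 0 < U s / A) by now apply Rdiv_lt_0_compat.
  pose proof (is_derive_comp ln _ s _ _ (is_derive_ln (U s / A) hp) hd) as h.
  unfold scal in h; simpl in h; unfold mult in h; simpl in h.
  replace (2 * q s) with (2 * q s * (U s / A) * / (U s / A)) by (rewrite Rmult_assoc, Rinv_r; lra).
  exact h.
- intros s; rewrite eU, eW; unfold q.
  auto_derive; [eexists; apply dphi|].
  rewrite_Derive (dphi s); fold (Y s); unfold U; field.
- intros e he.
  destruct (surjective_of_derive_ge phi (fun s => 2 * Y s) (2 * sqrt (4 * m)))
    with (y := e * (PI / 2)) as [s hs].
  + assert (0 < sqrt (4 * m)) by (apply sqrt_lt_R0; lra); lra.
  + exact dphi.
  + intros s; apply Rmult_le_compat_l; [lra|]; apply sqrt_le_1;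
      pose proof (pow2_ge_0 (E * sin (phi s))); lra.
  + exists s; rewrite eU, eW; unfold q, U; rewrite hs.
    destruct he as [-> | ->].
    * rewrite Rmult_1_l, cos_PI2, sin_PI2; split; field.
    * replace (-1 * (PI / 2)) with (- (PI / 2)) by ring.
      rewrite cos_neg, sin_neg, cos_PI2, sin_PI2; split; field.
Qed.

(** For [B = 0] the first integral puts [(q, A e^th)] on a half circle of radius [E]. Its rational
    parametrization by [x = k e^(2 E s)] solves the equation: the coordinates are [- E tanh] and
    [E sech] of [ln x]. *)
Lemma profile_ode_zero (A c : R) :
  0 < A -> exists th q, profile_ode A 0 c th q
    /\ forall y, Rabs y < sqrt (A ^ 2 + c ^ 2) -> exists s, q s = y.
Proof.
intros hA.
set (E := sqrt (A ^ 2 + c ^ 2)).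
assert (E2 : E * E = A ^ 2 + c ^ 2) by (apply sqrt_sqrt; nra).
assert (hE : 0 < E) by (apply sqrt_lt_R0; nra).
assert (hEc : c < E) by nra.
(* The parameter of the initial point [(c, A)] of the half circle. *)
set (k := (E - c) / A).
assert (hk : 0 < k) by (apply Rdiv_lt_0_compat; lra).
assert (kA : k * A = E - c) by (unfold k; field; lra).
set (x := fun s => k * exp (2 * E * s)).
assert (hx : forall s, 0 < x s) by (intros s; apply Rmult_lt_0_compat; [easy | apply exp_pos]).
assert (dx : forall s, is_derive x s (2 * E * x s)).
{ intros s; unfold x; auto_derive; auto; ring. }
set (U := fun s => 2 * E * x s / (1 + x s ^ 2)).
assert (hx2 : forall s, 0 < 1 + x s ^ 2) by (intros s; pose proof (pow2_ge_0 (x s)); lra).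
assert (Upos : forall s, 0 < U s).
{ intros s; apply Rdiv_lt_0_compat; auto; specialize (hx s); nra. }
exists (fun s => ln (U s / A)), (fun s => E * (1 - x s ^ 2) / (1 + x s ^ 2)).
assert (x0 : x 0 = k) by (unfold x; rewrite Rmult_0_r, exp_0; ring).
assert (k2 : A * (1 + k ^ 2) = 2 * E * k).
{ apply Rmult_eq_reg_r with A; [|lra].
  replace (A * (1 + k ^ 2) * A) with (A ^ 2 + (k * A) ^ 2) by ring.
  replace (2 * E * k * A) with (2 * E * (k * A)) by ring; rewrite kA; nra. }
split; [split; [|split; [|split]]|].
- replace (U 0 / A) with 1; [apply ln_1|].
  unfold U; rewrite x0, <- k2; field; split; nra.
- rewrite x0; apply Rmult_eq_reg_r with (1 + k ^ 2); [|nra].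
  replace (E * (1 - k ^ 2) / (1 + k ^ 2) * (1 + k ^ 2)) with (E * (1 - k ^ 2)) by (field; nra).
  apply Rmult_eq_reg_r with (A ^ 2); [|nra].
  replace (E * (1 - k ^ 2) * A ^ 2) with (E * (A ^ 2 - (k * A) ^ 2)) by ring.
  replace (c * (1 + k ^ 2) * A ^ 2) with (c * (A ^ 2 + (k * A) ^ 2)) by ring.
  rewrite kA; nra.
- intros s; pose proof (hx s); pose proof (hx2 s).
  assert (hd : is_derive (fun s => U s / A) s
    (2 * (E * (1 - x s ^ 2) / (1 + x s ^ 2)) * (U s / A))).
  { unfold U; auto_derive; [repeat split; try (eexists; apply dx); simpl in *; lra|].
    rewrite_Derive (dx s); field; simpl in *; lra. }
  assert (hp : 0 < U s / A) by now apply Rdiv_lt_0_compat.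
  pose proof (is_derive_comp ln _ s _ _ (is_derive_ln (U s / A) hp) hd) as h.
  unfold scal in h; simpl in h; unfold mult in h; simpl in h.
  replace (2 * (E * (1 - x s ^ 2) / (1 + x s ^ 2))) with
    (2 * (E * (1 - x s ^ 2) / (1 + x s ^ 2)) * (U s / A) * / (U s / A))
    by (rewrite Rmult_assoc, Rinv_r; lra).
  exact h.
- intros s; pose proof (hx s); pose proof (hx2 s).
  rewrite exp_ln by now apply Rdiv_lt_0_compat.
  replace (-2 * ((A * (U s / A)) ^ 2 - (0 * exp (- ln (U s / A))) ^ 2)) with (-2 * U s ^ 2)
    by (field; lra).
  unfold U; auto_derive; [repeat split; try (eexists; apply dx); simpl in *; lra|].
  rewrite_Derive (dx s); field; simpl in *; lra.
- intros y hy; apply Rabs_lt_between in hy.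
  assert (hr : 0 < (E - y) / (E + y)) by (apply Rdiv_lt_0_compat; lra).
  (* The positive solution of [E (1 - w^2) / (1 + w^2) = y]. *)
  set (w := sqrt ((E - y) / (E + y))).
  assert (hw : 0 < w) by now apply sqrt_lt_R0.
  assert (w2 : w ^ 2 = (E - y) / (E + y)) by (unfold w; simpl; rewrite Rmult_1_r; apply sqrt_sqrt; lra).
  exists (ln (w / k) / (2 * E)).
  assert (xw : x (ln (w / k) / (2 * E)) = w).
  { unfold x; replace (2 * E * (ln (w / k) / (2 * E))) with (ln (w / k)) by (field; lra).
    rewrite exp_ln by now apply Rdiv_lt_0_compat. field; lra. }
  rewrite xw, w2; field; lra.
Qed.

(** * Loops and their Iwasawa factors *)

Definition mneg (A : M2) : M2 := mscal (- (1))%C A.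

Lemma mmul_cof_cancel (A X : M2) : mdet X = 1%C -> A ** mcof X ** X = A.
Proof. intros h; now rewrite <- mmul_assoc, mmul_mcof_l, mmul_1_r. Qed.

Lemma mmul_cancel_cof (A X : M2) : mdet X = 1%C -> A ** X ** mcof X = A.
Proof. intros h; now rewrite <- mmul_assoc, mmul_mcof_r, mmul_1_r. Qed.

(** The Lax equation [L' = [L, M]] says exactly that [X L X^-1] is constant along [X' = X M]. *)
Lemma lax_conjugation (X L M : R -> M2) :
  X 0 = mid -> (forall s, mder X s (X s ** M s)) -> (forall s, mtrace (M s) = 0%C) ->
  (forall s, mder L s (L s ** M s +++ mneg (M s ** L s))) ->
  forall s, X s ** L s = L 0 ** X s.
Proof.
intros h0 hX ht hL s.
pose proof (linear_ode_det X M h0 hX ht s) as hd.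
assert (E : X s ** L s ** mcof (X s) = X 0 ** L 0 ** mcof (X 0)).
{ apply (mder_zero_const (fun s => X s ** L s ** mcof (X s))); intros t.
  eapply mder_eq; [|exact (mder_mul (mder_mul (hX t) (hL t))
    (mder_cof (hX t)))].
  rewrite mcof_mmul, (mcof_traceless (M t)) by easy.
  unfold mneg; m2_expand. }
rewrite h0, mmul_1_l, mcof_mid, mmul_1_r in E.
now rewrite <- E, mmul_cof_cancel.
Qed.

(** The product of [X] and its adjoint has zero derivative when [M] is skew-hermitian. *)
Lemma unitary_ode (X M : R -> M2) :
  X 0 = mid -> (forall s, mder X s (X s ** M s)) -> (forall s, mtrace (M s) = 0%C) ->
  (forall s, madj (M s) = mneg (M s)) -> forall s, in_SU2 (X s).
Proof.
intros h0 hX ht ha s; split; [|exact (linear_ode_det X M h0 hX ht s)].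
assert (E : X s ** madj (X s) = X 0 ** madj (X 0)).
{ apply (mder_zero_const (fun s => X s ** madj (X s))); intros t.
  eapply mder_eq; [|exact (mder_mul (hX t) (mder_adj (hX t)))].
  replace (madj (X t ** M t)) with (madj (M t) ** madj (X t)).
  - rewrite ha; unfold mneg; m2_expand.
  - generalize (X t) (M t); clear; intros A B; unfold madj.
    apply M2_ext; m2_unfold; rewrite Cplus_conj, !Cmult_conj; ring. }
rewrite E, h0; apply M2_ext; unfold madj; m2_unfold; apply C_ext; simpl; ring.
Qed.

Lemma in_SU2_rows (A : M2) : in_SU2 A ->
  Cmod (m11 A) ^ 2 + Cmod (m12 A) ^ 2 = 1 /\ Cmod (m21 A) ^ 2 + Cmod (m22 A) ^ 2 = 1.
Proof.
intros [h _]; pose proof (f_equal m11 h) as h1; pose proof (f_equal m22 h) as h2.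
unfold madj, mid, mdiag, mmul in h1, h2; cbn [m11 m12 m21 m22] in h1, h2.
apply (f_equal Re) in h1; apply (f_equal Re) in h2; simpl in h1, h2.
rewrite !Cmod2_alt; unfold Re, Im; split; lra.
Qed.

Lemma in_SU2_shape (A : M2) : in_SU2 A ->
  m21 A = (- Cconj (m12 A))%C /\ m22 A = Cconj (m11 A).
Proof.
intros [h hd].
assert (E : madj A = mcof A).
{ rewrite <- (mmul_1_l (madj A)), <- (mmul_mcof_l A hd), <- mmul_assoc, h, mmul_1_r.
  reflexivity. }
pose proof (f_equal m12 E) as h1; pose proof (f_equal m11 E) as h2.
unfold madj, mcof in h1, h2; cbn [m11 m12 m21 m22] in h1, h2.
split; [|now rewrite h2].
rewrite <- (Cconj_conj (m21 A)), h1.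
apply C_ext; simpl; ring.
Qed.

Lemma in_SU2_cof_mul (A B : M2) : in_SU2 A -> in_SU2 B -> in_SU2 (mcof A ** B).
Proof.
intros hA hB.
pose proof (in_SU2_shape A hA) as [a1 a2]; pose proof (in_SU2_shape B hB) as [b1 b2].
destruct hA as [hA dA]; destruct hB as [hB dB]; split.
- assert (E : madj (mcof A ** B) = mcof (mcof A ** B)).
  { unfold madj; apply M2_ext; m2_unfold; rewrite a1, a2, b1, b2;
      apply C_ext; simpl; ring. }
  rewrite E; apply mmul_mcof_r; rewrite mdet_mmul, mdet_mcof, dA, dB; ring.
- rewrite mdet_mmul, mdet_mcof, dA, dB; ring.
Qed.

(** [Re g <= 1] on the circle, so a mean equal to 1 forces [Re g = 1] everywhere, and then
    [|g| <= 1] leaves no imaginary part. *)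
Lemma circle_mean_bound (g : C -> C) (k : R) :
  (forall z, Cmod z = 1 -> cdiff g z /\ Cmod (g z) <= 1) ->
  circle_integral g 1 = 2 * PI * k ->
  k <= 1 /\ (k = 1 -> forall z, Cmod z = 1 -> g z = 1%C).
Proof.
intros hg hk.
pose proof PI_RGT_0 as hpi.
assert (hz : forall t, Cmod (RtoC 1 * cis t)%C = 1) by (intros; apply Cmod_circle; lra).
set (f := fun t => 1 - Re (g (RtoC 1 * cis t)%C)).
assert (cg : forall t, continuous (fun t => Re (g (RtoC 1 * cis t)%C)) t).
{ intros t; apply continuous_circle, hg, hz. }
assert (cf : forall t, continuous f t).
{ intros t; apply (continuous_minus (fun _ => 1)); [apply continuous_const | apply cg]. }
assert (f0 : forall t, 0 <= f t).
{ intros t; destruct (hg _ (hz t)) as [_ h].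
  pose proof (re_le_Cmod (g (RtoC 1 * cis t)%C)); pose proof (Rle_abs (Re (g (RtoC 1 * cis t)%C))).
  unfold f; lra. }
assert (If : RInt f 0 (2 * PI) = 2 * PI * (1 - k)).
{ refine (eq_trans (y := 2 * PI - circle_integral g 1) _ _); [|rewrite hk; lra].
  unfold f, circle_integral.
  refine (eq_trans (y := RInt (fun _ => 1) 0 (2 * PI)
    - RInt (fun t => Re (g (RtoC 1 * cis t)%C)) 0 (2 * PI)) _ _).
  - apply (RInt_minus (V := R_CompleteNormedModule) (fun _ => 1)).
    + apply ex_RInt_const.
    + apply (ex_RInt_continuous (fun t => Re (g (RtoC 1 * cis t)%C))); auto.
  - assert (I1 : RInt (fun _ => 1) 0 (2 * PI) = 2 * PI :> R)
      by (rewrite RInt_const; unfold scal; simpl; unfold mult; simpl; lra).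
    now rewrite I1. }
split.
- assert (0 <= RInt f 0 (2 * PI)).
  { apply RInt_ge_0; [lra | apply (ex_RInt_continuous f); auto | auto]. }
  nra.
- intros -> z h.
  destruct (Cmod_1_cis z h) as (t & ht & ->).
  replace (2 * PI * (1 - 1)) with 0 in If by ring.
  pose proof (RInt_nonneg_zero f 0 (2 * PI) ltac:(lra) cf f0 If t ht) as h0.
  destruct (hg (cis t) h) as [_ h1].
  unfold f in h0; replace (RtoC 1 * cis t)%C with (cis t) in h0 by ring.
  assert (h2 : Cmod (g (cis t)) ^ 2 <= 1) by (pose proof (Cmod_ge_0 (g (cis t))); nra).
  rewrite Cmod2_alt in h2; apply C_ext; simpl; [lra|].
  assert (Re (g (cis t)) = 1) by lra; nra.
Qed.

(* Uniqueness in the Iwasawa decomposition: the diagonal entries of [P] have means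
   [k] and [1/k] over the unit circle, where they are at most 1 in modulus. *)
Lemma su2_loop_rigidity (P Q : C -> M2) (r k : R) :
  0 < r <= 1 -> 0 < k ->
  (forall z, r <= Cmod z <= 1 -> exists A, is_mderive P z A) ->
  (forall z, Cmod z <= r -> exists A, is_mderive Q z A) ->
  (forall z, Cmod z = r -> P z = Q z) ->
  (forall z, Cmod z = 1 -> in_SU2 (P z)) ->
  Q 0%C = mdiag (RtoC k) (RtoC (/ k)) ->
  forall z, Cmod z = 1 -> P z = mid.
Proof.
intros hr hk hP hQ hPQ hSU hQ0.
assert (mean : forall m k', (m = m11 \/ m = m22) -> m (Q 0%C) = RtoC k' ->
   circle_integral (fun z => m (P z)) 1 = 2 * PI * k').
{ intros m k' hm e.
  (* The mean of [P] is carried from the unit circle to the circle of radius [r], where [P] may be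
     replaced by [Q], and from there to the centre. *)
  rewrite (circle_integral_annulus _ r 1).
  - replace (circle_integral (fun z => m (P z)) r) with (circle_integral (fun z => m (Q z)) r).
    + rewrite circle_integral_disc; [now rewrite e | lra |].
      intros z hz; destruct (hQ z hz) as (A & q1 & _ & _ & q4); exists (m A).
      destruct hm as [-> | ->]; [exact q1 | exact q4].
    + apply RInt_ext; intros t _; rewrite hPQ; [easy | apply Cmod_circle; lra].
  - lra.
  - intros z hz; destruct (hP z hz) as (A & q1 & _ & _ & q4); exists (m A).
    destruct hm as [-> | ->]; [exact q1 | exact q4]. }
assert (bd : forall m, (m = m11 \/ m = m22) -> forall z, Cmod z = 1 ->
   cdiff (fun z => m (P z)) z /\ Cmod (m (P z)) <= 1).
{ intros m hm z hz; split.
  - destruct (hP z ltac:(lra)) as (A & q1 & _ & _ & q4); exists (m A).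
    destruct hm as [-> | ->]; [exact q1 | exact q4].
  - destruct (in_SU2_rows _ (hSU z hz)) as [r1 r2].
    pose proof (pow2_ge_0 (Cmod (m12 (P z)))); pose proof (pow2_ge_0 (Cmod (m21 (P z)))).
    destruct hm as [-> | ->];
     [pose proof (Cmod_ge_0 (m11 (P z))) | pose proof (Cmod_ge_0 (m22 (P z)))]; nra. }
destruct (circle_mean_bound _ k (bd m11 (or_introl eq_refl))) as [k1 P11].
{ apply mean; [now left | now rewrite hQ0]. }
destruct (circle_mean_bound _ (/ k) (bd m22 (or_intror eq_refl))) as [k2 P22].
{ apply mean; [now right | now rewrite hQ0]. }
(* Both [k] and [1 / k] are at most 1. The diagonal entries are then 1, and unit rows leave nothing
   off the diagonal. *)
assert (hk1 : k = 1).
{ pose proof (Rinv_r k ltac:(lra)); nra. }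
intros z hz.
specialize (P11 hk1 z hz); rewrite hk1, Rinv_1 in P22; specialize (P22 eq_refl z hz).
destruct (in_SU2_rows _ (hSU z hz)) as [r1 r2].
cbv beta in P11, P22; rewrite P11, Cmod_1 in r1; rewrite P22, Cmod_1 in r2.
apply M2_ext; unfold mid, mdiag; cbn [m11 m12 m21 m22]; auto.
- apply Cmod_eq_0; nra.
- apply Cmod_eq_0; nra.
Qed.

(** * The Lax pair *)

Definition offdiag (u w : C) : M2 := mkM2 0%C u w 0%C.

Lemma mder_pencil (phi : C -> C) (P Q T : R -> M2) (P' Q' T' : M2) (l : C) (s : R) :
  mder P s P' -> mder Q s Q' -> mder T s T' ->
  mder (pencil phi P Q T l) s (mscal (phi l) P' +++ Q' +++ mscal l T').
Proof.
intros hP hQ hT.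
exact (mder_add (mder_add (mder_scal _ _ _ _ hP) hQ) (mder_scal _ _ _ _ hT)).
Qed.

Lemma is_mderive_pencil (phi : C -> C) (P Q T : R -> M2) (l psi : C) (s : R) :
  is_cderive phi l psi ->
  is_mderive (fun l => pencil phi P Q T l s) l (mscal psi (P s) +++ T s).
Proof.
intros hphi.
assert (H : forall x y z, is_cderive (fun l => phi l * x + y + l * z)%C l (psi * x + z)%C).
{ intros x y z.
  apply is_cderive_eq with ((psi * x + phi l * 0 + 0) + (1 * z + l * 0))%C; [ring|].
  exact (is_cderive_plus _ _ _ _ _ (is_cderive_plus _ _ _ _ _
    (is_cderive_mult _ _ _ _ _ hphi (is_cderive_const x l)) (is_cderive_const y l))
    (is_cderive_mult _ _ _ _ _ (is_cderive_id l) (is_cderive_const z l))). }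
exact (conj (H _ _ _) (conj (H _ _ _) (conj (H _ _ _) (H _ _ _)))).
Qed.

Lemma mder_offdiag (u w : R -> C) (s : R) (u' w' : C) :
  cder u s u' -> cder w s w' -> mder (fun s => offdiag (u s) (w s)) s (offdiag u' w').
Proof.
intros hu hw; exact (conj (cder_const _ _) (conj hu (conj hw (cder_const _ _)))).
Qed.
Arguments mder_offdiag {_ _ _ _ _}.

Lemma mder_mdiag (u w : R -> C) (s : R) (u' w' : C) :
  cder u s u' -> cder w s w' -> mder (fun s => mdiag (u s) (w s)) s (mdiag u' w').
Proof.
intros hu hw; exact (conj hu (conj (cder_const _ _) (conj (cder_const _ _) hw))).
Qed.

(** This is the [l^0] coefficient of minus the determinant of the Lax matrix, which conjugation
    preserves. It bounds all coefficients uniformly in [s]. *)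
Lemma profile_conserved (A B c : R) (th q : R -> R) :
  profile_ode A B c th q -> forall s,
  q s ^ 2 + (A * exp (th s)) ^ 2 + (B * exp (- th s)) ^ 2 = c ^ 2 + A ^ 2 + B ^ 2.
Proof.
intros (t0 & q0 & dt & dq) s.
replace (c ^ 2 + A ^ 2 + B ^ 2) with
  (q 0 ^ 2 + (A * exp (th 0)) ^ 2 + (B * exp (- th 0)) ^ 2)
  by (rewrite t0, q0, Ropp_0, exp_0; ring).
apply (is_derive_zero_const
  (fun s => q s ^ 2 + (A * exp (th s)) ^ 2 + (B * exp (- th s)) ^ 2)); intros x.
auto_derive; [repeat split; eexists; [apply dq | apply dt | apply dt]|].
rewrite_Derive (dq x); rewrite_Derive (dt x); ring.
Qed.
Arguments profile_conserved {_ _ _ _ _}.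

(** [fu] and [fw] are the [l^-1] coefficients of the off-diagonal entries; their product stays equal
    to [a b]. *)
Definition fu (a : C) (th : R -> R) (s : R) : C := (a * RtoC (exp (th s)))%C.
Definition fw (b : C) (th : R -> R) (s : R) : C := (b * RtoC (exp (- th s)))%C.

Definition lax_P (a b : C) (th : R -> R) (s : R) : M2 := offdiag (fu a th s) (fw b th s).
Definition lax_T (a b : C) (th : R -> R) (s : R) : M2 :=
  offdiag (Cconj (fw b th s)) (Cconj (fu a th s)).
Definition lax_Q (q : R -> R) (s : R) : M2 := mdiag (RtoC (q s)) (RtoC (- q s)).

(* The Lax matrix [F^-1 xi_m1 F] and its part skew-hermitian on the unit circle,
   which is the Maurer-Cartan form of the frame in the [s] direction. *)
Definition lax_L (a b : C) (th q : R -> R) : C -> R -> M2 :=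
  pencil Cinv (lax_P a b th) (lax_Q q) (lax_T a b th).
Definition lax_a (a b : C) (th : R -> R) : C -> R -> M2 :=
  pencil Cinv (lax_P a b th) (fun _ => mkM2 0 0 0 0)%C (fun s => mneg (lax_T a b th s)).
(* [lax_a - lax_L], which has no pole at 0. *)
Definition lax_b (a b : C) (th q : R -> R) : C -> R -> M2 :=
  pencil (fun _ => 0%C) (lax_P a b th) (fun s => mneg (lax_Q q s))
    (fun s => mscal (- (2))%C (lax_T a b th s)).

(** The prime denotes the derivative in [l], not in [s]. *)
Definition lax_L' (a b : C) (th : R -> R) (l : C) (s : R) : M2 :=
  mscal (- (/ l * / l))%C (lax_P a b th s) +++ lax_T a b th s.
Definition lax_a' (a b : C) (th : R -> R) (l : C) (s : R) : M2 :=
  mscal (- (/ l * / l))%C (lax_P a b th s) +++ mneg (lax_T a b th s).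

Lemma lax_L_0 (a b : C) (c : R) (th q : R -> R) (l : C) :
  th 0 = 0 -> q 0 = c -> lax_L a b th q l 0 = xi_m1 a b c l.
Proof.
intros t0 q0; unfold lax_L, pencil, lax_P, lax_Q, lax_T, fu, fw, offdiag, xi_m1.
rewrite t0, q0, Ropp_0, exp_0.
apply M2_ext; m2_unfold; unfold Cdiv; rewrite ?Cmult_conj;
  replace (Cconj (RtoC 1)) with (RtoC 1) by (apply C_ext; simpl; ring); try ring.
Qed.

Lemma cder_fu (a : C) (th q : R -> R) (s : R) :
  is_derive th s (2 * q s) -> cder (fu a th) s (RtoC (2 * q s) * fu a th s)%C.
Proof.
intros h.
assert (h1 : is_derive (fun s => exp (th s)) s (2 * q s * exp (th s))).
{ auto_derive; [eexists; apply h|]; rewrite_Derive h; ring. }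
eapply cder_eq; [|exact (cder_scal a _ _ _ (cder_real _ _ _ h1))].
unfold fu; rewrite (RtoC_mult (2 * q s)); ring.
Qed.

Lemma cder_fw (b : C) (th q : R -> R) (s : R) :
  is_derive th s (2 * q s) -> cder (fw b th) s (RtoC (- (2 * q s)) * fw b th s)%C.
Proof.
intros h.
assert (h1 : is_derive (fun s => exp (- th s)) s (- (2 * q s) * exp (- th s))).
{ auto_derive; [eexists; apply h|]; rewrite_Derive h; ring. }
eapply cder_eq; [|exact (cder_scal b _ _ _ (cder_real _ _ _ h1))].
unfold fw; rewrite (RtoC_mult (- (2 * q s))); ring.
Qed.

Lemma Cconj_RtoC (x : R) : Cconj (RtoC x) = RtoC x.
Proof. apply C_ext; simpl; ring. Qed.

(** The extreme powers of [l] cancel in the commutator. The coefficients of [l^-1] and [l] give the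
    equations of [fu] and [fw], and the coefficient of [l^0] gives that of [q]. *)
Lemma mder_lax_L (a b : C) (c : R) (th q : R -> R) (l : C) (s : R) :
  profile_ode (Cmod a) (Cmod b) c th q -> l <> 0%C ->
  mder (lax_L a b th q l) s
    (lax_L a b th q l s ** lax_a a b th l s +++ mneg (lax_a a b th l s ** lax_L a b th q l s)).
Proof.
intros (t0 & q0 & dt & dq) hl.
pose proof (cder_fu a th q s (dt s)) as hu; pose proof (cder_fw b th q s (dt s)) as hw.
eapply mder_eq; [|exact (mder_pencil Cinv _ _ _ _ _ _ l s (mder_offdiag hu hw)
  (mder_mdiag _ _ _ _ _ (cder_real _ _ _ (dq s))
     (cder_real _ _ _ (is_derive_opp _ _ _ (dq s))))
  (mder_offdiag (cder_conj hw) (cder_conj hu)))].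
assert (E : RtoC (-2 * ((Cmod a * exp (th s)) ^ 2 - (Cmod b * exp (- th s)) ^ 2))
  = (- (2) * (fu a th s * Cconj (fu a th s) - fw b th s * Cconj (fw b th s)))%C).
{ rewrite <- !Cmod2_conj; unfold fu, fw; rewrite !Cmod_mult, !Cmod_R.
  rewrite !(Rabs_pos_eq (exp _)) by (apply Rlt_le, exp_pos).
  apply C_ext; simpl; ring. }
change (opp (-2 * ((Cmod a * exp (th s)) ^ 2 - (Cmod b * exp (- th s)) ^ 2)))
  with (- (-2 * ((Cmod a * exp (th s)) ^ 2 - (Cmod b * exp (- th s)) ^ 2))).
rewrite (RtoC_opp (-2 * _)), E, !Cmult_conj, !Cconj_RtoC, (RtoC_opp (2 * _)), (RtoC_mult 2 (q s)).
unfold lax_L, lax_a, pencil, lax_P, lax_Q, lax_T, mneg, offdiag.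
rewrite RtoC_opp.
generalize (Cconj (fu a th s)) (Cconj (fw b th s)); intros u' w'.
generalize (fu a th s) (fw b th s) (RtoC (q s)); intros u w x.
apply M2_ext; m2_unfold; field; auto.
Qed.

Lemma lax_bounded (a b : C) (c : R) (th q : R -> R) :
  profile_ode (Cmod a) (Cmod b) c th q -> exists k, forall s,
    mbounded k (lax_P a b th s) /\ mbounded k (lax_Q q s) /\ mbounded k (lax_T a b th s)
    /\ mbounded k (mneg (lax_Q q s)) /\ mbounded k (mneg (lax_T a b th s))
    /\ mbounded k (mscal (- (2))%C (lax_T a b th s)).
Proof.
intros h; set (S := c ^ 2 + Cmod a ^ 2 + Cmod b ^ 2).
(* Each modulus is at most its square plus 1, hence at most [S + 1]; the factor 2 covers the doubled
   [lax_T] of [lax_b]. *)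
exists (2 * (S + 1)); intros s.
pose proof (profile_conserved h s) as E; fold S in E.
set (U := Cmod a * exp (th s)) in *; set (W := Cmod b * exp (- th s)) in *.
assert (hS : 0 <= S).
{ rewrite <- E; pose proof (pow2_ge_0 U); pose proof (pow2_ge_0 W);
  pose proof (pow2_ge_0 (q s)); lra. }
assert (hu : Cmod (fu a th s) <= S + 1).
{ unfold fu; rewrite Cmod_mult, Cmod_R, Rabs_pos_eq by (apply Rlt_le, exp_pos); fold U.
  pose proof (pow2_ge_0 W); pose proof (pow2_ge_0 (q s)); nra. }
assert (hw : Cmod (fw b th s) <= S + 1).
{ unfold fw; rewrite Cmod_mult, Cmod_R, Rabs_pos_eq by (apply Rlt_le, exp_pos); fold W.
  pose proof (pow2_ge_0 U); pose proof (pow2_ge_0 (q s)); nra. }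
assert (hq : Rabs (q s) <= S + 1).
{ pose proof (pow2_ge_0 W); pose proof (pow2_ge_0 U); apply Rabs_le; nra. }
assert (n2 : Cmod (- (2)) = 2).
{ rewrite Cmod_opp, Cmod_R; apply Rabs_pos_eq; lra. }
assert (n1 : Cmod (- (1)) = 1).
{ rewrite Cmod_opp, Cmod_R; apply Rabs_pos_eq; lra. }
assert (bT : mbounded (S + 1) (lax_T a b th s)).
{ entries; unfold lax_T, offdiag; cbn [m11 m12 m21 m22]; rewrite ?Cmod_conj, ?Cmod_0; lra. }
assert (bQ : mbounded (S + 1) (lax_Q q s)).
{ entries; unfold lax_Q, mdiag; cbn [m11 m12 m21 m22]; rewrite ?Cmod_R, ?Rabs_Ropp, ?Rabs_R0; lra. }
refine (conj _ (conj _ (conj _ (conj _ (conj _ _))))).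
- entries; unfold lax_P, offdiag; cbn [m11 m12 m21 m22]; rewrite ?Cmod_0; lra.
- eapply mbounded_le; [|exact bQ]; lra.
- eapply mbounded_le; [|exact bT]; lra.
- eapply mbounded_le; [|exact (mbounded_scal _ _ _ bQ)]; rewrite n1; lra.
- eapply mbounded_le; [|exact (mbounded_scal _ _ _ bT)]; rewrite n1; lra.
- eapply mbounded_le; [|exact (mbounded_scal _ _ _ bT)]; rewrite n2; lra.
Qed.

Lemma lax_cont (a b : C) (c : R) (th q : R -> R) :
  profile_ode (Cmod a) (Cmod b) c th q ->
  mcont (lax_P a b th) /\ mcont (lax_Q q) /\ mcont (lax_T a b th).
Proof.
intros (t0 & q0 & dt & dq); split; [|split].
- exact (mder_mcont _ _ (fun s => mder_offdiag (cder_fu a th q s (dt s))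
    (cder_fw b th q s (dt s)))).
- exact (mder_mcont _ _ (fun s => mder_mdiag _ _ _ _ _ (cder_real _ _ _ (dq s))
     (cder_real _ _ _ (is_derive_opp _ _ _ (dq s))))).
- exact (mder_mcont _ _ (fun s => mder_offdiag
    (cder_conj (cder_fw b th q s (dt s))) (cder_conj (cder_fu a th q s (dt s))))).
Qed.

Lemma lax_trace (a b : C) (th q : R -> R) (s : R) :
  mtrace (lax_P a b th s) = 0%C /\ mtrace (lax_Q q s) = 0%C /\ mtrace (lax_T a b th s) = 0%C.
Proof.
unfold lax_P, lax_Q, lax_T, offdiag; m2_unfold; rewrite RtoC_opp; repeat split; ring.
Qed.

Lemma Cinv_conj_unit (l : C) : Cmod l = 1 -> Cconj l = (/ l)%C.
Proof.
intros h.
assert (hl : l <> 0%C) by (apply Cmod_gt_0; lra).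
pose proof (Cmod2_conj l) as E; rewrite h in E.
rewrite <- (Cmult_1_l (Cconj l)), <- (Cinv_l l hl), <- Cmult_assoc, <- E.
apply C_ext; simpl; ring.
Qed.

(** On the circle conjugation turns [l] into [1 / l], so the adjoint exchanges the two outer terms
    of the pencil. *)
Lemma madj_lax (a b : C) (th q : R -> R) (l : C) (s : R) :
  Cmod l = 1 -> madj (lax_a a b th l s) = mneg (lax_a a b th l s)
    /\ madj (lax_L a b th q l s) = lax_L a b th q l s.
Proof.
intros h; pose proof (Cinv_conj_unit l h) as hl.
assert (hl' : Cconj (/ l) = l) by (rewrite <- hl; apply Cconj_conj).
unfold lax_a, lax_L, pencil, lax_P, lax_Q, lax_T, mneg, offdiag, madj; split;
  apply M2_ext; m2_unfold; rewrite ?Cplus_conj, ?Copp_conj, ?Cmult_conj, ?Cconj_conj, ?hl, ?hl';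
  rewrite ?Copp_conj, ?Cconj_conj; apply C_ext; simpl; try ring.
Qed.

Lemma pullback_delaunay (a b : C) (c : R) (z l : C) :
  pullback_exp (delaunay_potential a b c) z l = xi_m1 a b c l.
Proof.
unfold pullback_exp, delaunay_potential.
pose proof (cexp_neq_0 (cexp z)) as h; pose proof (cexp_neq_0 z) as h'.
generalize (xi_m1 a b c l); intros A.
apply M2_ext; m2_unfold; field; auto.
Qed.

Lemma cder_horizontal (s t : R) : cder (fun s => (s, t) : C) s 1%C.
Proof. split; simpl; auto_derive; auto. Qed.

Lemma cder_vertical (s t : R) : cder (fun t => (s, t) : C) t Ci.
Proof. split; simpl; auto_derive; auto. Qed.

Lemma mder_comp (G : C -> M2) (f : R -> C) (x : R) (v : C) (L : M2) :
  is_mderive G (f x) L -> cder f x v -> mder (fun t => G (f t)) x (mscal v L).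
Proof.
intros (g1 & g2 & g3 & g4) hf.
assert (H : forall m : M2 -> C, m (mscal v L) = (v * m L)%C ->
  is_cderive (fun w => m (G w)) (f x) (m L) -> cder (fun t => m (G (f t))) x (m (mscal v L))).
{ intros m e h; apply cder_eq with (m L * v)%C; [rewrite e; ring|].
  exact (cder_comp (fun w => m (G w)) f x _ _ h hf). }
exact (conj (H m11 eq_refl g1) (conj (H m12 eq_refl g2)
  (conj (H m21 eq_refl g3) (H m22 eq_refl g4)))).
Qed.

(** * Integrated frames and uniqueness of the unitary factor *)

Definition mconst_0 : M2 := mkM2 0 0 0 0.

(* [G], [X] and [E] integrate [lax_a], [lax_b] and [i xi_m1]: [E t ** G s] is the
   unitary Iwasawa factor of [exp ((s + i t) xi_m1)] and [mcof (X s)] the other one. *)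
Record loop_frames (a b : C) (c : R) (th q : R -> R) (G X E : C -> R -> M2) : Prop := {
  G_0 : forall l, G l 0 = mid;
  G_mder : forall l s, mder (G l) s (G l s ** lax_a a b th l s);
  G_det : forall l s, mdet (G l s) = 1%C;
  X_0 : forall l, X l 0 = mid;
  X_mder : forall l s, mder (X l) s (X l s ** lax_b a b th q l s);
  X_det : forall l s, mdet (X l s) = 1%C;
  E_0 : forall l, E l 0 = mid;
  E_mder : forall l t, mder (E l) t (E l t ** mscal Ci (lax_L a b th q l 0));
  E_det : forall l t, mdet (E l t) = 1%C;
  G_holo : forall l : C, l <> 0%C -> exists Y : R -> M2, forall s,
    is_mderive (fun l => G l s) l (Y s)
    /\ mder Y s (Y s ** lax_a a b th l s +++ G l s ** lax_a' a b th l s);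
  X_holo : forall l s, exists A, is_mderive (fun l => X l s) l A;
  E_holo : forall l : C, l <> 0%C -> exists Y : R -> M2, forall t,
    is_mderive (fun l => E l t) l (Y t)
    /\ mder Y t (Y t ** mscal Ci (lax_L a b th q l 0) +++ E l t ** mscal Ci (lax_L' a b th l 0))
}.
Arguments G_0 {_ _ _ _ _ _ _ _}.
Arguments G_mder {_ _ _ _ _ _ _ _}.
Arguments G_det {_ _ _ _ _ _ _ _}.
Arguments X_0 {_ _ _ _ _ _ _ _}.
Arguments X_mder {_ _ _ _ _ _ _ _}.
Arguments X_det {_ _ _ _ _ _ _ _}.
Arguments E_0 {_ _ _ _ _ _ _ _}.
Arguments E_mder {_ _ _ _ _ _ _ _}.
Arguments E_det {_ _ _ _ _ _ _ _}.
Arguments G_holo {_ _ _ _ _ _ _ _}.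
Arguments X_holo {_ _ _ _ _ _ _ _}.
Arguments E_holo {_ _ _ _ _ _ _ _}.

Lemma mcont_const (A : M2) : mcont (fun _ => A).
Proof.
exact (conj (ccont_const _) (conj (ccont_const _) (conj (ccont_const _) (ccont_const _)))).
Qed.

Lemma mtrace_mneg (A : M2) : mtrace A = 0%C -> mtrace (mneg A) = 0%C.
Proof. intros h; unfold mneg; rewrite mtrace_scal, h; ring. Qed.

Lemma loop_frames_exist (a b : C) (c : R) (th q : R -> R) :
  profile_ode (Cmod a) (Cmod b) c th q -> exists G X E, loop_frames a b c th q G X E.
Proof.
intros h.
destruct (lax_bounded a b c th q h) as [k hk].
assert (k0 : 0 <= k) by (eapply mbounded_nonneg; apply (hk 0)).
destruct (lax_cont a b c th q h) as (cP & cQ & cT).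
assert (b0 : mbounded k mconst_0).
{ entries; unfold mconst_0; cbn [m11 m12 m21 m22]; rewrite Cmod_0; lra. }
assert (ci : Cmod Ci = 1).
{ unfold Cmod, Ci; simpl fst; simpl snd; replace (0 ^ 2 + 1 ^ 2) with 1 by ring; apply sqrt_1. }
assert (bi : forall A, mbounded k A -> mbounded k (mscal Ci A)).
{ intros A hA; eapply mbounded_le; [|exact (mbounded_scal k Ci A hA)]; rewrite ci; lra. }
destruct (ode_family Cinv (lax_P a b th) (fun _ => mconst_0) (fun s => mneg (lax_T a b th s)) k)
  as (G & hG & hG'); auto; try (intros; apply hk).
{ apply mcont_const. } { now apply mcont_scal. }
{ intros; apply (lax_trace a b th q). }
{ intros; unfold mconst_0; m2_unfold; ring. }
{ intros; apply mtrace_mneg, (lax_trace a b th q). }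
(* [phi = 0] makes this frame holomorphic at [l = 0] as well. *)
destruct (ode_family (fun _ => 0%C) (lax_P a b th) (fun s => mneg (lax_Q q s))
  (fun s => mscal (- (2))%C (lax_T a b th s)) k)
  as (X & hX & hX'); auto; try (intros; apply hk).
{ now apply mcont_scal. } { now apply mcont_scal. }
{ intros; apply (lax_trace a b th q). }
{ intros; apply mtrace_mneg, (lax_trace a b th q). }
{ intros; rewrite mtrace_scal; replace (mtrace (lax_T a b th s)) with (RtoC 0); [ring|].
  symmetry; apply (lax_trace a b th q). }
(* The coefficients are frozen at [s = 0], where the Lax matrix is [xi_m1]. *)
destruct (ode_family Cinv (fun _ => mscal Ci (lax_P a b th 0)) (fun _ => mscal Ci (lax_Q q 0))
  (fun _ => mscal Ci (lax_T a b th 0)) k)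
  as (E & hE & hE'); auto; try apply mcont_const; try (intros; apply bi, hk).
{ intros; rewrite mtrace_scal; replace (mtrace (lax_P a b th 0)) with (RtoC 0); [ring|].
  symmetry; apply (lax_trace a b th q). }
{ intros; rewrite mtrace_scal; replace (mtrace (lax_Q q 0)) with (RtoC 0); [ring|].
  symmetry; apply (lax_trace a b th q). }
{ intros; rewrite mtrace_scal; replace (mtrace (lax_T a b th 0)) with (RtoC 0); [ring|].
  symmetry; apply (lax_trace a b th q). }
assert (eE : forall l t, pencil Cinv (fun _ => mscal Ci (lax_P a b th 0))
   (fun _ => mscal Ci (lax_Q q 0)) (fun _ => mscal Ci (lax_T a b th 0)) l t
   = mscal Ci (lax_L a b th q l 0)).
{ intros; unfold lax_L, pencil; m2_ring. }
exists G, X, E; split.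
- intros l; apply hG.
- intros l; exact (proj1 (proj2 (hG l))).
- intros l; exact (proj2 (proj2 (hG l))).
- intros l; apply hX.
- intros l; exact (proj1 (proj2 (hX l))).
- intros l; exact (proj2 (proj2 (hX l))).
- intros l; apply hE.
- intros l t; rewrite <- (eE l t); exact (proj1 (proj2 (hE l)) t).
- intros l; exact (proj2 (proj2 (hE l))).
- intros l hl; exact (hG' l _ (is_cderive_inv l hl)).
- intros l s; destruct (hX' l 0%C (is_cderive_const 0%C l)) as [Y hY].
  exists (Y s); apply hY.
- intros l hl; destruct (hE' l _ (is_cderive_inv l hl)) as [Y hY].
  exists Y; intros t; destruct (hY t) as [h1 h2]; split; [exact h1|].
  rewrite eE in h2; eapply mder_eq; [|exact h2].
  unfold lax_L'; f_equal; f_equal; m2_ring.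
Qed.

Lemma lax_b_eq (a b : C) (th q : R -> R) (l : C) (s : R) :
  lax_b a b th q l s = lax_a a b th l s +++ mneg (lax_L a b th q l s).
Proof. unfold lax_b, lax_a, lax_L, pencil, mneg; m2_ring. Qed.

Lemma lax_traces (a b : C) (th q : R -> R) (l : C) (s : R) :
  mtrace (lax_a a b th l s) = 0%C /\ mtrace (lax_b a b th q l s) = 0%C
  /\ mtrace (lax_L a b th q l s) = 0%C.
Proof.
destruct (lax_trace a b th q s) as (tP & tQ & tT).
unfold lax_a, lax_b, lax_L, pencil, mneg.
rewrite !mtrace_add, !mtrace_scal, tP, tQ, tT.
replace (mtrace (mkM2 0 0 0 0)) with (RtoC 0) by (m2_unfold; ring).
repeat split; ring.
Qed.

(** At [l = 0] the coefficient [lax_b] reduces to [diag(- q, q)], and [th' = 2 q] integrates it. The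
    diagonal is positive, as required of the second Iwasawa factor. *)
Lemma X_at_0 (a b : C) (c : R) (th q : R -> R) (G X E : C -> R -> M2) (s : R) :
  profile_ode (Cmod a) (Cmod b) c th q -> loop_frames a b c th q G X E ->
  X 0%C s = mdiag (RtoC (exp (- th s / 2))) (RtoC (exp (th s / 2))).
Proof.
intros (t0 & q0 & dt & dq) fr.
set (Dg := fun s => mdiag (RtoC (exp (th s / 2))) (RtoC (exp (- th s / 2)))).
assert (dD : forall s, mder Dg s (mdiag (RtoC (q s) * RtoC (exp (th s / 2)))%C
   (- RtoC (q s) * RtoC (exp (- th s / 2)))%C)).
{ intros x; apply (mder_mdiag (fun s => RtoC (exp (th s / 2))) (fun s => RtoC (exp (- th s / 2)))).
  - rewrite <- RtoC_mult; apply (cder_real (fun s => exp (th s / 2))).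
    auto_derive; [eexists; apply dt|]; rewrite_Derive (dt x).
    change (th x * / 2) with (th x / 2); field.
  - rewrite <- RtoC_opp, <- RtoC_mult; apply (cder_real (fun s => exp (- th s / 2))).
    auto_derive; [eexists; apply dt|]; rewrite_Derive (dt x).
    change (- th x * / 2) with (- th x / 2); field. }
assert (hc : X 0%C s ** Dg s = X 0%C 0 ** Dg 0).
{ apply (mder_zero_const (fun s => X 0%C s ** Dg s)); intros x.
  eapply mder_eq; [|exact (mder_mul (X_mder fr 0%C x) (dD x))].
  unfold lax_b, pencil, lax_Q, mneg, Dg; rewrite RtoC_opp.
  generalize (X 0%C x) (RtoC (exp (th x / 2))) (RtoC (exp (- th x / 2))) (RtoC (q x)).
  intros [A11 A12 A21 A22] e1 e2 y; apply M2_ext; m2_unfold; ring. }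
rewrite (X_0 fr) in hc.
assert (D0 : Dg 0 = mid).
{ unfold Dg, mid; rewrite t0; replace (0 / 2) with 0 by field;
  replace (- 0 / 2) with 0 by field; now rewrite exp_0. }
rewrite D0, mmul_1_l in hc.
assert (e : (RtoC (exp (th s / 2)) * RtoC (exp (- th s / 2)) = 1)%C).
{ rewrite <- RtoC_mult, <- exp_plus; replace (th s / 2 + - th s / 2) with 0 by field.
  now rewrite exp_0. }
assert (e' : Dg s ** mdiag (RtoC (exp (- th s / 2))) (RtoC (exp (th s / 2))) = mid).
{ unfold Dg; apply M2_ext; m2_unfold; try ring.
  - rewrite <- e; ring.
  - rewrite <- e; ring. }
rewrite <- (mmul_1_r (X 0%C s)), <- e', mmul_assoc, hc; apply mmul_1_l.
Qed.

Lemma mneg_cancel (A : M2) : A +++ mneg A = mkM2 0 0 0 0.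
Proof. unfold mneg; m2_ring. Qed.

(** [L] commutes with itself, so it satisfies the Lax equation for [lax_b = lax_a - L] as well as
    for [lax_a]. For [E] the coefficient is constant, and the Lax equation of a constant [B] is
    commutation. *)
Lemma frame_commutation (a b : C) (c : R) (th q : R -> R) (G X E : C -> R -> M2) (l : C) :
  profile_ode (Cmod a) (Cmod b) c th q -> loop_frames a b c th q G X E -> l <> 0%C ->
  (forall s, G l s ** lax_L a b th q l s = lax_L a b th q l 0 ** G l s)
  /\ (forall s, X l s ** lax_L a b th q l s = lax_L a b th q l 0 ** X l s)
  /\ forall t B, B ** lax_L a b th q l 0 = lax_L a b th q l 0 ** B -> E l t ** B = B ** E l t.
Proof.
intros h fr hl; split; [|split].
- apply (lax_conjugation (G l) (lax_L a b th q l) (lax_a a b th l)).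
  + apply fr.
  + exact (G_mder fr l).
  + intros s; apply (lax_traces a b th q).
  + intros s; now apply mder_lax_L with c.
- apply (lax_conjugation (X l) (lax_L a b th q l) (lax_b a b th q l)).
  + apply fr.
  + exact (X_mder fr l).
  + intros s; apply (lax_traces a b th q).
  + intros s; eapply mder_eq; [|now apply mder_lax_L with c].
    rewrite lax_b_eq; unfold mneg; m2_expand.
- intros t B hB.
  apply (lax_conjugation (E l) (fun _ => B) (fun _ => mscal Ci (lax_L a b th q l 0))).
  + apply fr.
  + exact (E_mder fr l).
  + intros s; rewrite mtrace_scal, (proj2 (proj2 (lax_traces a b th q l 0))); ring.
  + intros s; eapply mder_eq; [|apply mder_const].
    rewrite mmul_scal_l, mmul_scal_r, hB; now rewrite mneg_cancel.
Qed.

(** In the [t] direction [Phi E^-1] is constant, which leaves the case [t = 0]. [E] then moves to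
    the left past [G X^-1], which commutes with [A] because [G] and [X] both conjugate [L] into
    [A]. *)
Lemma Phi_factorization (a b : C) (c : R) (th q : R -> R) (G X E : C -> R -> M2)
    (r : R) (Phi : C -> C -> M2) (l : C) (s t : R) :
  profile_ode (Cmod a) (Cmod b) c th q -> loop_frames a b c th q G X E ->
  0 < r -> Cmod l = r ->
  solves r (pullback_exp (delaunay_potential a b c)) (fun _ => mid) 0%C Phi ->
  Phi (s, t) l = E l t ** G l s ** mcof (X l s).
Proof.
intros h fr hr hl hPhi.
assert (l0 : l <> 0%C) by (apply Cmod_gt_0; lra).
destruct (hPhi l hl) as [P0 dP].
destruct (frame_commutation a b c th q G X E l h fr l0) as (hG & hX & hE).
set (A := lax_L a b th q l 0) in *.
assert (eA : xi_m1 a b c l = A).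
{ symmetry; apply lax_L_0; apply h. }
assert (dS : forall x, mder (fun s => Phi (s, 0) l) x (Phi (x, 0) l ** A)).
{ intros x; eapply mder_eq; [|exact (mder_comp (fun w => Phi w l) _ x _ _ (dP (x, 0))
    (cder_horizontal x 0))].
  rewrite pullback_delaunay, eA; m2_ring. }
assert (dT : forall y, mder (fun t => Phi (s, t) l) y (mscal Ci (Phi (s, y) l ** A))).
{ intros y; eapply mder_eq; [|exact (mder_comp (fun w => Phi w l) _ y _ _ (dP (s, y))
    (cder_vertical s y))].
  now rewrite pullback_delaunay, eA. }
assert (dcof : forall (Y : R -> M2) M x, mtrace M = 0%C -> mder Y x (Y x ** M) ->
   mder (fun x => mcof (Y x)) x (mneg (M ** mcof (Y x)))).
{ intros Y M x hM hY; eapply mder_eq; [|exact (mder_cof hY)].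
  rewrite mcof_mmul, mcof_traceless by easy; unfold mneg; m2_expand. }
(* The derivative is [Phi X (L + lax_b - lax_a) G^-1], after [A X = X L], and the bracket
   vanishes. *)
assert (S1 : Phi (s, 0) l ** X l s ** mcof (G l s) = mid).
{ transitivity (Phi (0, 0) l ** X l 0 ** mcof (G l 0)).
  - apply (mder_zero_const (fun s => Phi (s, 0) l ** X l s ** mcof (G l s))); intros x.
    eapply mder_eq; [|exact (mder_mul (mder_mul (dS x)
      (X_mder fr l x))
      (dcof (G l) _ x (proj1 (lax_traces a b th q l x)) (G_mder fr l x)))].
    rewrite lax_b_eq; unfold mneg.
    rewrite <- (mmul_assoc _ A (X l x)), <- hX, !mmul_add_r.
    m2_expand.
  - rewrite (X_0 fr), (G_0 fr), mcof_mid, !mmul_1_r.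
    exact P0. }
assert (S2 : Phi (s, 0) l = G l s ** mcof (X l s)).
{ rewrite <- (mmul_cancel_cof (Phi (s, 0) l) (X l s)) by apply fr.
  rewrite <- (mmul_cof_cancel (Phi (s, 0) l ** X l s) (G l s)) by apply fr.
  now rewrite S1, mmul_1_l. }
assert (S3 : Phi (s, t) l ** mcof (E l t) = Phi (s, 0) l).
{ transitivity (Phi (s, 0) l ** mcof (E l 0)).
  - apply (mder_zero_const (fun t => Phi (s, t) l ** mcof (E l t))); intros y.
    assert (tA : mtrace (mscal Ci A) = 0%C).
    { rewrite mtrace_scal; unfold A; rewrite (proj2 (proj2 (lax_traces a b th q l 0))); ring. }
    eapply mder_eq; [|exact (mder_mul (dT y)
      (dcof (E l) _ y tA (E_mder fr l y)))].
    unfold mneg; m2_expand.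
  - rewrite (E_0 fr), mcof_mid; apply mmul_1_r. }
rewrite <- (mmul_cof_cancel (Phi (s, t) l) (E l t)), S3, S2 by apply fr.
symmetry; rewrite <- (mmul_assoc (E l t)); apply hE.
assert (hX' : mcof (X l s) ** A = lax_L a b th q l s ** mcof (X l s)).
{ rewrite <- (mmul_cancel_cof (mcof (X l s) ** A) (X l s)) by apply fr.
  rewrite <- (mmul_assoc _ A), <- hX, mmul_assoc.
  now rewrite mmul_mcof_l, mmul_1_l by apply fr. }
now rewrite <- mmul_assoc, hX', !mmul_assoc, hG.
Qed.

Lemma in_SU2_mmul (A B : M2) : in_SU2 A -> in_SU2 B -> in_SU2 (A ** B).
Proof.
intros hA hB; rewrite <- (mcof_mcof A); apply in_SU2_cof_mul; [|easy].
rewrite <- (mmul_1_r (mcof A)); apply in_SU2_cof_mul; [easy|].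
split.
- apply M2_ext; unfold madj; m2_unfold; apply C_ext; simpl; ring.
- m2_unfold; ring.
Qed.

(** On the circle [L] is hermitian, so [i L] is skew-hermitian, and so is [lax_a]: both factors
    solve equations in [su(2)]. *)
Lemma loop_frame_unitary (a b : C) (c : R) (th q : R -> R) (G X E : C -> R -> M2) (l : C) :
  loop_frames a b c th q G X E -> Cmod l = 1 ->
  forall s t, in_SU2 (E l t ** G l s).
Proof.
intros fr hl s t; apply in_SU2_mmul.
- apply (unitary_ode (E l) (fun _ => mscal Ci (lax_L a b th q l 0))).
  + apply fr.
  + exact (E_mder fr l).
  + intros _; rewrite mtrace_scal, (proj2 (proj2 (lax_traces a b th q l 0))); ring.
  + intros _; pose proof (proj2 (madj_lax a b th q l 0 hl)) as h.
    replace (madj (mscal Ci (lax_L a b th q l 0))) with (mscal (Cconj Ci) (madj (lax_L a b th q l 0)))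
      by (unfold mscal, madj; cbn [m11 m12 m21 m22]; now rewrite !Cmult_conj).
    rewrite h; replace (Cconj Ci) with (- (1) * Ci)%C by (apply C_ext; simpl; ring).
    unfold mneg; m2_ring.
- apply (unitary_ode (G l) (lax_a a b th l)).
  + apply fr.
  + exact (G_mder fr l).
  + intros x; apply (lax_traces a b th q).
  + intros x; apply (madj_lax a b th q l x hl).
Qed.

(** On [|l| = r] one has [(E G)^-1 F = X^-1 B^-1]. The left side extends to [r <= |l| <= 1] and the
    right side to the disc, so the rigidity lemma applies. *)
Lemma iwasawa_factor_unique (a b : C) (c : R) (th q : R -> R) (G X E : C -> R -> M2)
    (r : R) (Phi : C -> C -> M2) (F B : C -> M2) (s t : R) :
  profile_ode (Cmod a) (Cmod b) c th q -> loop_frames a b c th q G X E ->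
  0 < r <= 1 ->
  solves r (pullback_exp (delaunay_potential a b c)) (fun _ => mid) 0%C Phi ->
  iwasawa r (Phi (s, t)) F B ->
  forall l, Cmod l = 1 -> F l = E l t ** G l s.
Proof.
intros h fr hr hPhi ((Fsl & Fann & FSU) & (Bsl & Bdisc & rho & hrho & B0) & hFB) l hl.
set (FF := fun l => E l t ** G l s).
assert (dFF : forall l, mdet (FF l) = 1%C).
{ intros l'; unfold FF; rewrite mdet_mmul.
  rewrite (E_det fr), (G_det fr); ring. }
assert (hFF : forall z : C, z <> 0%C -> exists A, is_mderive FF z A).
{ intros z hz; destruct (G_holo fr z hz) as [Y hY].
  destruct (E_holo fr z hz) as [Z hZ].
  eexists; exact (is_mderive_mul _ _ z _ _ (proj1 (hZ t)) (proj1 (hY s))). }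
assert (E1 : mcof (FF l) ** F l = mid).
(* [exp (th s / 2) / rho] is the upper left entry of [X^-1 B^-1] at 0. *)
{ apply (su2_loop_rigidity (fun l => mcof (FF l) ** F l)
    (fun l => mcof (X l s) ** mcof (B l)) r (exp (th s / 2) * / rho)); auto.
  - apply Rmult_lt_0_compat; [apply exp_pos | now apply Rinv_0_lt_compat].
  - intros z hz.
    assert (z0 : z <> 0%C) by (apply Cmod_gt_0; lra).
    destruct (hFF z z0) as [A hA].
    assert (hF : mholo_at F z).
    { destruct (Rle_lt_or_eq_dec r (Cmod z)) as [h1 | h1]; [lra | | now apply Fsl].
      apply Fann; split; [easy|].
      apply Rle_lt_trans with 1; [lra|]; rewrite <- Rinv_1; apply Rinv_lt_contravar; lra. }
    destruct (mholo_at_is_mderive F z hF) as [A' hA'].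
    eexists; exact (is_mderive_mul _ _ z _ _ (is_mderive_cof hA) hA').
  - intros z hz; destruct (X_holo fr z s) as [A hA].
    assert (hB : mholo_at B z).
    { destruct (Rle_lt_or_eq_dec (Cmod z) r hz) as [h1 | h1]; [now apply Bdisc | now apply Bsl]. }
    destruct (mholo_at_is_mderive B z hB) as [A' hA'].
    eexists; exact (is_mderive_mul _ _ z _ _ (is_mderive_cof hA) (is_mderive_cof hA')).
  - intros z hz; cbv beta.
    destruct (Bsl z hz) as (_ & _ & dB).
    rewrite <- (mmul_cancel_cof (F z) (B z) dB), <- hFB by easy.
    rewrite (Phi_factorization a b c th q G X E r Phi z s t h fr (proj1 hr) hz hPhi).
    fold (FF z); rewrite !mmul_assoc, mmul_mcof_l by apply dFF.
    now rewrite mmul_1_l.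
  - intros z hz; apply in_SU2_cof_mul; [|now apply FSU].
    now apply (loop_frame_unitary a b c th q G X E).
  - cbv beta; rewrite (X_at_0 a b c th q G X E s h fr), B0.
    assert (e1 : exp (- th s / 2) = / exp (th s / 2)).
    { rewrite <- exp_Ropp; f_equal; field. }
    pose proof (exp_pos (th s / 2)).
    apply M2_ext; m2_unfold.
    + transitivity (RtoC (exp (th s / 2) * / rho)); [rewrite RtoC_mult; ring | reflexivity].
    + apply C_ext; simpl; ring.
    + apply C_ext; simpl; ring.
    + rewrite Rinv_mult, Rinv_inv, <- e1, RtoC_mult; ring. }
change (F l = FF l).
rewrite <- (mmul_1_r (FF l)), <- E1, mmul_assoc, mmul_mcof_r by apply dFF.
now rewrite mmul_1_l.
Qed.

(** * The Sym-Bobenko formula along the frame *)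

(** The derivative of the frame in [l] enters as a separate argument [Y], because its derivatives in
    [s] and [t] come from equations of its own. *)
Definition sym_matrix (H : R) (l : C) (F Y : M2) : M2 :=
  mscal (RtoC (- (1 / H)))
    (mscal (Ci * l)%C (Y ** mcof F) +++ mscal (Ci / 2)%C (F ** Defs.sigma ** mcof F)).

(** [Y] stands for the derivative of [F] in [l]: its equations are those of [F] differentiated in
    [l]. *)
Record frame_pair (a b : C) (th q : R -> R) (l : C) (F Y : R -> R -> M2) : Prop := {
  fp_SU2 : forall s t, in_SU2 (F s t);
  fp_F_s : forall s t, mder (fun s => F s t) s (F s t ** lax_a a b th l s);
  fp_F_t : forall s t, mder (fun t => F s t) t (F s t ** mscal Ci (lax_L a b th q l s));
  fp_Y_s : forall s t, mder (fun s => Y s t) s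
    (Y s t ** lax_a a b th l s +++ F s t ** lax_a' a b th l s);
  fp_Y_t : forall s t, mder (fun t => Y s t) t
    (Y s t ** mscal Ci (lax_L a b th q l s) +++ F s t ** mscal Ci (lax_L' a b th l s)) }.
Arguments fp_SU2 {_ _ _ _ _ _ _}.
Arguments fp_F_s {_ _ _ _ _ _ _}.
Arguments fp_F_t {_ _ _ _ _ _ _}.
Arguments fp_Y_s {_ _ _ _ _ _ _}.
Arguments fp_Y_t {_ _ _ _ _ _ _}.

Lemma generated_frame_pair (H r : R) (a b : C) (c : R) (th q : R -> R) (f : C -> C -> R3) :
  0 < r <= 1 -> profile_ode (Cmod a) (Cmod b) c th q ->
  dpw_generates H r (pullback_exp (delaunay_potential a b c)) (fun _ => mid) 0%C f ->
  forall l, Cmod l = 1 -> exists F Y, frame_pair a b th q l F Y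
    /\ forall s t, f l (s, t) = su2_coords (sym_matrix H l (F s t) (Y s t)).
Proof.
intros hr h (Phi & F & B & hPhi & hFB & hf) l hl.
destruct (loop_frames_exist a b c th q h) as (G & X & E & fr).
assert (l0 : l <> 0%C) by (apply Cmod_gt_0; lra).
destruct (G_holo fr l l0) as [YG hG].
destruct (E_holo fr l l0) as [YE hE].
set (FF := fun s t => E l t ** G l s).
set (YY := fun s t => YE t ** G l s +++ E l t ** YG s).
destruct (frame_commutation a b c th q G X E l h fr l0) as (cG & _ & cE).
set (A := lax_L a b th q l 0) in *; set (A' := lax_L' a b th l 0).
(* The derivative in [l] of [G L = A G]. *)
assert (dc : forall s, A' ** G l s +++ A ** YG s
   = YG s ** lax_L a b th q l s +++ G l s ** lax_L' a b th l s).
{ intros s.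
  assert (dL : forall s, is_mderive (fun l => lax_L a b th q l s) l (lax_L' a b th l s)).
  { intros x; apply is_mderive_pencil; now apply is_cderive_inv. }
  refine (is_mderive_unique (fun l => G l s ** lax_L a b th q l s) l _ _ _
    (is_mderive_mul _ _ l _ _ (proj1 (hG s)) (dL s))).
  (* Commutation is available away from 0, and the open disc of radius 1 around the unimodular [l]
     avoids 0. *)
  apply (is_mderive_ext_near (fun l => lax_L a b th q l 0 ** G l s) _ l _ 1 Rlt_0_1).
  - intros w hw; symmetry.
    apply (frame_commutation a b c th q G X E w h fr).
    apply Cmod_gt_0; pose proof (Cmod_triangle (l - w) w) as h1.
    replace (l - w + w)%C with l in h1 by ring.
    replace (l - w)%C with (- (w - l))%C in h1 by ring; rewrite Cmod_opp in h1; lra.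
  - exact (is_mderive_mul _ _ l _ _ (dL 0) (proj1 (hG s))). }
assert (z0 : forall B, mkM2 0 0 0 0 ** B = mkM2 0 0 0 0) by (intros; m2_ring).
assert (z1 : forall B, B ** mkM2 0 0 0 0 = mkM2 0 0 0 0) by (intros; m2_ring).
assert (z2 : forall B, mkM2 0 0 0 0 +++ B = B) by (intros; m2_ring).
assert (z3 : forall B, B +++ mkM2 0 0 0 0 = B) by (intros; m2_ring).
exists FF, YY; split; [split|].
- intros s t; now apply (loop_frame_unitary a b c th q G X E).
- intros s t; eapply mder_eq; [|exact (mder_mul (mder_const (E l t) s)
    (G_mder fr l s))].
  rewrite z0, z2; apply mmul_assoc.
- intros s t; eapply mder_eq; [|exact (mder_mul (E_mder fr l t)
    (mder_const (G l s) t))].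
  rewrite z1, z3; unfold FF; fold A.
  rewrite mmul_scal_r, mmul_scal_l, mmul_scal_r, <- !mmul_assoc; now rewrite cG.
- intros s t; eapply mder_eq; [|exact (mder_add
    (mder_mul (mder_const (YE t) s) (G_mder fr l s))
    (mder_mul (mder_const (E l t) s) (proj2 (hG s))))].
  rewrite !z0, !z2; unfold FF, YY; m2_expand.
- intros s t; eapply mder_eq; [|exact (mder_add
    (mder_mul (proj2 (hE t)) (mder_const (G l s) t))
    (mder_mul (E_mder fr l t) (mder_const (YG s) t)))].
  rewrite !z1, !z3; unfold FF, YY; fold A; fold A'.
  transitivity (mscal Ci (YE t ** (A ** G l s) +++ E l t ** (A' ** G l s +++ A ** YG s))).
  + m2_expand.
  + rewrite dc, <- cG; m2_expand.
- intros s t; rewrite hf by easy.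
  assert (hF : forall w, Cmod w = 1 -> F (s, t) w = E w t ** G w s).
  { exact (iwasawa_factor_unique a b c th q G X E r Phi _ _ s t h fr hr hPhi (hFB (s, t))). }
  destruct (hFB (s, t)) as ((Fsl & Fann & FSU) & _).
  assert (hFh : mholo_at (F (s, t)) l).
  { destruct (Rle_lt_or_eq_dec r 1) as [h1 | h1]; [lra | | apply Fsl; lra].
    apply Fann; rewrite hl; split; [easy|].
    rewrite <- Rinv_1; apply Rinv_lt_contravar; lra. }
  destruct (mholo_at_is_mderive _ _ hFh) as [D hD].
  assert (hY : is_mderive (fun w => E w t ** G w s) l (YY s t)).
  { exact (is_mderive_mul _ _ l _ _ (proj1 (hE t)) (proj1 (hG s))). }
  (* The given frame agrees with [E G] on the unit circle, and that determines its derivative. *)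
  assert (eD : D = YY s t).
  { destruct hD as (d1 & d2 & d3 & d4); destruct hY as (y1 & y2 & y3 & y4).
    apply M2_ext.
    - refine (is_cderive_circle_unique _ _ l _ _ hl _ d1 y1); intros w hw; now rewrite hF.
    - refine (is_cderive_circle_unique _ _ l _ _ hl _ d2 y2); intros w hw; now rewrite hF.
    - refine (is_cderive_circle_unique _ _ l _ _ hl _ d3 y3); intros w hw; now rewrite hF.
    - refine (is_cderive_circle_unique _ _ l _ _ hl _ d4 y4); intros w hw; now rewrite hF. }
  unfold sym_bobenko, sym_matrix; rewrite (is_mderive_mderive hD), eD, (hF l hl).
  fold (FF s t); rewrite minv_mcof; [reflexivity|].
  apply (loop_frame_unitary a b c th q G X E l fr hl s t).
Qed.

(** * The moving frame of the surface *)

Definition is_vder (p : R -> R3) (t : R) (v : R3) : Prop :=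
  is_derive (fun t => cx (p t)) t (cx v) /\ is_derive (fun t => cy (p t)) t (cy v)
  /\ is_derive (fun t => cz (p t)) t (cz v).

Definition vcomb (E1 E2 E3 : R3) (x y z : R) : R3 :=
  vadd (vadd (vscal x E1) (vscal y E2)) (vscal z E3).

Record orthoframe (E1 E2 E3 : R3) : Prop := {
  of_11 : dot E1 E1 = 1; of_22 : dot E2 E2 = 1; of_33 : dot E3 E3 = 1;
  of_12 : dot E1 E2 = 0; of_13 : dot E1 E3 = 0; of_23 : dot E2 E3 = 0;
  of_c12 : cross E1 E2 = E3; of_c23 : cross E2 E3 = E1; of_c31 : cross E3 E1 = E2 }.
Arguments of_11 {_ _ _}.
Arguments of_22 {_ _ _}.
Arguments of_12 {_ _ _}.
Arguments of_c12 {_ _ _}.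

(* [X] has differential and frame connection those of the Sym-Bobenko surface
   with [a / l = a1 + i a2] and [b / l = b1 + i b2]. *)
Record moving_frame (H a1 a2 b1 b2 : R) (th q : R -> R) (X E1 E2 E3 : R -> R -> R3) : Prop := {
  mf_ortho : forall s t, orthoframe (E1 s t) (E2 s t) (E3 s t);
  mf_X_s : forall s t, is_vder (fun s => X s t) s
    (vcomb (E1 s t) (E2 s t) (E3 s t)
       0 (- (2 / H) * (a2 * exp (th s))) (2 / H * (a1 * exp (th s))));
  mf_X_t : forall s t, is_vder (fun t => X s t) t
    (vcomb (E1 s t) (E2 s t) (E3 s t)
       0 (- (2 / H) * (a1 * exp (th s))) (- (2 / H) * (a2 * exp (th s))));
  mf_E1_s : forall s t, is_vder (fun s => E1 s t) s
    (vcomb (E1 s t) (E2 s t) (E3 s t)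
       0 (2 * (a2 * exp (th s) + b2 * exp (- th s))) (- (2) * (a1 * exp (th s) - b1 * exp (- th s))));
  mf_E2_s : forall s t, is_vder (fun s => E2 s t) s
    (vcomb (E1 s t) (E2 s t) (E3 s t) (- (2) * (a2 * exp (th s) + b2 * exp (- th s))) 0 0);
  mf_E3_s : forall s t, is_vder (fun s => E3 s t) s
    (vcomb (E1 s t) (E2 s t) (E3 s t) (2 * (a1 * exp (th s) - b1 * exp (- th s))) 0 0);
  mf_E1_t : forall s t, is_vder (fun t => E1 s t) t
    (vcomb (E1 s t) (E2 s t) (E3 s t)
       0 (2 * (a1 * exp (th s) + b1 * exp (- th s))) (2 * (a2 * exp (th s) - b2 * exp (- th s))));
  mf_E2_t : forall s t, is_vder (fun t => E2 s t) t
    (vcomb (E1 s t) (E2 s t) (E3 s t)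
       (- (2) * (a1 * exp (th s) + b1 * exp (- th s))) 0 (2 * q s));
  mf_E3_t : forall s t, is_vder (fun t => E3 s t) t
    (vcomb (E1 s t) (E2 s t) (E3 s t)
       (- (2) * (a2 * exp (th s) - b2 * exp (- th s))) (- (2) * q s) 0) }.
Arguments mf_ortho {_ _ _ _ _ _ _ _ _ _ _}.

Lemma R3_ext (p q : R3) : cx p = cx q -> cy p = cy q -> cz p = cz q -> p = q.
Proof. destruct p, q; simpl; congruence. Qed.

Lemma is_vder_eq (p : R -> R3) (t : R) (v w : R3) : v = w -> is_vder p t v -> is_vder p t w.
Proof. now intros ->. Qed.

Lemma su2_inner_derive (F : R -> M2) (t : R) (F' N : M2) :
  mder F t F' -> is_derive (fun t => su2_inner (F t) N) t (su2_inner F' N).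
Proof.
intros h.
assert (hs : forall A, - (1 / 2) * Re (m11 A + m22 A)%C = - Re (mtrace A) / 2).
{ intros A; unfold mtrace; field. }
pose proof (mder_mul h (mder_const N t)) as (h1 & _ & _ & h4).
destruct (cder_plus h1 h4) as [hR _].
replace (su2_inner F' N) with
  (- (1 / 2) * Re (m11 (F' ** N +++ F t ** mkM2 0 0 0 0) + m22 (F' ** N +++ F t ** mkM2 0 0 0 0))%C).
- apply (is_derive_ext (fun t => - (1 / 2) * Re (m11 (F t ** N) + m22 (F t ** N))%C)).
  + intros x; apply hs.
  + exact (is_derive_scal _ _ (- (1 / 2)) _ hR).
- unfold su2_inner, mtrace; m2_unfold; unfold Re; simpl; field.
Qed.

Lemma su2_coords_vder (F : R -> M2) (t : R) (F' : M2) :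
  mder F t F' -> is_vder (fun t => su2_coords (F t)) t (su2_coords F').
Proof.
intros h; refine (conj _ (conj _ _)); unfold su2_coords; cbn [cx cy cz];
  now apply su2_inner_derive.
Qed.

Definition su2_mat (x y z : R) : M2 :=
  mscal (RtoC x) e1 +++ mscal (RtoC y) e2 +++ mscal (RtoC z) e3.

(** The image of [e] under the rotation of [su(2)] that [F] induces by conjugation. *)
Definition frame_vec (F e : M2) : R3 := su2_coords (F ** e ** mcof F).

Lemma su2_inner_add (A B N : M2) : su2_inner (A +++ B) N = su2_inner A N + su2_inner B N.
Proof. unfold su2_inner, mtrace; m2_unfold; unfold Re; simpl; field. Qed.

Lemma su2_inner_scal (k : R) (A N : M2) : su2_inner (mscal (RtoC k) A) N = k * su2_inner A N.
Proof. unfold su2_inner, mtrace; m2_unfold; unfold Re; simpl; field. Qed.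

Lemma frame_vec_comb (F : M2) (x y z : R) :
  su2_coords (F ** su2_mat x y z ** mcof F)
  = vcomb (frame_vec F e1) (frame_vec F e2) (frame_vec F e3) x y z.
Proof.
unfold su2_mat; rewrite !mmul_add_r, !mmul_add_l, !mmul_scal_r, !mmul_scal_l.
unfold vcomb, frame_vec, su2_coords, vadd, vscal; cbn [cx cy cz].
now rewrite !su2_inner_add, !su2_inner_scal.
Qed.

Lemma frame_vec_orthoframe (F : M2) :
  in_SU2 F -> orthoframe (frame_vec F e1) (frame_vec F e2) (frame_vec F e3).
Proof.
intros h; destruct (in_SU2_shape F h) as [h1 h2]; destruct (in_SU2_rows F h) as [h3 _].
destruct F as [[x1 x2] [y1 y2] w z]; cbn [m11 m12 m21 m22] in *; subst w z.
rewrite !Cmod2_alt in h3; simpl in h3.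
assert (N : x1 * x1 + x2 * x2 + (y1 * y1 + y2 * y2) = 1) by lra; clear h h3.
(* The coordinates of the rotation attached to a unit quaternion are quadratic. Inserting powers of
   [n = 1] makes the orthogonality relations homogeneous, hence polynomial identities. *)
set (n := x1 * x1 + x2 * x2 + (y1 * y1 + y2 * y2)) in N.
assert (V1 : frame_vec (mkM2 (x1, x2) (y1, y2) (- Cconj (y1, y2))%C (Cconj (x1, x2))) e1
  = mkR3 (x1 * x1 + x2 * x2 - y1 * y1 - y2 * y2) (2 * (x1 * y2 + x2 * y1))
         (2 * (x2 * y2 - x1 * y1))).
{ apply R3_ext; unfold frame_vec, su2_coords, su2_inner, e1, e2, e3; m2_unfold;
   unfold Re; simpl; field. }
assert (V2 : frame_vec (mkM2 (x1, x2) (y1, y2) (- Cconj (y1, y2))%C (Cconj (x1, x2))) e2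
  = mkR3 (2 * (x2 * y1 - x1 * y2)) (x1 * x1 - x2 * x2 + y1 * y1 - y2 * y2)
         (2 * (x1 * x2 + y1 * y2))).
{ apply R3_ext; unfold frame_vec, su2_coords, su2_inner, e1, e2, e3; m2_unfold;
   unfold Re; simpl; field. }
assert (V3 : frame_vec (mkM2 (x1, x2) (y1, y2) (- Cconj (y1, y2))%C (Cconj (x1, x2))) e3
  = mkR3 (2 * (x1 * y1 + x2 * y2)) (2 * (y1 * y2 - x1 * x2))
         (x1 * x1 - x2 * x2 - y1 * y1 + y2 * y2)).
{ apply R3_ext; unfold frame_vec, su2_coords, su2_inner, e1, e2, e3; m2_unfold;
   unfold Re; simpl; field. }
rewrite V1, V2, V3; clear V1 V2 V3.
assert (N2 : n * n = 1) by (rewrite N; ring).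
split; unfold dot; cbn [cx cy cz]; try (rewrite <- N2; unfold n; ring); try ring;
  apply R3_ext; unfold cross; cbn [cx cy cz];
  match goal with |- _ = ?v => transitivity (n * v); [unfold n; ring | rewrite N; ring] end.
Qed.

(** The derivative of [F e F^-1] is [F [M, e] F^-1]. *)
Lemma frame_vec_vder (F : R -> M2) (M e : M2) (x y z : R) (t : R) :
  mtrace M = 0%C -> mder F t (F t ** M) -> M ** e +++ mneg (e ** M) = su2_mat x y z ->
  is_vder (fun t => frame_vec (F t) e) t
    (vcomb (frame_vec (F t) e1) (frame_vec (F t) e2) (frame_vec (F t) e3) x y z).
Proof.
intros hM hF hV; rewrite <- frame_vec_comb, <- hV.
assert (z1 : forall B, B ** mkM2 0 0 0 0 = mkM2 0 0 0 0) by (intros; m2_ring).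
assert (z3 : forall B, B +++ mkM2 0 0 0 0 = B) by (intros; m2_ring).
apply (su2_coords_vder (fun t => F t ** e ** mcof (F t))).
eapply mder_eq; [|exact (mder_mul (mder_mul hF (mder_const e t))
  (mder_cof hF))].
rewrite mcof_mmul, (mcof_traceless M), z1, z3 by easy; unfold mneg; m2_expand.
Qed.

(** In the derivative of [Y F^-1] the two terms containing [Y] cancel and [F M' F^-1] remains. The
    tangent vectors thus have coordinates in the frame that depend on [M] and [M'] only. *)
Lemma sym_matrix_mder (H : R) (l : C) (F Y : R -> M2) (M M' : M2) (t : R) :
  (forall t, mdet (F t) = 1%C) -> mtrace M = 0%C ->
  mder F t (F t ** M) -> mder Y t (Y t ** M +++ F t ** M') ->
  mder (fun t => sym_matrix H l (F t) (Y t)) t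
    (F t ** mscal (RtoC (- (1 / H))) (mscal (Ci * l)%C M' +++
       mscal (Ci / 2)%C (M ** Defs.sigma +++ mneg (Defs.sigma ** M))) ** mcof (F t)).
Proof.
intros dF hM hF hY.
assert (z1 : forall B, B ** mkM2 0 0 0 0 = mkM2 0 0 0 0) by (intros; m2_ring).
assert (z3 : forall B, B +++ mkM2 0 0 0 0 = B) by (intros; m2_ring).
eapply mder_eq; [|exact (mder_scal (RtoC (- (1 / H))) _ _ _ (mder_add
  (mder_scal (Ci * l)%C _ _ _ (mder_mul hY (mder_cof hF)))
  (mder_scal (Ci / 2)%C _ _ _ (mder_mul
     (mder_mul hF (mder_const Defs.sigma t)) (mder_cof hF)))))].
rewrite mcof_mmul, (mcof_traceless M), z1, z3 by easy; unfold mneg; m2_expand.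
Qed.

(** On the unit circle [l] can be absorbed into [a / l] and [b / l], so the member of the family
    with parameter [l] obeys the frame equations of [l = 1] with these two numbers. *)
Lemma lax_normal_form (a b : C) (th q : R -> R) (l : C) (s : R) :
  Cmod l = 1 ->
  let x := (a / l * RtoC (exp (th s)))%C in let y := (b / l * RtoC (exp (- th s)))%C in
  lax_a a b th l s = offdiag (x - Cconj y)%C (y - Cconj x)%C
  /\ lax_L a b th q l s = mkM2 (RtoC (q s)) (x + Cconj y)%C (y + Cconj x)%C (RtoC (- q s))
  /\ mscal l (lax_a' a b th l s) = offdiag (- (x + Cconj y))%C (- (y + Cconj x))%C
  /\ mscal l (lax_L' a b th l s) = offdiag (Cconj y - x)%C (Cconj x - y)%C.
Proof.
intros hl x y.
assert (l0 : l <> 0%C) by (apply Cmod_gt_0; lra).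
pose proof (Cinv_conj_unit l hl) as h.
assert (hl' : Cconj (/ l) = l) by (rewrite <- h; apply Cconj_conj).
assert (ex : Cconj x = (l * Cconj (fu a th s))%C).
{ unfold x, fu, Cdiv; rewrite !Cmult_conj, hl'; ring. }
assert (ey : Cconj y = (l * Cconj (fw b th s))%C).
{ unfold y, fw, Cdiv; rewrite !Cmult_conj, hl'; ring. }
rewrite ex, ey; unfold lax_a, lax_L, lax_a', lax_L', pencil, lax_P, lax_Q, lax_T, mneg, offdiag.
replace x with (/ l * fu a th s)%C by (unfold x, fu, Cdiv; ring).
replace y with (/ l * fw b th s)%C by (unfold y, fw, Cdiv; ring).
refine (conj _ (conj _ (conj _ _))); apply M2_ext; m2_unfold; try ring; field; auto.
Qed.

Lemma generated_moving_frame (H r : R) (a b : C) (c : R) (th q : R -> R) (f : C -> C -> R3) :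
  H <> 0 -> 0 < r <= 1 -> profile_ode (Cmod a) (Cmod b) c th q ->
  dpw_generates H r (pullback_exp (delaunay_potential a b c)) (fun _ => mid) 0%C f ->
  forall l, Cmod l = 1 -> exists E1 E2 E3,
    moving_frame H (Re (a / l)%C) (Im (a / l)%C) (Re (b / l)%C) (Im (b / l)%C) th q
      (on_coords (f l)) E1 E2 E3.
Proof.
intros hH hr h hgen l hl.
destruct (generated_frame_pair H r a b c th q f hr h hgen l hl) as (F & Y & fp & hf).
exists (fun s t => frame_vec (F s t) e1), (fun s t => frame_vec (F s t) e2),
  (fun s t => frame_vec (F s t) e3).
assert (dF : forall s t, mdet (F s t) = 1%C) by (intros s t; apply (fp_SU2 fp)).
assert (tA : forall s, mtrace (lax_a a b th l s) = 0%C) by (intros; apply (lax_traces a b th q)).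
assert (tL : forall s, mtrace (mscal Ci (lax_L a b th q l s)) = 0%C).
{ intros s; rewrite mtrace_scal, (proj2 (proj2 (lax_traces a b th q l s))); ring. }
assert (nf := fun s => lax_normal_form a b th q l s hl); cbv zeta in nf.
destruct (a / l)%C as [a1 a2]; destruct (b / l)%C as [b1 b2]; simpl Re; simpl Im.
set (x := fun s => ((a1, a2) * RtoC (exp (th s)))%C).
set (y := fun s => ((b1, b2) * RtoC (exp (- th s)))%C).
set (la := fun s => offdiag (x s - Cconj (y s))%C (y s - Cconj (x s))%C).
set (la' := fun s => offdiag (- (x s + Cconj (y s)))%C (- (y s + Cconj (x s)))%C).
set (ll := fun s => mscal Ci (mkM2 (RtoC (q s)) (x s + Cconj (y s))%C (y s + Cconj (x s))%C
  (RtoC (- q s)))).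
set (ll' := fun s => mscal Ci (offdiag (Cconj (y s) - x s)%C (Cconj (x s) - y s)%C)).
assert (n1 : forall s, lax_a a b th l s = la s) by (intros s; apply nf).
assert (n2 : forall s, mscal Ci (lax_L a b th q l s) = ll s).
{ intros s; unfold ll; f_equal; apply nf. }
assert (n3 : forall s, mscal (Ci * l)%C (lax_a' a b th l s) = mscal Ci (la' s)).
{ intros s; unfold la'.
  transitivity (mscal Ci (mscal l (lax_a' a b th l s))); [m2_ring | f_equal; apply nf]. }
assert (n4 : forall s, mscal (Ci * l)%C (mscal Ci (lax_L' a b th l s)) = mscal Ci (ll' s)).
{ intros s; unfold ll'.
  transitivity (mscal Ci (mscal Ci (mscal l (lax_L' a b th l s)))); [m2_ring|].
  do 2 f_equal; apply nf. }
assert (vder_f : forall (p : R -> R * R) t V,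
  is_vder (fun t => su2_coords (sym_matrix H l (F (fst (p t)) (snd (p t)))
    (Y (fst (p t)) (snd (p t))))) t V ->
  is_vder (fun t => on_coords (f l) (fst (p t)) (snd (p t))) t V).
{ intros p t V (d1 & d2 & d3); unfold on_coords; refine (conj _ (conj _ _)).
  - eapply is_derive_ext; [|exact d1]; intros; now rewrite hf.
  - eapply is_derive_ext; [|exact d2]; intros; now rewrite hf.
  - eapply is_derive_ext; [|exact d3]; intros; now rewrite hf. }
assert (E_s : forall s t e k1 k2 k3, la s ** e +++ mneg (e ** la s) = su2_mat k1 k2 k3 ->
  is_vder (fun s => frame_vec (F s t) e) s (vcomb (frame_vec (F s t) e1) (frame_vec (F s t) e2)
    (frame_vec (F s t) e3) k1 k2 k3)).
{ intros s t e k1 k2 k3 he; apply (frame_vec_vder (fun s => F s t) (lax_a a b th l s)); auto.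
  - apply (fp_F_s fp).
  - now rewrite n1. }
assert (E_t : forall s t e k1 k2 k3, ll s ** e +++ mneg (e ** ll s) = su2_mat k1 k2 k3 ->
  is_vder (fun t => frame_vec (F s t) e) t (vcomb (frame_vec (F s t) e1) (frame_vec (F s t) e2)
    (frame_vec (F s t) e3) k1 k2 k3)).
{ intros s t e k1 k2 k3 he; apply (frame_vec_vder (fun t => F s t)
    (mscal Ci (lax_L a b th q l s))); auto.
  - apply (fp_F_t fp).
  - now rewrite n2. }
split.
1: intros s t; apply frame_vec_orthoframe, (fp_SU2 fp).
(* With the first goal closed, the two leading goals are the equations of [X], and the others those
   of the frame vectors in [s] and in [t]. *)
3-5: intros s t; apply E_s; unfold la.
6-8: intros s t; apply E_t; unfold ll.
1: { intros s t; apply (vder_f (fun s => (s, t))); simpl.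
     rewrite <- frame_vec_comb.
     pose proof (su2_coords_vder _ _ _ (sym_matrix_mder H l (fun s => F s t) (fun s => Y s t) _ _ s
       (fun s => dF s t) (tA s) (fp_F_s fp s t) (fp_Y_s fp s t))) as hd.
     rewrite n1, n3 in hd; eapply is_vder_eq; [|exact hd]; do 3 f_equal.
     unfold la, la'. unfold x, y; generalize (exp (th s)) (exp (- th s)); intros P M.
     unfold su2_mat, offdiag, mneg, e1, e2, e3; apply M2_ext; m2_unfold;
       apply C_ext; simpl; field; auto. }
1: { intros s t; apply (vder_f (fun t => (s, t))); simpl.
     rewrite <- frame_vec_comb.
     pose proof (su2_coords_vder _ _ _ (sym_matrix_mder H l (fun t => F s t) (fun t => Y s t) _ _ t
       (fun t => dF s t) (tL s) (fp_F_t fp s t) (fp_Y_t fp s t))) as hd.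
     rewrite n2, n4 in hd; eapply is_vder_eq; [|exact hd]; do 3 f_equal.
     unfold ll, ll'. unfold x, y; generalize (exp (th s)) (exp (- th s)); intros P M.
     unfold su2_mat, offdiag, mneg, e1, e2, e3; apply M2_ext; m2_unfold;
       apply C_ext; simpl; field; auto. }
all: unfold x, y; generalize (exp (th s)) (exp (- th s)); intros P M;
  unfold su2_mat, offdiag, mneg, e1, e2, e3; apply M2_ext; m2_unfold; apply C_ext; simpl; ring.
Qed.

(** * Smoothness of the surface *)

Inductive poly_closure (S : (R -> R -> R) -> Prop) : (R -> R -> R) -> Prop :=
| pc_gen f : S f -> poly_closure S f
| pc_const k : poly_closure S (fun _ _ => k)
| pc_plus f g : poly_closure S f -> poly_closure S g -> poly_closure S (fun s t => f s t + g s t)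
| pc_mult f g : poly_closure S f -> poly_closure S g -> poly_closure S (fun s t => f s t * g s t)
| pc_ext f g : (forall s t, f s t = g s t) -> poly_closure S f -> poly_closure S g.

Definition has_partials (f fs ft : R -> R -> R) : Prop :=
  forall s t, is_derive (fun s => f s t) s (fs s t) /\ is_derive (fun t => f s t) t (ft s t).

Lemma ex_diff_n_ext (f g : R -> R -> R) (n : nat) :
  (forall s t, f s t = g s t) -> forall s t, ex_diff_n f n s t -> ex_diff_n g n s t.
Proof.
intros h s t; apply ex_diff_n_ext_loc.
exists (mkposreal 1 Rlt_0_1); auto.
Qed.

(** Sums and products of generators form an algebra that the partial derivatives map to itself, so
    the order of differentiability can be raised by induction without ever computing a higher
    derivative. *)
Lemma poly_closure_smooth (S : (R -> R -> R) -> Prop) :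
  (forall f, S f -> forall s t, continuity_2d_pt f s t) ->
  (forall f, S f -> exists fs ft, has_partials f fs ft /\ poly_closure S fs /\ poly_closure S ft) ->
  forall f, poly_closure S f -> forall n s t, ex_diff_n f n s t.
Proof.
intros cS dS.
assert (cont : forall f, poly_closure S f -> forall s t, continuity_2d_pt f s t).
{ intros f hf; induction hf as [f hf | k | f g _ IHf _ IHg | f g _ IHf _ IHg | f g h _ IHf];
    intros s t.
  - now apply cS.
  - apply continuity_2d_pt_const.
  - now apply continuity_2d_pt_plus.
  - now apply continuity_2d_pt_mult.
  - now apply (continuity_2d_pt_ext f). }
assert (der : forall f, poly_closure S f ->
   exists fs ft, has_partials f fs ft /\ poly_closure S fs /\ poly_closure S ft).
{ intros f hf; induction hf as [f hf | k | f g hf IHf hg IHg | f g hf IHf hg IHg | f g h hf IHf].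
  - now apply dS.
  - exists (fun _ _ => 0), (fun _ _ => 0); split; [|split; apply pc_const].
    intros s t; split; apply (is_derive_const (V := R_NormedModule)).
  - destruct IHf as (fs & ft & h1 & h2 & h3); destruct IHg as (gs & gt & h4 & h5 & h6).
    exists (fun s t => fs s t + gs s t), (fun s t => ft s t + gt s t).
    split; [|split; now apply pc_plus].
    intros s t; destruct (h1 s t) as [u1 u2]; destruct (h4 s t) as [u3 u4]; split.
    + exact (is_derive_plus _ _ _ _ _ u1 u3).
    + exact (is_derive_plus _ _ _ _ _ u2 u4).
  - destruct IHf as (fs & ft & h1 & h2 & h3); destruct IHg as (gs & gt & h4 & h5 & h6).
    exists (fun s t => fs s t * g s t + f s t * gs s t),
      (fun s t => ft s t * g s t + f s t * gt s t).
    split; [|split; apply pc_plus; now apply pc_mult].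
    intros s t; destruct (h1 s t) as [u1 u2]; destruct (h4 s t) as [u3 u4]; split.
    + exact (is_derive_mult (fun s => f s t) (fun s => g s t) s _ _ u1 u3 Rmult_comm).
    + exact (is_derive_mult (fun t => f s t) (fun t => g s t) t _ _ u2 u4 Rmult_comm).
  - destruct IHf as (fs & ft & h1 & h2 & h3); exists fs, ft; split; [|easy].
    intros s t; destruct (h1 s t) as [u1 u2]; split.
    + apply (is_derive_ext (fun s => f s t)); auto.
    + apply (is_derive_ext (fun t => f s t)); auto. }
intros f hf n; revert f hf; induction n as [|n IH]; intros f hf s t.
- split; [now apply cont | exact I].
- destruct (der f hf) as (fs & ft & h1 & h2 & h3).
  split; [now apply cont|]; split; [|split; [|split]].
  + exact (ex_intro _ _ (proj1 (h1 s t))).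
  + exact (ex_intro _ _ (proj2 (h1 s t))).
  + apply (ex_diff_n_ext fs); [|now apply IH].
    intros u v; symmetry; apply is_derive_unique, h1.
  + apply (ex_diff_n_ext ft); [|now apply IH].
    intros u v; symmetry; apply is_derive_unique, h1.
Qed.

(** The displacement in [s] is controlled by the mean value theorem with a bound uniform in [t]; the
    displacement in [t] is left to one-variable continuity. *)
Lemma continuity_2d_of_bounded_partial (f fs : R -> R -> R) (K : R -> R) (s t : R) :
  (forall s t, is_derive (fun s => f s t) s (fs s t)) ->
  (forall s t, Rabs (fs s t) <= K s) -> continuous K s ->
  continuous (fun t => f s t) t -> continuity_2d_pt f s t.
Proof.
intros hf hK cK cf eps.
apply continuity_pt_filterlim in cK; apply continuity_pt_filterlim in cf.
destruct (cK 1 Rlt_0_1) as [d1 [hd1 H1]].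
destruct (cf (eps / 2)) as [d2 [hd2 H2]]; [pose proof (cond_pos eps); lra|].
assert (hK0 : 0 <= K s) by (pose proof (hK s t); pose proof (Rabs_pos (fs s t)); lra).
set (d3 := eps / (2 * (K s + 1))).
assert (hd3 : 0 < d3) by (apply Rdiv_lt_0_compat; [apply cond_pos | lra]).
assert (hd : 0 < Rmin d3 (Rmin d1 d2)) by (repeat apply Rmin_pos; lra).
exists (mkposreal _ hd); intros u v hu hv; simpl in hu, hv.
pose proof (Rmin_l d3 (Rmin d1 d2)); pose proof (Rmin_r d3 (Rmin d1 d2)).
pose proof (Rmin_l d1 d2); pose proof (Rmin_r d1 d2).
assert (h1 : Rabs (f u v - f s v) <= (K s + 1) * Rabs (u - s)).
{ destruct (MVT_gen (fun s => f s v) s u (fun s => fs s v)) as [c [hc E]].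
  - intros x _; apply hf.
  - intros x _; apply continuity_pt_filterlim, (ex_derive_continuous (fun s => f s v)).
    eexists; apply hf.
  - rewrite E, Rabs_mult; apply Rmult_le_compat_r; [apply Rabs_pos|].
    eapply Rle_trans; [apply hK|].
    destruct (Req_dec c s) as [-> | hcs]; [lra|].
    assert (hcd : Rabs (c - s) < d1).
    { destruct (Rle_lt_dec s u) as [hsu | hsu].
      - rewrite Rmin_left, Rmax_right in hc by lra.
        rewrite Rabs_pos_eq by lra; rewrite Rabs_pos_eq in hu by lra; lra.
      - rewrite Rmin_right, Rmax_left in hc by lra.
        rewrite Rabs_left1 by lra; rewrite Rabs_left1 in hu by lra; lra. }
    specialize (H1 c); simpl in H1; unfold R_dist, D_x, no_cond in H1.
    specialize (H1 (conj (conj I (fun e => hcs (eq_sym e))) hcd)).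
    apply Rabs_lt_between in H1; lra. }
assert (h2 : Rabs (f s v - f s t) < eps / 2).
{ destruct (Req_dec v t) as [-> | hvt].
  - rewrite Rminus_diag, Rabs_R0; pose proof (cond_pos eps); lra.
  - specialize (H2 v); simpl in H2; unfold R_dist, D_x, no_cond in H2.
    apply H2; split; [split; [exact I | auto] | lra]. }
assert (h3 : (K s + 1) * Rabs (u - s) <= (K s + 1) * d3) by (apply Rmult_le_compat_l; lra).
replace ((K s + 1) * d3) with (eps / 2) in h3 by (unfold d3; field; lra).
pose proof (Rabs_triang (f u v - f s v) (f s v - f s t)) as h4.
replace (f u v - f s v + (f s v - f s t)) with (f u v - f s t) in h4 by ring.
lra.
Qed.

Definition frame_coef (th q : R -> R) (x : R -> R) : Prop :=
  exists k1 k2 k3, forall s, x s = k1 * exp (th s) + k2 * exp (- th s) + k3 * q s.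

Definition is_coord (pr : R3 -> R) : Prop := pr = cx \/ pr = cy \/ pr = cz.

Inductive frame_gen (th q : R -> R) (X E1 E2 E3 : R -> R -> R3) : (R -> R -> R) -> Prop :=
| fg_exp : frame_gen th q X E1 E2 E3 (fun s _ => exp (th s))
| fg_expm : frame_gen th q X E1 E2 E3 (fun s _ => exp (- th s))
| fg_q : frame_gen th q X E1 E2 E3 (fun s _ => q s)
| fg_vec (pr : R3 -> R) (V : R -> R -> R3) :
   is_coord pr -> V = X \/ V = E1 \/ V = E2 \/ V = E3 ->
   frame_gen th q X E1 E2 E3 (fun s t => pr (V s t)).

Lemma is_vder_coord (pr : R3 -> R) (p : R -> R3) (t : R) (v : R3) :
  is_coord pr -> is_vder p t v -> is_derive (fun t => pr (p t)) t (pr v).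
Proof. intros [-> | [-> | ->]] (h1 & h2 & h3); auto. Qed.

Lemma coord_vcomb (pr : R3 -> R) (E1 E2 E3 : R3) (x y z : R) :
  is_coord pr -> pr (vcomb E1 E2 E3 x y z) = x * pr E1 + y * pr E2 + z * pr E3.
Proof. intros [-> | [-> | ->]]; reflexivity. Qed.

Lemma coord_le_1 (pr : R3 -> R) (V : R3) : is_coord pr -> dot V V = 1 -> Rabs (pr V) <= 1.
Proof.
intros [-> | [-> | ->]] h; unfold dot in h; apply Rabs_le;
  pose proof (pow2_ge_0 (cx V)); pose proof (pow2_ge_0 (cy V)); pose proof (pow2_ge_0 (cz V)); nra.
Qed.

(** A common shape for the eight differential equations, so that the surface and the three frame
    vectors are treated by one argument. *)
Lemma moving_frame_vec (H a1 a2 b1 b2 : R) (th q : R -> R) (X E1 E2 E3 V : R -> R -> R3) :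
  moving_frame H a1 a2 b1 b2 th q X E1 E2 E3 -> V = X \/ V = E1 \/ V = E2 \/ V = E3 ->
  exists x y z x' y' z',
    frame_coef th q x /\ frame_coef th q y /\ frame_coef th q z
    /\ frame_coef th q x' /\ frame_coef th q y' /\ frame_coef th q z'
    /\ (forall s t, is_vder (fun s => V s t) s (vcomb (E1 s t) (E2 s t) (E3 s t) (x s) (y s) (z s)))
    /\ forall s t, is_vder (fun t => V s t) t
         (vcomb (E1 s t) (E2 s t) (E3 s t) (x' s) (y' s) (z' s)).
Proof.
intros mf [-> | [-> | [-> | ->]]].
- exists (fun _ => 0), (fun s => - (2 / H) * (a2 * exp (th s))), (fun s => 2 / H * (a1 * exp (th s))),
   (fun _ => 0), (fun s => - (2 / H) * (a1 * exp (th s))), (fun s => - (2 / H) * (a2 * exp (th s))).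
  refine (conj _ (conj _ (conj _ (conj _ (conj _ (conj _ (conj _ _))))))).
  + exists 0, 0, 0; intros; ring.
  + exists (- (2 / H) * a2), 0, 0; intros; ring.
  + exists (2 / H * a1), 0, 0; intros; ring.
  + exists 0, 0, 0; intros; ring.
  + exists (- (2 / H) * a1), 0, 0; intros; ring.
  + exists (- (2 / H) * a2), 0, 0; intros; ring.
  + apply mf.
  + apply mf.
- exists (fun _ => 0), (fun s => 2 * (a2 * exp (th s) + b2 * exp (- th s))),
    (fun s => - (2) * (a1 * exp (th s) - b1 * exp (- th s))),
   (fun _ => 0), (fun s => 2 * (a1 * exp (th s) + b1 * exp (- th s))),
    (fun s => 2 * (a2 * exp (th s) - b2 * exp (- th s))).
  refine (conj _ (conj _ (conj _ (conj _ (conj _ (conj _ (conj _ _))))))).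
  + exists 0, 0, 0; intros; ring.
  + exists (2 * a2), (2 * b2), 0; intros; ring.
  + exists (-2 * a1), (2 * b1), 0; intros; ring.
  + exists 0, 0, 0; intros; ring.
  + exists (2 * a1), (2 * b1), 0; intros; ring.
  + exists (2 * a2), (-2 * b2), 0; intros; ring.
  + apply mf.
  + apply mf.
- exists (fun s => - (2) * (a2 * exp (th s) + b2 * exp (- th s))), (fun _ => 0), (fun _ => 0),
   (fun s => - (2) * (a1 * exp (th s) + b1 * exp (- th s))), (fun _ => 0), (fun s => 2 * q s).
  refine (conj _ (conj _ (conj _ (conj _ (conj _ (conj _ (conj _ _))))))).
  + exists (-2 * a2), (-2 * b2), 0; intros; ring.
  + exists 0, 0, 0; intros; ring.
  + exists 0, 0, 0; intros; ring.
  + exists (-2 * a1), (-2 * b1), 0; intros; ring.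
  + exists 0, 0, 0; intros; ring.
  + exists 0, 0, 2; intros; ring.
  + apply mf.
  + apply mf.
- exists (fun s => 2 * (a1 * exp (th s) - b1 * exp (- th s))), (fun _ => 0), (fun _ => 0),
   (fun s => - (2) * (a2 * exp (th s) - b2 * exp (- th s))), (fun s => - (2) * q s), (fun _ => 0).
  refine (conj _ (conj _ (conj _ (conj _ (conj _ (conj _ (conj _ _))))))).
  + exists (2 * a1), (-2 * b1), 0; intros; ring.
  + exists 0, 0, 0; intros; ring.
  + exists 0, 0, 0; intros; ring.
  + exists (-2 * a2), (2 * b2), 0; intros; ring.
  + exists 0, 0, (-2); intros; ring.
  + exists 0, 0, 0; intros; ring.
  + apply mf.
  + apply mf.
Qed.
Arguments moving_frame_vec {_ _ _ _ _ _ _ _ _ _ _}.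

(** The frame vectors have length 1, so every partial derivative in [s] is bounded by the sum of the
    moduli of its coefficients, which depends on [s] only. This gives joint continuity of the
    generators. *)
Lemma moving_frame_smooth (H a1 a2 b1 b2 A B c : R) (th q : R -> R) (X E1 E2 E3 : R -> R -> R3) :
  profile_ode A B c th q -> moving_frame H a1 a2 b1 b2 th q X E1 E2 E3 ->
  forall f, poly_closure (frame_gen th q X E1 E2 E3) f -> forall n s t, ex_diff_n f n s t.
Proof.
intros (t0 & q0 & dt & dq) mf.
set (S := frame_gen th q X E1 E2 E3).
assert (dP : forall s, is_derive (fun s => exp (th s)) s (2 * q s * exp (th s))).
{ intros s; auto_derive; [exact (ex_intro _ _ (dt s))|]; rewrite_Derive (dt s); ring. }
assert (dM : forall s, is_derive (fun s => exp (- th s)) s (-2 * q s * exp (- th s))).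
{ intros s; auto_derive; [exact (ex_intro _ _ (dt s))|]; rewrite_Derive (dt s); ring. }
assert (pP : poly_closure S (fun s _ => exp (th s))) by (apply pc_gen, fg_exp).
assert (pM : poly_closure S (fun s _ => exp (- th s))) by (apply pc_gen, fg_expm).
assert (pq : poly_closure S (fun s _ => q s)) by (apply pc_gen, fg_q).
assert (c1 : forall (g g' : R -> R), (forall s, is_derive g s (g' s)) -> forall s t : R,
  continuity_2d_pt (fun s _ => g s) s t).
{ intros g g' hg s t; apply (continuity_1d_2d_pt_comp g (fun s _ => s)).
  - apply continuity_pt_filterlim, (ex_derive_continuous g); eexists; apply hg.
  - apply continuity_2d_pt_id1. }
assert (z0 : forall (g : R) t, is_derive (fun _ : R => g) t 0)
  by (intros; apply (is_derive_const (V := R_NormedModule))).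
assert (pcoef : forall x, frame_coef th q x -> poly_closure S (fun s _ => x s)).
{ intros x (k1 & k2 & k3 & hx).
  apply (pc_ext _ (fun s _ => k1 * exp (th s) + k2 * exp (- th s) + k3 * q s)); [auto|].
  apply (pc_plus _ (fun s _ => k1 * exp (th s) + k2 * exp (- th s)) (fun s _ => k3 * q s)).
  - apply (pc_plus _ (fun s _ => k1 * exp (th s)) (fun s _ => k2 * exp (- th s))).
    + apply (pc_mult _ (fun _ _ => k1)); [apply pc_const | exact pP].
    + apply (pc_mult _ (fun _ _ => k2)); [apply pc_const | exact pM].
  - apply (pc_mult _ (fun _ _ => k3)); [apply pc_const | exact pq]. }
assert (ccoef : forall x, frame_coef th q x -> forall s, continuous (fun s => Rabs (x s)) s).
{ intros x (k1 & k2 & k3 & hx) s.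
  apply (continuous_comp x Rabs); [|apply continuous_Rabs].
  apply (continuous_ext (fun s => k1 * exp (th s) + k2 * exp (- th s) + k3 * q s)); [auto|].
  apply (ex_derive_continuous (fun s => k1 * exp (th s) + k2 * exp (- th s) + k3 * q s)).
  auto_derive.
  exact (conj (ex_intro _ _ (dt s)) (conj (ex_intro _ _ (dt s)) (conj (ex_intro _ _ (dq s)) I))). }
assert (pcomb : forall pr x y z, is_coord pr -> frame_coef th q x -> frame_coef th q y ->
  frame_coef th q z ->
  poly_closure S (fun s t => pr (vcomb (E1 s t) (E2 s t) (E3 s t) (x s) (y s) (z s)))).
{ intros pr x y z hpr hx hy hz.
  apply (pc_ext _ (fun s t => x s * pr (E1 s t) + y s * pr (E2 s t) + z s * pr (E3 s t))).
  - intros s t; now rewrite coord_vcomb.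
  - apply (pc_plus _ (fun s t => x s * pr (E1 s t) + y s * pr (E2 s t))
      (fun s t => z s * pr (E3 s t))).
    + apply (pc_plus _ (fun s t => x s * pr (E1 s t)) (fun s t => y s * pr (E2 s t))).
      * apply (pc_mult _ (fun s _ => x s)); [now apply pcoef | apply pc_gen, fg_vec; auto].
      * apply (pc_mult _ (fun s _ => y s)); [now apply pcoef | apply pc_gen, fg_vec; auto].
    + apply (pc_mult _ (fun s _ => z s)); [now apply pcoef | apply pc_gen, fg_vec; auto]. }
apply poly_closure_smooth.
- intros f [ | | | pr V hpr hV] s t.
  + exact (c1 _ _ dP s t).
  + exact (c1 _ _ dM s t).
  + exact (c1 _ _ dq s t).
  + destruct (moving_frame_vec V mf hV)
      as (x & y & z & x' & y' & z' & hx & hy & hz & _ & _ & _ & h1 & h2).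
    apply (continuity_2d_of_bounded_partial _
      (fun s t => pr (vcomb (E1 s t) (E2 s t) (E3 s t) (x s) (y s) (z s)))
      (fun s => Rabs (x s) + Rabs (y s) + Rabs (z s))).
    * intros u v; exact (is_vder_coord pr _ _ _ hpr (h1 u v)).
    * intros u v; rewrite coord_vcomb by easy.
      destruct (mf_ortho mf u v) as [o1 o2 o3 _ _ _ _ _ _].
      eapply Rle_trans; [apply Rabs_triang|].
      apply Rplus_le_compat; [eapply Rle_trans; [apply Rabs_triang|]; apply Rplus_le_compat|];
        rewrite Rabs_mult;
        match goal with |- ?l * Rabs (pr ?W) <= _ =>
          pose proof (Rabs_pos (pr W)); assert (Rabs (pr W) <= 1) by now apply coord_le_1 end;
        match goal with |- Rabs ?w * _ <= _ => pose proof (Rabs_pos w); nra end.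
    * apply (continuous_plus (fun s => Rabs (x s) + Rabs (y s)) (fun s => Rabs (z s)));
        [apply (continuous_plus (fun s => Rabs (x s)) (fun s => Rabs (y s)))|]; now apply ccoef.
    * apply (ex_derive_continuous (fun t => pr (V s t))).
      eexists; exact (is_vder_coord pr _ _ _ hpr (h2 s t)).
- intros f [ | | | pr V hpr hV].
  + exists (fun s _ => 2 * q s * exp (th s)), (fun _ _ => 0); split; [|split].
    * intros s t; split; [apply dP | apply z0].
    * apply (pc_mult _ (fun s _ => 2 * q s)); [|exact pP].
      apply (pc_mult _ (fun _ _ => 2)); [apply pc_const | exact pq].
    * apply pc_const.
  + exists (fun s _ => -2 * q s * exp (- th s)), (fun _ _ => 0); split; [|split].
    * intros s t; split; [apply dM | apply z0].
    * apply (pc_mult _ (fun s _ => -2 * q s)); [|exact pM].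
      apply (pc_mult _ (fun _ _ => -2)); [apply pc_const | exact pq].
    * apply pc_const.
  + exists (fun s _ => -2 * ((A * exp (th s)) ^ 2 - (B * exp (- th s)) ^ 2)), (fun _ _ => 0);
      split; [|split].
    * intros s t; split; [apply dq | apply z0].
    * apply (pc_ext _ (fun s _ => -2 * A ^ 2 * (exp (th s) * exp (th s))
         + 2 * B ^ 2 * (exp (- th s) * exp (- th s)))); [intros; ring|].
      apply (pc_plus _ (fun s _ => -2 * A ^ 2 * (exp (th s) * exp (th s)))
         (fun s _ => 2 * B ^ 2 * (exp (- th s) * exp (- th s)))).
      -- apply (pc_mult _ (fun _ _ => -2 * A ^ 2)); [apply pc_const|].
         apply (pc_mult _ (fun s _ => exp (th s))); exact pP.
      -- apply (pc_mult _ (fun _ _ => 2 * B ^ 2)); [apply pc_const|].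
         apply (pc_mult _ (fun s _ => exp (- th s))); exact pM.
    * apply pc_const.
  + destruct (moving_frame_vec V mf hV)
      as (x & y & z & x' & y' & z' & hx & hy & hz & hx' & hy' & hz' & h1 & h2).
    exists (fun s t => pr (vcomb (E1 s t) (E2 s t) (E3 s t) (x s) (y s) (z s))),
      (fun s t => pr (vcomb (E1 s t) (E2 s t) (E3 s t) (x' s) (y' s) (z' s))).
    split; [|split; now apply pcomb].
    intros s t; split.
    * exact (is_vder_coord pr _ _ _ hpr (h1 s t)).
    * exact (is_vder_coord pr _ _ _ hpr (h2 s t)).
Qed.
Arguments moving_frame_smooth {_ _ _ _ _ _ _ _ _ _ _ _ _ _}.

(** * Vector calculus, fundamental forms and the Hopf differential *)

Lemma is_vder_vDerive (p : R -> R3) (t : R) (v : R3) : is_vder p t v -> vDerive p t = v.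
Proof.
intros (h1 & h2 & h3); unfold vDerive; apply R3_ext; cbn [cx cy cz]; now apply is_derive_unique.
Qed.

Lemma is_vder_ext (p p' : R -> R3) (t : R) (v : R3) :
  (forall t, p t = p' t) -> is_vder p t v -> is_vder p' t v.
Proof.
intros h (h1 & h2 & h3); refine (conj _ (conj _ _)).
- apply (is_derive_ext (fun t => cx (p t))); [intros; now rewrite h | exact h1].
- apply (is_derive_ext (fun t => cy (p t))); [intros; now rewrite h | exact h2].
- apply (is_derive_ext (fun t => cz (p t))); [intros; now rewrite h | exact h3].
Qed.

Lemma is_vder_vadd (p p' : R -> R3) (t : R) (v v' : R3) :
  is_vder p t v -> is_vder p' t v' -> is_vder (fun t => vadd (p t) (p' t)) t (vadd v v').
Proof.
intros (h1 & h2 & h3) (k1 & k2 & k3).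
exact (conj (is_derive_plus _ _ _ _ _ h1 k1) (conj (is_derive_plus _ _ _ _ _ h2 k2)
  (is_derive_plus _ _ _ _ _ h3 k3))).
Qed.
Arguments is_vder_vadd {_ _ _ _ _}.

Lemma is_vder_vscal (x : R -> R) (p : R -> R3) (t x' : R) (v : R3) :
  is_derive x t x' -> is_vder p t v ->
  is_vder (fun t => vscal (x t) (p t)) t (vadd (vscal x' (p t)) (vscal (x t) v)).
Proof.
intros hx (h1 & h2 & h3).
exact (conj (is_derive_mult x _ t _ _ hx h1 Rmult_comm)
  (conj (is_derive_mult x _ t _ _ hx h2 Rmult_comm)
    (is_derive_mult x _ t _ _ hx h3 Rmult_comm))).
Qed.

Lemma is_vder_const (v : R3) (t : R) : is_vder (fun _ => v) t (mkR3 0 0 0).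
Proof.
exact (conj (is_derive_const (V := R_NormedModule) (cx v) t)
  (conj (is_derive_const (V := R_NormedModule) (cy v) t)
    (is_derive_const (V := R_NormedModule) (cz v) t))).
Qed.

Lemma is_vder_zero_const (p : R -> R3) :
  (forall t, is_vder p t (mkR3 0 0 0)) -> forall s t, p s = p t.
Proof.
intros h s t; apply R3_ext.
- apply (is_derive_zero_const (fun t => cx (p t))); intros x; exact (proj1 (h x)).
- apply (is_derive_zero_const (fun t => cy (p t))); intros x; exact (proj1 (proj2 (h x))).
- apply (is_derive_zero_const (fun t => cz (p t))); intros x; exact (proj2 (proj2 (h x))).
Qed.

Lemma is_vder_vcomb (E1 E2 E3 : R -> R3) (x y z : R -> R) (t : R) (E1' E2' E3' : R3)
    (x' y' z' : R) :
  is_vder E1 t E1' -> is_vder E2 t E2' -> is_vder E3 t E3' ->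
  is_derive x t x' -> is_derive y t y' -> is_derive z t z' ->
  is_vder (fun t => vcomb (E1 t) (E2 t) (E3 t) (x t) (y t) (z t)) t
    (vadd (vcomb (E1 t) (E2 t) (E3 t) x' y' z') (vcomb E1' E2' E3' (x t) (y t) (z t))).
Proof.
intros h1 h2 h3 hx hy hz.
eapply is_vder_eq; [|exact (is_vder_vadd (is_vder_vadd
  (is_vder_vscal _ _ _ _ _ hx h1) (is_vder_vscal _ _ _ _ _ hy h2))
  (is_vder_vscal _ _ _ _ _ hz h3))].
apply R3_ext; simpl; ring.
Qed.

Lemma vcomb_vcomb (E1 E2 E3 : R3) (x1 y1 z1 x2 y2 z2 x3 y3 z3 x y z : R) :
  vcomb (vcomb E1 E2 E3 x1 y1 z1) (vcomb E1 E2 E3 x2 y2 z2) (vcomb E1 E2 E3 x3 y3 z3) x y z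
  = vcomb E1 E2 E3 (x * x1 + y * x2 + z * x3) (x * y1 + y * y2 + z * y3)
      (x * z1 + y * z2 + z * z3).
Proof. apply R3_ext; simpl; ring. Qed.

Lemma vadd_vcomb (E1 E2 E3 : R3) (x y z x' y' z' : R) :
  vadd (vcomb E1 E2 E3 x y z) (vcomb E1 E2 E3 x' y' z')
  = vcomb E1 E2 E3 (x + x') (y + y') (z + z').
Proof. apply R3_ext; simpl; ring. Qed.

Lemma vscal_vcomb (E1 E2 E3 : R3) (k x y z : R) :
  vscal k (vcomb E1 E2 E3 x y z) = vcomb E1 E2 E3 (k * x) (k * y) (k * z).
Proof. apply R3_ext; simpl; ring. Qed.

Lemma dot_comm (p q : R3) : dot p q = dot q p.
Proof. unfold dot; ring. Qed.

Lemma dot_vcomb (E1 E2 E3 : R3) (x y z x' y' z' : R) :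
  orthoframe E1 E2 E3 ->
  dot (vcomb E1 E2 E3 x y z) (vcomb E1 E2 E3 x' y' z') = x * x' + y * y' + z * z'.
Proof.
intros [o11 o22 o33 o12 o13 o23 _ _ _].
transitivity (x * x' * dot E1 E1 + y * y' * dot E2 E2 + z * z' * dot E3 E3
  + (x * y' + y * x') * dot E1 E2 + (x * z' + z * x') * dot E1 E3 + (y * z' + z * y') * dot E2 E3).
- unfold dot; simpl; ring.
- rewrite o11, o22, o33, o12, o13, o23; ring.
Qed.

Lemma cross_vcomb (E1 E2 E3 : R3) (x y z x' y' z' : R) :
  orthoframe E1 E2 E3 ->
  cross (vcomb E1 E2 E3 x y z) (vcomb E1 E2 E3 x' y' z')
  = vcomb E1 E2 E3 (y * z' - z * y') (z * x' - x * z') (x * y' - y * x').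
Proof.
intros [_ _ _ _ _ _ c12 c23 c31].
transitivity (vcomb (cross E2 E3) (cross E3 E1) (cross E1 E2)
  (y * z' - z * y') (z * x' - x * z') (x * y' - y * x')).
- apply R3_ext; simpl; ring.
- now rewrite c12, c23, c31.
Qed.

Lemma vnorm_vcomb (E1 E2 E3 : R3) (x y z : R) :
  orthoframe E1 E2 E3 -> vnorm (vcomb E1 E2 E3 x y z) = sqrt (x ^ 2 + y ^ 2 + z ^ 2).
Proof. intros h; unfold vnorm; rewrite dot_vcomb by easy; f_equal; ring. Qed.

(** The unit normal is [E1]. Since [e^th e^-th = 1], the trace-free part of the second fundamental
    form is constant, and the mean curvature is a quotient of two multiples of [e^(2 th)]. *)
Lemma moving_frame_geometry (H a1 a2 b1 b2 A B c : R) (th q : R -> R)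
    (X E1 E2 E3 : R -> R -> R3) :
  H <> 0 -> 0 < a1 ^ 2 + a2 ^ 2 ->
  profile_ode A B c th q -> moving_frame H a1 a2 b1 b2 th q X E1 E2 E3 ->
  immersion X /\ conformal X /\ cmc H X
  /\ forall s t, I_ss X s t = 4 / H ^ 2 * (a1 ^ 2 + a2 ^ 2) * exp (th s) ^ 2
      /\ hopf X s t = (- (2 / H) * (a1 * b1 - a2 * b2), - (2 / H) * (a1 * b2 + a2 * b1)).
Proof.
intros hH hA hode mf.
assert (hsm : smooth X).
{ intros n s t.
  assert (G : forall pr, is_coord pr ->
    poly_closure (frame_gen th q X E1 E2 E3) (fun s t => pr (X s t))).
  { intros pr hpr; apply pc_gen, fg_vec; auto. }
  pose proof (moving_frame_smooth hode mf) as h.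
  refine (conj _ (conj _ _)); apply h, G; unfold is_coord; auto. }
destruct hode as (t0 & q0 & dt & dq).
destruct mf as [ortho Xs Xt E1s E2s E3s E1t E2t E3t].
assert (P0 : forall s, 0 < exp (th s)) by (intros; apply exp_pos).
assert (PM : forall s, exp (th s) * exp (- th s) = 1).
{ intros s; rewrite <- exp_plus; replace (th s + - th s) with 0 by ring; apply exp_0. }
set (y1 := fun s => - (2 / H) * (a2 * exp (th s))).
set (z1 := fun s => 2 / H * (a1 * exp (th s))).
set (y2 := fun s => - (2 / H) * (a1 * exp (th s))).
assert (eS : forall s t, Ds X s t = vcomb (E1 s t) (E2 s t) (E3 s t) 0 (y1 s) (z1 s)).
{ intros s t; apply is_vder_vDerive, Xs. }
assert (eT : forall s t, Dt X s t = vcomb (E1 s t) (E2 s t) (E3 s t) 0 (y2 s) (y1 s)).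
{ intros s t; apply is_vder_vDerive, Xt. }
set (g := fun s => 4 / H ^ 2 * (a1 ^ 2 + a2 ^ 2) * exp (th s) ^ 2).
assert (g0 : forall s, 0 < g s).
{ intros s; unfold g; apply Rmult_lt_0_compat; [apply Rmult_lt_0_compat; [|easy]|].
  - apply Rdiv_lt_0_compat; [lra | now apply pow2_gt_0].
  - now apply pow_lt. }
assert (eX : forall s t, cross (Ds X s t) (Dt X s t) = vcomb (E1 s t) (E2 s t) (E3 s t) (g s) 0 0).
{ intros s t; rewrite eS, eT, cross_vcomb by apply ortho.
  f_equal; unfold y1, y2, z1, g; field; auto. }
assert (eN : forall s t, normal X s t = vcomb (E1 s t) (E2 s t) (E3 s t) 1 0 0).
{ intros s t; unfold normal; rewrite eX, vnorm_vcomb, vscal_vcomb by apply ortho.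
  replace (g s ^ 2 + 0 ^ 2 + 0 ^ 2) with (g s * g s) by ring.
  specialize (g0 s); rewrite sqrt_square by lra; f_equal; field; lra. }
assert (z0 : forall (k : R) t, is_derive (fun _ : R => k) t 0)
  by (intros; apply (is_derive_const (V := R_NormedModule))).
assert (dk : forall k1 k2 s, is_derive (fun s => k1 * (k2 * exp (th s))) s
   (2 * q s * (k1 * (k2 * exp (th s))))).
{ intros k1 k2 s; auto_derive; [exact (ex_intro _ _ (dt s))|]; rewrite_Derive (dt s); ring. }
assert (dy1 : forall s, is_derive y1 s (2 * q s * y1 s)) by (intros; apply dk).
assert (dz1 : forall s, is_derive z1 s (2 * q s * z1 s)) by (intros; apply dk).
assert (dy2 : forall s, is_derive y2 s (2 * q s * y2 s)) by (intros; apply dk).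
assert (iss : forall s t, I_ss X s t = g s).
{ intros s t; unfold I_ss; rewrite eS, dot_vcomb by apply ortho; unfold y1, z1, g; field; auto. }
assert (itt : forall s t, I_tt X s t = g s).
{ intros s t; unfold I_tt; rewrite eT, dot_vcomb by apply ortho; unfold y1, y2, g; field; auto. }
assert (ist : forall s t, I_st X s t = 0).
{ intros s t; unfold I_st; rewrite eS, eT, dot_vcomb by apply ortho; unfold y1, y2, z1; field; auto. }
set (A2 := a1 ^ 2 + a2 ^ 2) in *; set (ab := a1 * b1 - a2 * b2).
assert (iiss : forall s t, II_ss X s t = 4 / H * (A2 * exp (th s) ^ 2 - ab)).
{ intros s t; unfold II_ss.
  pose proof (is_vder_vDerive _ _ _ (is_vder_ext (fun s => vcomb (E1 s t) (E2 s t) (E3 s t) 0 (y1 s) (z1 s))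
    (fun s => Ds X s t) s _ (fun s => eq_sym (eS s t))
    (is_vder_vcomb (fun s => E1 s t) (fun s => E2 s t) (fun s => E3 s t) _ _ _ s _ _ _ _ _ _
      (E1s s t) (E2s s t) (E3s s t) (z0 0 s) (dy1 s) (dz1 s)))) as e.
  match type of e with _ = ?v => change (Ds (Ds X) s t = v) in e end; cbv beta in e.
  rewrite e, vcomb_vcomb, vadd_vcomb, eN, dot_vcomb by apply ortho.
  clear e; pose proof (PM s) as e1; unfold y1, z1, A2, ab.
  generalize dependent (exp (th s)); generalize (exp (- th s)); intros M P e1.
  transitivity (4 / H * ((a1 ^ 2 + a2 ^ 2) * P ^ 2 - (a1 * b1 - a2 * b2) * (P * M)));
    [field; auto | rewrite e1; field; auto]. }
assert (iitt : forall s t, II_tt X s t = 4 / H * (A2 * exp (th s) ^ 2 + ab)).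
{ intros s t; unfold II_tt.
  pose proof (is_vder_vDerive _ _ _ (is_vder_ext (fun t => vcomb (E1 s t) (E2 s t) (E3 s t) 0 (y2 s) (y1 s))
    (fun t => Dt X s t) t _ (fun t => eq_sym (eT s t))
    (is_vder_vcomb (fun t => E1 s t) (fun t => E2 s t) (fun t => E3 s t)
      (fun _ => 0) (fun _ => y2 s) (fun _ => y1 s) t _ _ _ _ _ _
      (E1t s t) (E2t s t) (E3t s t) (z0 0 t) (z0 (y2 s) t) (z0 (y1 s) t)))) as e.
  match type of e with _ = ?v => change (Dt (Dt X) s t = v) in e end; cbv beta in e.
  rewrite e, vcomb_vcomb, vadd_vcomb, eN, dot_vcomb by apply ortho.
  clear e; pose proof (PM s) as e1; unfold y1, y2, A2, ab.
  generalize dependent (exp (th s)); generalize (exp (- th s)); intros M P e1.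
  transitivity (4 / H * ((a1 ^ 2 + a2 ^ 2) * P ^ 2 + (a1 * b1 - a2 * b2) * (P * M)));
    [field; auto | rewrite e1; field; auto]. }
assert (iist : forall s t, II_st X s t = 4 / H * (a1 * b2 + a2 * b1)).
{ intros s t; unfold II_st.
  pose proof (is_vder_vDerive _ _ _ (is_vder_ext (fun s => vcomb (E1 s t) (E2 s t) (E3 s t) 0 (y2 s) (y1 s))
    (fun s => Dt X s t) s _ (fun s => eq_sym (eT s t))
    (is_vder_vcomb (fun s => E1 s t) (fun s => E2 s t) (fun s => E3 s t) _ _ _ s _ _ _ _ _ _
      (E1s s t) (E2s s t) (E3s s t) (z0 0 s) (dy2 s) (dy1 s)))) as e.
  match type of e with _ = ?v => change (Ds (Dt X) s t = v) in e end; cbv beta in e.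
  rewrite e, vcomb_vcomb, vadd_vcomb, eN, dot_vcomb by apply ortho.
  clear e; pose proof (PM s) as e1; unfold y1, y2.
  generalize dependent (exp (th s)); generalize (exp (- th s)); intros M P e1.
  transitivity (4 / H * (a1 * b2 + a2 * b1) * (P * M)); [field; auto | rewrite e1; field; auto]. }
refine (conj (conj hsm _) (conj _ (conj _ _))).
- intros s t h; rewrite eX in h.
  assert (h1 : dot (vcomb (E1 s t) (E2 s t) (E3 s t) (g s) 0 0)
    (vcomb (E1 s t) (E2 s t) (E3 s t) 1 0 0) = 0) by (rewrite h; unfold dot; simpl; ring).
  rewrite dot_vcomb in h1 by apply ortho; specialize (g0 s); lra.
- intros s t; now rewrite iss, itt, ist.
- intros s t; unfold mean_curvature; rewrite iss, itt, ist, iiss, iitt, iist.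
  unfold g; specialize (P0 s); fold A2; field; repeat split; lra || auto.
- intros s t; split; [apply iss|].
  unfold hopf; rewrite iiss, iitt, iist; unfold ab; f_equal; field; auto.
Qed.
Arguments moving_frame_geometry {_ _ _ _ _ _ _ _ _ _ _ _ _ _}.

(** * Surfaces of revolution *)

Lemma ex_diff_n_slice (n : nat) (g : R -> R -> R) (t : R) :
  (forall m s t, ex_diff_n g m s t) -> forall s, ex_derive_n (fun s => g s t) n s.
Proof.
revert g; induction n as [|n IH]; intros g hg s; [exact I|].
destruct n as [|n].
- destruct (hg 1%nat s t) as (_ & h & _); exact h.
- assert (hg' : forall m s t, ex_diff_n (fun u v => Derive (fun z => g z v) u) m s t).
  { intros m u v; destruct (hg (S m) u v) as (_ & _ & _ & h & _); exact h. }
  pose proof (IH _ hg' s) as h.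
  apply (ex_derive_ext (Derive_n (fun s => Derive (fun z => g z t) s) n)); [|exact h].
  intros x; change (Derive_n (Derive_n (fun z => g z t) 1) n x = Derive_n (fun s => g s t) (S n) x).
  rewrite Derive_n_comp; f_equal; lia.
Qed.

Lemma cross_cross_unit (u p : R3) :
  dot u u = 1 -> dot u p = 0 -> cross u (cross u p) = vscal (-1) p.
Proof.
intros h1 h2.
transitivity (vadd (vscal (dot u p) u) (vscal (- dot u u) p)).
- apply R3_ext; unfold dot; simpl; ring.
- rewrite h1, h2; apply R3_ext; simpl; ring.
Qed.

Lemma is_vder_cross_l (u : R3) (p : R -> R3) (t : R) (v : R3) :
  is_vder p t v -> is_vder (fun t => cross u (p t)) t (cross u v).
Proof.
intros (h1 & h2 & h3).
assert (H : forall (f g : R -> R) f' g' x y, is_derive f t f' -> is_derive g t g' ->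
  is_derive (fun t => x * f t - y * g t) t (x * f' - y * g')).
{ intros f g f' g' x y hf hg.
  exact (is_derive_minus _ _ _ _ _ (is_derive_scal f t x f' hf) (is_derive_scal g t y g' hg)). }
exact (conj (H _ _ _ _ (cy u) (cz u) h3 h2) (conj (H _ _ _ _ (cz u) (cx u) h1 h3)
  (H _ _ _ _ (cx u) (cy u) h2 h1))).
Qed.

(** The pair turned back by the angle [t], [cos t T - sin t (u x T)] and [sin t T + cos t (u x T)],
    has zero derivative because [u x (u x T) = - T]. *)
Lemma rotation_ode (u : R3) (T : R -> R3) :
  dot u u = 1 -> (forall t, dot u (T t) = 0) -> (forall t, is_vder T t (cross u (T t))) ->
  forall t, T t = vadd (vscal (cos t) (T 0)) (vscal (sin t) (cross u (T 0))).
Proof.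
intros hu huT hT t.
assert (h1 : forall t, vadd (vscal (cos t) (T t)) (vscal (- sin t) (cross u (T t))) = T 0).
{ intros x; transitivity (vadd (vscal (cos 0) (T 0)) (vscal (- sin 0) (cross u (T 0)))).
  - apply (is_vder_zero_const (fun t => vadd (vscal (cos t) (T t)) (vscal (- sin t) (cross u (T t))))).
    intros y.
    assert (ds : is_derive (fun t => - sin t) y (- cos y)) by (auto_derive; auto; ring).
    eapply is_vder_eq; [|exact (is_vder_vadd
      (is_vder_vscal _ _ _ _ _ (is_derive_cos y) (hT y))
      (is_vder_vscal _ _ _ _ _ ds (is_vder_cross_l u T y _ (hT y))))].
    rewrite cross_cross_unit by auto.
    generalize (cross u (T y)); intros w; apply R3_ext; simpl; ring.
  - rewrite cos_0, sin_0; apply R3_ext; simpl; ring. }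
assert (h2 : forall t, vadd (vscal (sin t) (T t)) (vscal (cos t) (cross u (T t))) = cross u (T 0)).
{ intros x; transitivity (vadd (vscal (sin 0) (T 0)) (vscal (cos 0) (cross u (T 0)))).
  - apply (is_vder_zero_const (fun t => vadd (vscal (sin t) (T t)) (vscal (cos t) (cross u (T t))))).
    intros y.
    eapply is_vder_eq; [|exact (is_vder_vadd
      (is_vder_vscal _ _ _ _ _ (is_derive_sin y) (hT y))
      (is_vder_vscal _ _ _ _ _ (is_derive_cos y) (is_vder_cross_l u T y _ (hT y))))].
    rewrite cross_cross_unit by auto.
    generalize (cross u (T y)); intros w; apply R3_ext; simpl; ring.
  - rewrite cos_0, sin_0; apply R3_ext; simpl; ring. }
rewrite <- (h2 t), <- (h1 t).
pose proof (sin2_cos2 t) as h; unfold Rsqr in h.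
generalize (cross u (T t)); intros w.
transitivity (vscal (sin t * sin t + cos t * cos t) (T t)).
- rewrite h; apply R3_ext; simpl; ring.
- apply R3_ext; simpl; ring.
Qed.

Lemma orthoframe_cross (u v : R3) :
  dot u u = 1 -> dot v v = 1 -> dot u v = 0 -> orthoframe u v (cross u v).
Proof.
intros hu hv huv.
split; auto.
- transitivity (dot u u * dot v v - dot u v * dot u v); [unfold dot; simpl; ring|].
  rewrite hu, hv, huv; ring.
- unfold dot; simpl; ring.
- unfold dot; simpl; ring.
- transitivity (vadd (vscal (dot v v) u) (vscal (- dot u v) v)).
  + apply R3_ext; unfold dot; simpl; ring.
  + rewrite hv, huv; apply R3_ext; simpl; ring.
- transitivity (vadd (vscal (dot u u) v) (vscal (- dot u v) u)).
  + apply R3_ext; unfold dot; simpl; ring.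
  + rewrite hu, huv; apply R3_ext; simpl; ring.
Qed.

(** The axis [u] and the direction [T] of the parallels are written in the moving frame with
    coefficients depending on [s]. The frame equations make [u] constant and give [T_t = u x T]; the
    remaining identities again come from vanishing derivatives. *)
Lemma moving_frame_revolution (H a1 a2 b1 b2 A B c : R) (th q : R -> R)
    (X E1 E2 E3 : R -> R -> R3) :
  H <> 0 -> 0 < A -> A ^ 2 = a1 ^ 2 + a2 ^ 2 -> B ^ 2 = b1 ^ 2 + b2 ^ 2 ->
  a1 * b2 + a2 * b1 = 0 -> c ^ 2 + (a1 + b1) ^ 2 + (a2 - b2) ^ 2 = 1 / 4 ->
  profile_ode A B c th q -> moving_frame H a1 a2 b1 b2 th q X E1 E2 E3 ->
  exists o u v h rho, surface_of_revolution X o u v h rho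
    /\ (forall s, rho s = 2 / Rabs H * (A * exp (th s)))
    /\ forall s, is_derive h s (4 / H * ((A * exp (th s)) ^ 2 + (a1 * b1 - a2 * b2))).
Proof.
intros hH hA eA eB him hnorm hode mf.
pose proof (profile_conserved hode) as cons.
pose proof (moving_frame_smooth hode mf) as hsm.
destruct hode as (t0 & q0 & dt & dq).
destruct mf as [ortho Xs Xt E1s E2s E3s E1t E2t E3t].
assert (P0 : forall s, 0 < exp (th s)) by (intros; apply exp_pos).
assert (PM : forall s, exp (th s) * exp (- th s) = 1).
{ intros s; rewrite <- exp_plus; replace (th s + - th s) with 0 by ring; apply exp_0. }
assert (dP : forall k s, is_derive (fun s => k * exp (th s)) s (2 * q s * (k * exp (th s)))).
{ intros k s; auto_derive; [exact (ex_intro _ _ (dt s))|]; rewrite_Derive (dt s); ring. }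
assert (z0 : forall (k : R) t, is_derive (fun _ : R => k) t 0)
  by (intros; apply (is_derive_const (V := R_NormedModule))).
set (kap := a1 * b1 - a2 * b2) in *.
set (j1 := fun s => a1 * exp (th s) + b1 * exp (- th s)).
set (j2 := fun s => a2 * exp (th s) - b2 * exp (- th s)).
(* The rotation axis: twice [i xi_m1] at [l = 1], in the moving frame. *)
set (e := fun s t => vcomb (E1 s t) (E2 s t) (E3 s t) (2 * q s) (-2 * j2 s) (2 * j1 s)).
assert (nj : forall s, q s ^ 2 + j1 s ^ 2 + j2 s ^ 2 = 1 / 4).
{ intros s; specialize (cons s); specialize (PM s); unfold j1, j2.
  transitivity (q s ^ 2 + (A * exp (th s)) ^ 2 + (B * exp (- th s)) ^ 2
    + 2 * kap * (exp (th s) * exp (- th s))).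
  - rewrite !Rpow_mult_distr, eA, eB; unfold kap; ring.
  - rewrite cons, PM, <- hnorm, eA, eB; unfold kap; ring. }
assert (aj : forall s, a1 * j2 s - a2 * j1 s = 0).
{ intros s; unfold j1, j2; transitivity (- (a1 * b2 + a2 * b1) * exp (- th s)); [ring|].
  rewrite him; ring. }
assert (djM : forall k l s, is_derive (fun s => k * (a1 * exp (th s) + l * exp (- th s))) s
   (2 * q s * (k * (a1 * exp (th s) - l * exp (- th s))))).
{ intros k l s; auto_derive; [repeat split; exact (ex_intro _ _ (dt s))|].
  rewrite_Derive (dt s); ring. }
assert (e_s : forall s t, is_vder (fun s => e s t) s (mkR3 0 0 0)).
{ intros s t.
  assert (dq2 : is_derive (fun s => 2 * q s) s
    (2 * (-2 * ((A * exp (th s)) ^ 2 - (B * exp (- th s)) ^ 2)))) by exact (is_derive_scal _ _ _ _ (dq s)).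
  assert (dj2 : is_derive (fun s => -2 * j2 s) s
    (2 * q s * (-2 * (a2 * exp (th s) + b2 * exp (- th s))))).
  { unfold j2; auto_derive; [repeat split; exact (ex_intro _ _ (dt s))|].
    rewrite_Derive (dt s); ring. }
  eapply is_vder_eq; [|exact (is_vder_vcomb (fun s => E1 s t) (fun s => E2 s t) (fun s => E3 s t)
     _ _ _ s _ _ _ _ _ _ (E1s s t) (E2s s t) (E3s s t) dq2 dj2 (djM 2 b1 s))].
  rewrite vcomb_vcomb, vadd_vcomb.
  transitivity (vcomb (E1 s t) (E2 s t) (E3 s t) 0 0 0); [|apply R3_ext; simpl; ring].
  unfold j1, j2; f_equal; rewrite ?Rpow_mult_distr, ?eA, ?eB; ring. }
assert (e_t : forall s t, is_vder (fun t => e s t) t (mkR3 0 0 0)).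
{ intros s t.
  eapply is_vder_eq; [|exact (is_vder_vcomb (fun t => E1 s t) (fun t => E2 s t) (fun t => E3 s t)
     (fun _ => 2 * q s) (fun _ => -2 * j2 s) (fun _ => 2 * j1 s) t _ _ _ _ _ _
     (E1t s t) (E2t s t) (E3t s t) (z0 _ t) (z0 _ t) (z0 _ t))].
  rewrite vcomb_vcomb, vadd_vcomb.
  transitivity (vcomb (E1 s t) (E2 s t) (E3 s t) 0 0 0); [|apply R3_ext; simpl; ring].
  unfold j1, j2; f_equal; ring. }
set (u := e 0 0).
assert (eu : forall s t, e s t = u).
{ intros s t; transitivity (e s 0).
  - apply (is_vder_zero_const (fun t => e s t)); intros; apply e_t.
  - apply (is_vder_zero_const (fun s => e s 0)); intros; apply e_s. }
assert (uu : dot u u = 1).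
{ unfold u, e; rewrite dot_vcomb by apply ortho; specialize (nj 0); lra. }
(* The sign of [H], which orients [T] so that the radius comes out positive for either sign. *)
set (sg := H / Rabs H).
assert (hH' : 0 < Rabs H) by now apply Rabs_pos_lt.
assert (sg2 : sg * sg = 1).
{ unfold sg; transitivity (H ^ 2 / Rabs H ^ 2); [field; lra|].
  rewrite pow2_abs; field; auto. }
assert (sgH : sg / Rabs H = 1 / H).
{ unfold sg; transitivity (H / (Rabs H ^ 2)); [field; lra|].
  rewrite pow2_abs; field; auto. }
set (tau := sg / A).
(* The direction of [X_t], which depends on [t] only because [a b] is real. *)
set (T := fun s t => vcomb (E1 s t) (E2 s t) (E3 s t) 0 (- tau * a1) (- tau * a2)).
assert (T_s : forall s t, is_vder (fun s => T s t) s (mkR3 0 0 0)).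
{ intros s t.
  eapply is_vder_eq; [|exact (is_vder_vcomb (fun s => E1 s t) (fun s => E2 s t) (fun s => E3 s t)
     (fun _ => 0) (fun _ => - tau * a1) (fun _ => - tau * a2) s _ _ _ _ _ _
     (E1s s t) (E2s s t) (E3s s t) (z0 _ s) (z0 _ s) (z0 _ s))].
  rewrite vcomb_vcomb, vadd_vcomb.
  transitivity (vcomb (E1 s t) (E2 s t) (E3 s t)
     (2 * tau * exp (- th s) * (a1 * b2 + a2 * b1)) 0 0).
  - f_equal; ring.
  - rewrite him; apply R3_ext; simpl; ring. }
assert (Ts : forall s t, T s t = T 0 t).
{ intros s t; apply (is_vder_zero_const (fun s => T s t)); intros; apply T_s. }
assert (T_t : forall s t, is_vder (fun t => T s t) t (cross u (T s t))).
{ intros s t.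
  eapply is_vder_eq; [|exact (is_vder_vcomb (fun t => E1 s t) (fun t => E2 s t) (fun t => E3 s t)
     (fun _ => 0) (fun _ => - tau * a1) (fun _ => - tau * a2) t _ _ _ _ _ _
     (E1t s t) (E2t s t) (E3t s t) (z0 _ t) (z0 _ t) (z0 _ t))].
  rewrite <- (eu s t); unfold e, T; rewrite vcomb_vcomb, vadd_vcomb, cross_vcomb by apply ortho.
  unfold j1, j2; f_equal; ring. }
assert (uT : forall s t, dot u (T s t) = 0).
{ intros s t; rewrite <- (eu s t); unfold e, T; rewrite dot_vcomb by apply ortho.
  transitivity (2 * tau * (a1 * j2 s - a2 * j1 s)); [ring | rewrite aj; ring]. }
assert (TT : forall s t, dot (T s t) (T s t) = 1).
{ intros s t; unfold T; rewrite dot_vcomb by apply ortho.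
  transitivity (tau * tau * (a1 ^ 2 + a2 ^ 2)); [ring|].
  rewrite <- eA; unfold tau; transitivity (sg * sg); [field; lra | exact sg2]. }
(* [v] is chosen with [u x v = T0]: the radial direction at [t = 0], a quarter turn behind the
   tangent of the parallel. *)
set (T0 := T 0 0); set (v := cross T0 u).
assert (uT0 : dot u T0 = 0) by apply uT.
assert (TT0 : dot T0 T0 = 1) by apply TT.
assert (uv : cross u v = T0).
{ unfold v; transitivity (vadd (vscal (dot u u) T0) (vscal (- dot u T0) u)).
  - apply R3_ext; unfold dot; simpl; ring.
  - rewrite uu, uT0; apply R3_ext; simpl; ring. }
assert (rot : forall t, T 0 t = vadd (vscal (cos t) T0) (vscal (- sin t) v)).
{ intros t; rewrite (rotation_ode u (T 0) uu (uT 0) (T_t 0) t); fold T0.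
  apply R3_ext; unfold v; simpl; ring. }
set (Rt := fun t => vadd (vscal (cos t) v) (vscal (sin t) T0)).
assert (RT : forall t, Rt t = cross (T 0 t) u).
{ intros t; rewrite rot.
  transitivity (vadd (vscal (cos t) (cross T0 u)) (vscal (sin t) (cross u v))).
  - unfold Rt; now rewrite uv.
  - apply R3_ext; simpl; ring. }
assert (dR : forall t, is_vder Rt t (T 0 t)).
{ intros t; rewrite rot.
  eapply is_vder_eq; [|exact (is_vder_vadd
     (is_vder_vscal cos (fun _ => v) _ _ _ (is_derive_cos t) (is_vder_const v t))
     (is_vder_vscal sin (fun _ => T0) _ _ _ (is_derive_sin t) (is_vder_const T0 t)))].
  apply R3_ext; simpl; ring. }
set (rho := fun s => 2 / Rabs H * (A * exp (th s))).
assert (drho : forall s, is_derive rho s (2 * q s * rho s)).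
{ intros s; unfold rho.
  apply (is_derive_ext (fun s => 2 / Rabs H * A * exp (th s))); [intros x; apply Rmult_assoc|].
  replace (2 * q s * (2 / Rabs H * (A * exp (th s)))) with (2 * q s * (2 / Rabs H * A * exp (th s)))
    by ring.
  apply dP. }
set (h := fun s => cx (X s 0) * cx u + cy (X s 0) * cy u + cz (X s 0) * cz u).
assert (ht : forall s t, dot (vcomb (E1 s t) (E2 s t) (E3 s t)
    0 (- (2 / H) * (a2 * exp (th s))) (2 / H * (a1 * exp (th s)))) u
   = 4 / H * ((A * exp (th s)) ^ 2 + kap)).
{ intros s t; rewrite <- (eu s t); unfold e; rewrite dot_vcomb by apply ortho.
  rewrite Rpow_mult_distr, eA; unfold j1, j2, kap.
  specialize (PM s); transitivity (4 / H * ((a1 ^ 2 + a2 ^ 2) * exp (th s) ^ 2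
    + (a1 * b1 - a2 * b2) * (exp (th s) * exp (- th s)))); [field; auto | rewrite PM; field; auto]. }
assert (dh : forall s, is_derive h s (4 / H * ((A * exp (th s)) ^ 2 + kap))).
{ intros s; rewrite <- (ht s 0); destruct (Xs s 0) as (x1 & x2 & x3).
  assert (ds : forall (f : R -> R) f' k, is_derive f s f' -> is_derive (fun s => f s * k) s (f' * k)).
  { intros f f' k hf; apply (is_derive_ext (fun s => k * f s)); [intros; apply Rmult_comm|].
    rewrite Rmult_comm; now apply is_derive_scal. }
  exact (is_derive_plus _ _ _ _ _ (is_derive_plus _ _ _ _ _ (ds _ _ (cx u) x1) (ds _ _ (cy u) x2))
    (ds _ _ (cz u) x3)). }
assert (rhotau : forall s, rho s * tau = 2 / H * exp (th s)).
{ intros s; unfold rho, tau.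
  transitivity (2 * (sg / Rabs H) * exp (th s)); [field; lra | rewrite sgH; field; auto]. }
(* The point of the axis from which heights are measured; its constancy is the claim. *)
set (Z := fun s t => vadd (X s t) (vadd (vscal (- h s) u) (vscal (- rho s) (Rt t)))).
assert (Z_t : forall s t, is_vder (fun t => Z s t) t (mkR3 0 0 0)).
{ intros s t.
  eapply is_vder_eq; [|exact (is_vder_vadd (Xt s t) (is_vder_vadd
     (is_vder_const (vscal (- h s) u) t)
     (is_vder_vscal (fun _ => - rho s) Rt t 0 _ (z0 _ t) (dR t))))].
  rewrite <- (Ts s t); unfold T.
  transitivity (vcomb (E1 s t) (E2 s t) (E3 s t) 0
    ((rho s * tau - 2 / H * exp (th s)) * a1) ((rho s * tau - 2 / H * exp (th s)) * a2)).
  - apply R3_ext; simpl; ring.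
  - rewrite rhotau; apply R3_ext; simpl; ring. }
assert (Z_s : forall s t, is_vder (fun s => Z s t) s (mkR3 0 0 0)).
{ intros s t.
  assert (dh' : is_derive (fun s => - h s) s (- (4 / H * ((A * exp (th s)) ^ 2 + kap))))
    by exact (is_derive_opp _ _ _ (dh s)).
  assert (drho' : is_derive (fun s => - rho s) s (- (2 * q s * rho s)))
    by exact (is_derive_opp _ _ _ (drho s)).
  eapply is_vder_eq; [|exact (is_vder_vadd (Xs s t) (is_vder_vadd
     (is_vder_vscal _ (fun _ => u) s _ _ dh' (is_vder_const u s))
     (is_vder_vscal _ (fun _ => Rt t) s _ _ drho' (is_vder_const (Rt t) s))))].
  rewrite RT, <- (Ts s t), <- (eu s t); unfold T, e; rewrite cross_vcomb by apply ortho.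
  set (P := exp (th s)) in *; set (J1 := j1 s) in *; set (J2 := j2 s) in *.
  assert (hp : 4 / H * ((A * P) ^ 2 + kap) = 4 / H * P * (a1 * J1 + a2 * J2)).
  { unfold P; rewrite <- (ht s t), <- (eu s t); unfold e; rewrite dot_vcomb by apply ortho.
    unfold J1, J2; field; auto. }
  rewrite hp.
  (* All three components vanish by [rhotau], the unit length of the axis vector ([nj]) and its
     orthogonality to [T] ([aj]). *)
  transitivity (vcomb (E1 s t) (E2 s t) (E3 s t)
    (4 * q s * (a1 * J1 + a2 * J2) * (rho s * tau - 2 / H * P))
    (- (2 / H) * (a2 * P) + 8 / H * P * (a1 * J1 + a2 * J2) * J2
       + 4 * q s ^ 2 * a2 * (rho s * tau))
    (2 / H * (a1 * P) - 8 / H * P * (a1 * J1 + a2 * J2) * J1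
       - 4 * q s ^ 2 * a1 * (rho s * tau))).
  - apply R3_ext; simpl; field; auto.
  - rewrite rhotau; fold P.
    assert (q2 : q s ^ 2 = 1 / 4 - J1 ^ 2 - J2 ^ 2) by (specialize (nj s); fold J1 J2 in nj; lra).
    pose proof (aj s) as haj; fold J1 J2 in haj.
    transitivity (vcomb (E1 s t) (E2 s t) (E3 s t) 0
      (8 / H * P * J1 * (a1 * J2 - a2 * J1)) (8 / H * P * J2 * (a1 * J2 - a2 * J1))).
    + f_equal; rewrite ?q2; field; auto.
    + rewrite haj; apply R3_ext; simpl; ring. }
assert (Zc : forall s t, Z s t = Z 0 0).
{ intros s t; transitivity (Z s 0).
  - apply (is_vder_zero_const (fun t => Z s t)); intros; apply Z_t.
  - apply (is_vder_zero_const (fun s => Z s 0)); intros; apply Z_s. }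
set (S := poly_closure (frame_gen th q X E1 E2 E3)) in *.
exists (Z 0 0), u, v, h, rho; split; [|split; [reflexivity | exact dh]].
refine (conj uu (conj _ (conj _ (conj _ (conj _ _))))).
- unfold v; transitivity (dot u u * dot T0 T0 - dot u T0 * dot u T0); [unfold dot; simpl; ring|].
  rewrite uu, TT0, uT0; ring.
- unfold v, dot; simpl; ring.
- intros n s; split.
  + apply (ex_diff_n_slice n (fun s t => cx (X s t) * cx u + cy (X s t) * cy u + cz (X s t) * cz u) 0).
    apply hsm.
    assert (G : forall pr k, is_coord pr -> S (fun s t => pr (X s t) * k)).
    { intros pr k hpr; apply (pc_mult _ (fun s t => pr (X s t)) (fun _ _ => k)).
      - apply pc_gen, fg_vec; auto.
      - apply pc_const. }
    apply (pc_plus _ (fun s t => cx (X s t) * cx u + cy (X s t) * cy u)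
      (fun s t => cz (X s t) * cz u)); [|apply (G cz); unfold is_coord; auto].
    apply (pc_plus _ (fun s t => cx (X s t) * cx u) (fun s t => cy (X s t) * cy u));
      [apply (G cx) | apply (G cy)]; unfold is_coord; auto.
  + apply (ex_diff_n_slice n (fun s _ => 2 / Rabs H * (A * exp (th s))) 0).
    apply hsm.
    apply (pc_mult _ (fun _ _ => 2 / Rabs H) (fun s _ => A * exp (th s))); [apply pc_const|].
    apply (pc_mult _ (fun _ _ => A) (fun s _ => exp (th s))); [apply pc_const|].
    apply pc_gen, fg_exp.
- intros s; split.
  + unfold rho; apply Rmult_lt_0_compat; [apply Rdiv_lt_0_compat; lra|].
    now apply Rmult_lt_0_compat.
  (* If [rho' = 0] then [q = 0]. With [h' = 0] as well, [(j1, j2)] would be both orthogonal and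
     parallel to the nonzero vector [(a1, a2)], hence 0, against [nj]. *)
  + rewrite (is_derive_unique _ _ _ (dh s)), (is_derive_unique _ _ _ (drho s)).
    destruct (Req_dec (2 * q s * rho s) 0) as [hq | hq]; [left | now right].
    assert (hr : 0 < rho s).
    { unfold rho; apply Rmult_lt_0_compat; [apply Rdiv_lt_0_compat; lra|].
      now apply Rmult_lt_0_compat. }
    assert (hq0 : q s = 0) by nra.
    rewrite <- (ht s 0), <- (eu s 0); unfold e; rewrite dot_vcomb by apply ortho.
    intros hz.
    assert (hz' : a1 * j1 s + a2 * j2 s = 0).
    { apply Rmult_eq_reg_l with (4 / H * exp (th s)).
      - rewrite Rmult_0_r, <- hz; field; auto.
      - apply Rmult_integral_contrapositive_currified; [|apply Rgt_not_eq, P0].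
        apply Rmult_integral_contrapositive_currified; [lra | now apply Rinv_neq_0_compat]. }
    specialize (nj s); specialize (aj s); rewrite hq0 in nj.
    assert (hsum : A ^ 2 * (j1 s ^ 2 + j2 s ^ 2)
       = (a1 * j1 s + a2 * j2 s) ^ 2 + (a1 * j2 s - a2 * j1 s) ^ 2) by (rewrite eA; ring).
    rewrite hz', aj in hsum.
    assert (0 < A ^ 2) by now apply pow_lt.
    nra.
- intros s t; rewrite uv, <- (Zc s t); unfold Z, Rt; apply R3_ext; simpl; ring.
Qed.
Arguments moving_frame_revolution {_ _ _ _ _ _ _ _ _ _ _ _ _ _}.

(** * Completeness and the punctured sphere *)

Lemma RInt_ge_increment (f P P' : R -> R) (T : R) :
  (forall t, continuous f t) -> (forall t, is_derive P t (P' t)) ->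
  (forall t, P' t <= f t) -> 0 <= T -> P T - P 0 <= RInt f 0 T.
Proof.
intros cf hP hle hT.
set (g := fun t => RInt f 0 t - P t).
assert (dg : forall t, is_derive g t (f t - P' t)).
{ intros t; exact (is_derive_minus (V := R_NormedModule) (fun t => RInt f 0 t) P t _ _
    (is_derive_primitive f t cf) (hP t)). }
destruct (MVT_gen g 0 T (fun t => f t - P' t)) as [c [_ hc]].
- intros t _; apply dg.
- intros t _; apply continuity_pt_filterlim, (ex_derive_continuous g).
  exact (ex_intro _ _ (dg t)).
- unfold g in hc; rewrite RInt_point in hc; specialize (hle c).
  change (zero : R) with 0 in hc; nra.
Qed.

(* Along a curve [(p, q)] the speed is [rho (p t) sqrt (p' ^ 2 + q' ^ 2)], because
   the profile has speed [rho]. *)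
Lemma revolution_complete (X : R -> R -> R3) (o u v : R3) (h rho h' rho' : R -> R) (k : R) :
  surface_of_revolution X o u v h rho ->
  (forall s, is_derive h s (h' s)) -> (forall s, is_derive rho s (rho' s)) ->
  (forall s, h' s ^ 2 + rho' s ^ 2 = rho s ^ 2) ->
  0 < k -> (forall s, k <= rho s) -> complete X.
Proof.
intros (huu & hvv & huv & _ & hpos & hX) dh drho hsp hk hrho p q hp hq hlim.
pose proof (orthoframe_cross u v huu hvv huv) as of.
set (w := cross u v) in *.
assert (dp : forall t, is_derive p t (Derive p t)) by (intros t; apply Derive_correct, hp).
assert (dq : forall t, is_derive q t (Derive q t)) by (intros t; apply Derive_correct, hq).
set (f := fun t => rho (p t) * sqrt (Derive p t ^ 2 + Derive q t ^ 2)).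
assert (speed : forall t, vnorm (vDerive (fun t => X (p t) (q t)) t) = f t).
{ intros t.
  assert (comp : forall (g g' : R -> R) (y : R -> R), (forall s, is_derive g s (g' s)) ->
    is_derive y t (Derive y t) -> is_derive (fun t => g (y t)) t (Derive y t * g' (y t))).
  { intros g g' y hg hy; exact (is_derive_comp g y t _ _ (hg (y t)) hy). }
  assert (e : vDerive (fun t => X (p t) (q t)) t = vcomb u v w (Derive p t * h' (p t))
    (Derive p t * rho' (p t) * cos (q t) - rho (p t) * Derive q t * sin (q t))
    (Derive p t * rho' (p t) * sin (q t) + rho (p t) * Derive q t * cos (q t))).
  { apply is_vder_vDerive.
    apply (is_vder_ext (fun t => vadd (vadd o (vscal (h (p t)) u))
      (vscal (rho (p t)) (vadd (vscal (cos (q t)) v) (vscal (sin (q t)) w)))));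
      [intros; symmetry; apply hX|].
    eapply is_vder_eq; [|exact (is_vder_vadd
      (is_vder_vadd (is_vder_const o t)
        (is_vder_vscal _ (fun _ => u) t _ _ (comp h h' p dh (dp t)) (is_vder_const u t)))
      (is_vder_vscal _ _ t _ _ (comp rho rho' p drho (dp t)) (is_vder_vadd
        (is_vder_vscal _ (fun _ => v) t _ _ (comp cos (fun x => - sin x) q
           (fun s => is_derive_cos s) (dq t)) (is_vder_const v t))
        (is_vder_vscal _ (fun _ => w) t _ _ (comp sin cos q
           (fun s => is_derive_sin s) (dq t)) (is_vder_const w t)))))].
    apply R3_ext; simpl; ring. }
  rewrite e, vnorm_vcomb by easy; unfold f.
  destruct (hpos (p t)) as [r0 _]; specialize (hsp (p t)).
  pose proof (sin2_cos2 (q t)) as sc; unfold Rsqr in sc.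
  transitivity (sqrt (rho (p t) * rho (p t) * (Derive p t ^ 2 + Derive q t ^ 2))).
  2: { rewrite sqrt_mult_alt, sqrt_square by nra; reflexivity. }
  f_equal.
  transitivity ((Derive p t) ^ 2 * (h' (p t) ^ 2
     + rho' (p t) ^ 2 * (sin (q t) * sin (q t) + cos (q t) * cos (q t)))
     + rho (p t) ^ 2 * Derive q t ^ 2 * (sin (q t) * sin (q t) + cos (q t) * cos (q t))); [ring|].
  rewrite sc, !Rmult_1_r, hsp; ring. }
assert (cf : forall t, continuous f t).
{ intros t; apply (continuous_mult (fun t => rho (p t))).
  - apply (continuous_comp p rho).
    + exact (ex_derive_continuous p t (ex_intro _ _ (dp t))).
    + exact (ex_derive_continuous rho _ (ex_intro _ _ (drho (p t)))).
  - apply (continuous_comp (fun t => Derive p t ^ 2 + Derive q t ^ 2) sqrt); [|apply continuous_sqrt].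
    assert (csq : forall g : R -> R, continuous g t -> continuous (fun t => g t ^ 2) t).
    { intros g hg; apply (continuous_ext (fun t => g t * g t)); [intros x; simpl; ring|].
      now apply (continuous_mult g g). }
    apply (continuous_plus (fun t => Derive p t ^ 2) (fun t => Derive q t ^ 2)); apply csq.
    + apply hp.
    + apply hq. }
assert (fge : forall t y, Rabs y <= sqrt (Derive p t ^ 2 + Derive q t ^ 2) -> k * y <= f t).
{ intros t y hy; unfold f; specialize (hrho (p t)); pose proof (Rle_abs y); pose proof (Rabs_pos y).
  apply Rle_trans with (k * Rabs y); [nra|].
  apply Rmult_le_compat; lra. }
assert (hs1 : forall t, Rabs (Derive p t) <= sqrt (Derive p t ^ 2 + Derive q t ^ 2)).
{ intros t; rewrite <- sqrt_Rsqr_abs; apply sqrt_le_1_alt; unfold Rsqr; nra. }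
assert (hs2 : forall t, Rabs (Derive q t) <= sqrt (Derive p t ^ 2 + Derive q t ^ 2)).
{ intros t; rewrite <- sqrt_Rsqr_abs; apply sqrt_le_1_alt; unfold Rsqr; nra. }
assert (bound : forall y : R -> R, (forall t, is_derive y t (Derive y t)) ->
  (forall t, Rabs (Derive y t) <= sqrt (Derive p t ^ 2 + Derive q t ^ 2)) ->
  forall T, 0 <= T -> k * Rabs (y T - y 0) <= RInt f 0 T).
{ intros y dy hy T hT.
  assert (b1 : k * y T - k * y 0 <= RInt f 0 T).
  { apply (RInt_ge_increment f (fun t => k * y t) (fun t => k * Derive y t)); auto.
    intros t; apply is_derive_scal, dy. }
  assert (b2 : - k * y T - - k * y 0 <= RInt f 0 T).
  { apply (RInt_ge_increment f (fun t => - k * y t) (fun t => - k * Derive y t)); auto.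
    - intros t; apply is_derive_scal, dy.
    - intros t; replace (- k * Derive y t) with (k * - Derive y t) by ring.
      apply fge; now rewrite Rabs_Ropp. }
  unfold Rabs; destruct (Rcase_abs (y T - y 0)); lra. }
apply is_lim_spec in hlim; apply is_lim_spec; intros M.
(* Far out, [|p T - p 0| + |q T - q 0|] exceeds [2 M / k]. The length is at least [k] times each
   summand, hence at least [k] times their half sum. *)
destruct (hlim (2 * M / k + Rabs (p 0) + Rabs (q 0))) as [N hN].
exists (Rmax N 0); intros T hT.
pose proof (Rmax_l N 0); pose proof (Rmax_r N 0).
rewrite (RInt_ext _ f) by (intros; apply speed).
specialize (hN T ltac:(lra)).
pose proof (bound p dp hs1 T ltac:(lra)) as b1; pose proof (bound q dq hs2 T ltac:(lra)) as b2.
pose proof (Cmod_le_Re_Im (p T, q T)) as hc; unfold Re, Im in hc; simpl in hc.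
pose proof (Rabs_triang (p T - p 0) (p 0)) as t1; replace (p T - p 0 + p 0) with (p T) in t1 by ring.
pose proof (Rabs_triang (q T - q 0) (q 0)) as t2; replace (q T - q 0 + q 0) with (q T) in t2 by ring.
assert (h1 : 2 * M / k < Rabs (p T - p 0) + Rabs (q T - q 0)) by lra.
apply Rlt_div_l in h1; [|easy].
lra.
Qed.

(** The remainder [d] is orthogonal to [u], [v] and [u x v]; the Gram identity [G] for the square of
    the triple product then reduces to [|d|^2 = 0]. *)
Lemma orthoframe_expand (u v w y : R3) :
  orthoframe u v w -> y = vcomb u v w (dot y u) (dot y v) (dot y w).
Proof.
intros of.
set (d := vadd y (vscal (-1) (vcomb u v w (dot y u) (dot y v) (dot y w)))).
assert (hd : forall x, dot d x = dot y x - dot (vcomb u v w (dot y u) (dot y v) (dot y w)) x).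
{ intros x; unfold d, dot; simpl; ring. }
assert (e1 : u = vcomb u v w 1 0 0) by (apply R3_ext; simpl; ring).
assert (e2 : v = vcomb u v w 0 1 0) by (apply R3_ext; simpl; ring).
assert (e3 : w = vcomb u v w 0 0 1) by (apply R3_ext; simpl; ring).
assert (du : forall a b c, dot (vcomb u v w a b c) u = a).
{ intros a b c; transitivity (dot (vcomb u v w a b c) (vcomb u v w 1 0 0));
    [f_equal; exact e1 | rewrite dot_vcomb by easy; ring]. }
assert (dv : forall a b c, dot (vcomb u v w a b c) v = b).
{ intros a b c; transitivity (dot (vcomb u v w a b c) (vcomb u v w 0 1 0));
    [f_equal; exact e2 | rewrite dot_vcomb by easy; ring]. }
assert (dw : forall a b c, dot (vcomb u v w a b c) w = c).
{ intros a b c; transitivity (dot (vcomb u v w a b c) (vcomb u v w 0 0 1));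
    [f_equal; exact e3 | rewrite dot_vcomb by easy; ring]. }
assert (d1 : dot d u = 0) by (rewrite hd, du; ring).
assert (d2 : dot d v = 0) by (rewrite hd, dv; ring).
assert (d3 : dot d (cross u v) = 0) by (rewrite (of_c12 of), hd, dw; ring).
assert (G : dot d (cross u v) ^ 2 = dot d d * dot u u * dot v v
  + 2 * dot d u * dot u v * dot v d - dot d d * dot u v ^ 2 - dot u u * dot v d ^ 2
  - dot v v * dot d u ^ 2) by (unfold dot; simpl; ring).
rewrite (dot_comm v d), d1, d2, d3, (of_11 of), (of_22 of), (of_12 of) in G.
assert (hdd : dot d d = 0) by lra.
assert (d0 : cx d = 0 /\ cy d = 0 /\ cz d = 0) by (unfold dot in hdd; repeat split; nra).
destruct d0 as (x1 & x2 & x3); unfold d in x1, x2, x3; simpl in x1, x2, x3.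
apply R3_ext; simpl; lra.
Qed.

(** [g] is the height over the centre. It takes all values strictly between [- rad] and [rad], so
    every parallel occurs and only the two poles on the axis are missed. *)
Lemma revolution_twice_punctured_sphere (X : R -> R -> R3) (o u v : R3) (h rho g : R -> R)
    (k rad : R) :
  surface_of_revolution X o u v h rho -> 0 < rad -> (forall s, h s = k + g s) ->
  (forall s, g s ^ 2 + rho s ^ 2 = rad ^ 2) ->
  (forall y, Rabs y < rad -> exists s, g s = y) -> twice_punctured_sphere X.
Proof.
intros (huu & hvv & huv & _ & hpos & hX) hr hh hg hsurj.
pose proof (orthoframe_cross u v huu hvv huv) as of.
set (w := cross u v) in *.
set (m := vadd o (vscal k u)).
assert (eX : forall s t, X s t = vadd m (vcomb u v w (g s) (rho s * cos t) (rho s * sin t))).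
{ intros s t; rewrite hX, hh; unfold m; apply R3_ext; simpl; ring. }
assert (dist : forall d, vdist (vadd m d) m = vnorm d).
{ intros d; unfold vdist; f_equal; apply R3_ext; simpl; ring. }
assert (eu : forall x, vscal x u = vcomb u v w x 0 0) by (intros; apply R3_ext; simpl; ring).
assert (inj : forall d d', vadd m d = vadd m d' -> d = d').
{ intros d d' e; apply R3_ext; [apply (f_equal cx) in e | apply (f_equal cy) in e
   | apply (f_equal cz) in e]; simpl in e; lra. }
assert (dotu : forall x y z, dot (vcomb u v w x y z) u = x).
{ intros x y z; transitivity (dot (vcomb u v w x y z) (vcomb u v w 1 0 0)).
  - f_equal; apply R3_ext; simpl; ring.
  - rewrite dot_vcomb by easy; ring. }
assert (glt : forall s, - rad < g s < rad).
{ intros s; specialize (hg s); destruct (hpos s) as [h0 _]; nra. }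
exists m, (vadd m (vscal rad u)), (vadd m (vscal (- rad) u)), rad.
split; [easy|]; split; [|split; [|split]].
- intros e; apply inj in e; rewrite !eu in e; apply (f_equal (fun d => dot d u)) in e.
  rewrite !dotu in e; lra.
- rewrite dist, eu, vnorm_vcomb by easy.
  replace (rad ^ 2 + 0 ^ 2 + 0 ^ 2) with (rad * rad) by ring; apply sqrt_square; lra.
- rewrite dist, eu, vnorm_vcomb by easy.
  replace ((- rad) ^ 2 + 0 ^ 2 + 0 ^ 2) with (rad * rad) by ring; apply sqrt_square; lra.
- intros y; split.
  + intros (s & t & <-); rewrite eX; split; [|split].
    * rewrite dist, vnorm_vcomb by easy.
      pose proof (sin2_cos2 t) as sc; unfold Rsqr in sc.
      replace (g s ^ 2 + (rho s * cos t) ^ 2 + (rho s * sin t) ^ 2) with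
        (g s ^ 2 + rho s ^ 2 * (sin t * sin t + cos t * cos t)) by ring.
      rewrite sc, Rmult_1_r, hg; replace (rad ^ 2) with (rad * rad) by ring.
      apply sqrt_square; lra.
    * intros e; apply inj in e; rewrite eu in e; apply (f_equal (fun d => dot d u)) in e.
      rewrite !dotu in e; specialize (glt s); lra.
    * intros e; apply inj in e; rewrite eu in e; apply (f_equal (fun d => dot d u)) in e.
      rewrite !dotu in e; specialize (glt s); lra.
  + intros (hd & hp & hq).
    set (d := vadd y (vscal (-1) m)).
    assert (ey : y = vadd m d) by (apply R3_ext; unfold d; simpl; ring).
    pose proof (orthoframe_expand u v w d of) as ed.
    set (x1 := dot d u) in *; set (x2 := dot d v) in *; set (x3 := dot d w) in *.
    assert (hn : x1 ^ 2 + x2 ^ 2 + x3 ^ 2 = rad ^ 2).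
    { rewrite ey, dist, ed, vnorm_vcomb in hd by easy.
      rewrite <- hd; replace (sqrt (x1 ^ 2 + x2 ^ 2 + x3 ^ 2) ^ 2) with
        (sqrt (x1 ^ 2 + x2 ^ 2 + x3 ^ 2) * sqrt (x1 ^ 2 + x2 ^ 2 + x3 ^ 2)) by ring.
      rewrite sqrt_sqrt; [easy|].
      pose proof (pow2_ge_0 x1); pose proof (pow2_ge_0 x2); pose proof (pow2_ge_0 x3); lra. }
    assert (hx1 : Rabs x1 < rad).
    { destruct (Rlt_le_dec (Rabs x1) rad) as [hlt | hle]; [easy | exfalso].
      assert (rad ^ 2 <= x1 ^ 2) by (rewrite <- (pow2_abs x1); nra).
      pose proof (pow2_ge_0 x2); pose proof (pow2_ge_0 x3).
      assert (h2 : x2 = 0) by nra; assert (h3 : x3 = 0) by nra.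
      assert (h1 : (x1 - rad) * (x1 + rad) = 0) by nra.
      rewrite h2, h3, <- eu in ed.
      apply Rmult_integral in h1; destruct h1 as [h1 | h1].
      - apply hp; rewrite ey, ed; do 2 f_equal; lra.
      - apply hq; rewrite ey, ed; do 2 f_equal; lra. }
    destruct (hsurj x1 hx1) as [s hs].
    destruct (polar_coordinates x2 x3) as (t & hc & hsn).
    assert (er : sqrt (x2 ^ 2 + x3 ^ 2) = rho s).
    { replace (x2 ^ 2 + x3 ^ 2) with (rho s * rho s) by (specialize (hg s); rewrite hs in hg; lra).
      apply sqrt_square; destruct (hpos s); lra. }
    rewrite er in hc, hsn.
    exists s, t; rewrite eX, hs, hc, hsn; now rewrite ey, ed.
Qed.

(** * The potential *)

(** A ball of the uniform structure of [C] is controlled in modulus up to a factor [sqrt 2 < 2],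
    hence the halved radius. *)
Lemma holo_at_of_cdiff (g : C -> C) (x : C) (d : R) :
  0 < d -> (forall w, Cmod (w - x) < d -> cdiff g w) -> holo_at g x.
Proof.
intros hd h.
assert (he : 0 < d / 2) by lra.
exists (mkposreal _ he); intros y hy.
apply h.
pose proof (C_NormedModule_mixin_compat2 x y (mkposreal _ he) hy) as hm.
change (minus y x) with (y - x)%C in hm; simpl in hm.
assert (sqrt 2 < 2).
{ rewrite <- (sqrt_square 2) at 2 by lra; apply sqrt_lt_1; lra. }
nra.
Qed.

Lemma mholo_at_const (A : M2) (x : C) : mholo_at (fun _ => A) x.
Proof.
assert (H : forall k : C, holo_at (fun _ => k) x).
{ intros k; apply (holo_at_of_cdiff _ x 1 Rlt_0_1); intros w _; exists 0%C; apply is_cderive_const. }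
exact (conj (H _) (conj (H _) (conj (H _) (H _)))).
Qed.

Lemma mholo_at_ext (F G : C -> M2) (x : C) : (forall w, F w = G w) -> mholo_at F x -> mholo_at G x.
Proof.
intros h (f1 & f2 & f3 & f4).
assert (H : forall m : M2 -> C, holo_at (fun w => m (F w)) x -> holo_at (fun w => m (G w)) x).
{ intros m [e he]; exists e; intros w hw; destruct (he w hw) as [l hl]; exists l.
  exact (is_cderive_ext _ _ w l (fun z => f_equal m (h z)) hl). }
exact (conj (H _ f1) (conj (H _ f2) (conj (H _ f3) (H _ f4)))).
Qed.

Lemma delaunay_dpw_triple (r : R) (a b : C) (c : R) :
  dpw_triple r (pullback_exp (delaunay_potential a b c)) (fun _ => mid).
Proof.
assert (detsig : minv Defs.sigma = Defs.sigma).
{ unfold minv; apply M2_ext; m2_unfold; apply C_ext; simpl; field. }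
split; [split|].
- intros z l hl; split; [|split; [|split]].
  + apply (mholo_at_ext (fun _ => xi_m1 a b c l)); [|apply mholo_at_const].
    intros w; symmetry; apply pullback_delaunay.
  + apply (mholo_at_ext (xi_m1 a b c)); [intros w; symmetry; apply pullback_delaunay|].
    assert (hl0 : 0 < Cmod l) by now apply Cmod_gt_0.
    assert (H : forall x y : C, holo_at (fun w => x / w + y * w)%C l).
    { intros x y; apply (holo_at_of_cdiff _ l (Cmod l) hl0); intros w hw.
      assert (w0 : w <> 0%C).
      { intros ->; replace (0 - l)%C with (- l)%C in hw by ring; rewrite Cmod_opp in hw; lra. }
      eexists; exact (is_cderive_plus _ _ w _ _ (is_cderive_scal x _ w _ (is_cderive_inv w w0))
        (is_cderive_scal y _ w _ (is_cderive_id w))). }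
    destruct (mholo_at_const (xi_m1 a b c l) l) as (k1 & _ & _ & k4).
    exact (conj k1 (conj (H _ _) (conj (H _ _) k4))).
  + rewrite pullback_delaunay; unfold xi_m1; m2_unfold; rewrite RtoC_opp; ring.
  + unfold twisted_at; rewrite !pullback_delaunay, detsig; unfold xi_m1.
    assert (hl' : (- l)%C <> 0%C).
    { intros e; apply hl; replace l with (- - l)%C by ring; rewrite e; ring. }
    apply M2_ext; m2_unfold; field; auto.
(* [l xi] written as a polynomial in [l], which gives its value at 0. *)
- exists (fun _ l => mkM2 (RtoC c * l)%C (a + Cconj b * (l * l))%C
     (b + Cconj a * (l * l))%C (RtoC (- c) * l)%C); split.
  + intros z l; split; [apply mholo_at_const|].
    assert (H : forall (x y : C), holo_at (fun w => x + y * (w * w))%C l).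
    { intros x y; apply (holo_at_of_cdiff _ l 1 Rlt_0_1); intros w _.
      eexists; exact (is_cderive_plus _ _ w _ _ (is_cderive_const x w)
        (is_cderive_scal y _ w _ (is_cderive_mult _ _ w _ _ (is_cderive_id w) (is_cderive_id w)))). }
    assert (H' : forall (x : C), holo_at (fun w => x * w)%C l).
    { intros x; apply (holo_at_of_cdiff _ l 1 Rlt_0_1); intros w _.
      eexists; exact (is_cderive_scal x _ w _ (is_cderive_id w)). }
    exact (conj (H' _) (conj (H _ _) (conj (H _ _) (H' _)))).
  + intros z l hl; rewrite pullback_delaunay; unfold xi_m1.
    apply M2_ext; m2_unfold; field; auto.
- intros l _; split; [apply mholo_at_const | split].
  + unfold twisted_at; rewrite detsig, mmul_1_r.
    apply M2_ext; m2_unfold; ring.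
  + m2_unfold; ring.
Qed.

(** * Bulge and neck radii *)

Lemma quadratic_roots (H kap x : R) :
  H <> 0 -> 0 <= 1 - 16 * kap ->
  (x * (1 - x * H) = 4 * kap / H <->
   x = 1 / (2 * H) * (1 + sqrt (1 - 16 * kap)) \/ x = 1 / (2 * H) * (1 - sqrt (1 - 16 * kap))).
Proof.
intros hH hk.
pose proof (sqrt_sqrt _ hk) as hD; set (D := sqrt (1 - 16 * kap)) in *.
assert (E : x * (1 - x * H) - 4 * kap / H
  = - H * ((x - 1 / (2 * H) * (1 + D)) * (x - 1 / (2 * H) * (1 - D)))).
{ replace kap with ((1 - D * D) / 16) by (rewrite hD; field); field; auto. }
split.
- intros h; assert (h0 : - H * ((x - 1 / (2 * H) * (1 + D)) * (x - 1 / (2 * H) * (1 - D))) = 0)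
    by (rewrite <- E; lra).
  apply Rmult_integral in h0; destruct h0 as [h0 | h0]; [lra|].
  apply Rmult_integral in h0; destruct h0 as [h0 | h0]; [left | right]; lra.
- intros [h | h]; apply Rminus_diag_uniq; rewrite E, h; ring.
Qed.

(** The profile has speed [rho], so the first integral of the profile is [h' - H rho^2 = 4 kap / H].
    At a critical point of [rho] the signed radius equals [h'] and is therefore a root; [hcrit] and
    [hcrit0] provide the critical points that realize the nonzero roots. *)
Lemma bulge_neck_of_profile (H A B c kap : R) (th q h rho : R -> R) :
  H <> 0 -> 0 < A -> kap ^ 2 = A ^ 2 * B ^ 2 -> c ^ 2 + A ^ 2 + B ^ 2 + 2 * kap = 1 / 4 ->
  profile_ode A B c th q -> (forall s, rho s = 2 / Rabs H * (A * exp (th s))) ->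
  (forall s, is_derive h s (4 / H * ((A * exp (th s)) ^ 2 + kap))) ->
  (0 < B -> forall e, e = 1 \/ e = -1 -> exists s, q s = 0
     /\ A * exp (th s) - B * exp (- th s) = e * sqrt (c ^ 2 + (A - B) ^ 2)) ->
  (B = 0 -> exists s, q s = 0) -> 0 <= B ->
  (forall s, is_derive rho s (2 * q s * rho s))
  /\ (forall s, (4 / H * ((A * exp (th s)) ^ 2 + kap)) ^ 2 + (2 * q s * rho s) ^ 2 = rho s ^ 2)
  /\ bulge_neck_radii H h rho
      (1 / (2 * H) * (1 + sqrt (1 - 16 * kap))) (1 / (2 * H) * (1 - sqrt (1 - 16 * kap))).
Proof.
intros hH hA hkap hnorm hode hrho dh hcrit hcrit0 hB.
pose proof (profile_conserved hode) as cons.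
destruct hode as (t0 & q0 & dt & dq).
assert (hH' : 0 < Rabs H) by now apply Rabs_pos_lt.
assert (H2 : Rabs H ^ 2 = H ^ 2) by apply pow2_abs.
assert (hr0 : forall s, 0 < rho s).
{ intros s; rewrite hrho; apply Rmult_lt_0_compat; [apply Rdiv_lt_0_compat; lra|].
  apply Rmult_lt_0_compat; [easy | apply exp_pos]. }
assert (rho2 : forall s, rho s ^ 2 = 4 / H ^ 2 * (A * exp (th s)) ^ 2).
{ intros s; rewrite hrho, Rpow_mult_distr; f_equal.
  rewrite <- H2; field; lra. }
assert (UW : forall s, A * exp (th s) * (B * exp (- th s)) = A * B).
{ intros s; transitivity (A * B * (exp (th s) * exp (- th s))); [ring|].
  rewrite <- exp_plus; replace (th s + - th s) with 0 by ring; rewrite exp_0; ring. }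
assert (drho : forall s, is_derive rho s (2 * q s * rho s)).
{ intros s; apply (is_derive_ext (fun s => 2 / Rabs H * (A * exp (th s)))); [auto|].
  rewrite hrho; auto_derive; [exact (ex_intro _ _ (dt s))|]; rewrite_Derive (dt s); field; lra. }
assert (speed : forall s, (4 / H * ((A * exp (th s)) ^ 2 + kap)) ^ 2 + (2 * q s * rho s) ^ 2
   = rho s ^ 2).
{ intros s; rewrite Rpow_mult_distr, (Rpow_mult_distr (2 * q s)), rho2.
  specialize (cons s); specialize (UW s).
  set (U := A * exp (th s)) in *; set (W := B * exp (- th s)) in *.
  assert (hk2 : kap ^ 2 = U ^ 2 * W ^ 2).
  { rewrite hkap; transitivity ((A * B) ^ 2); [ring | rewrite <- UW; ring]. }
  assert (q2 : q s ^ 2 = 1 / 4 - 2 * kap - U ^ 2 - W ^ 2) by lra.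
  transitivity (16 / H ^ 2 * (U ^ 4 + 2 * U ^ 2 * kap + kap ^ 2 + q s ^ 2 * U ^ 2)); [field; auto|].
  rewrite hk2, q2; field; auto. }
split; [exact drho|]; split; [exact speed|].
(* [2 kap <= 2 A B <= A^2 + B^2], so the normalization yields [4 kap <= 1 / 4]. *)
assert (hD : 0 <= 1 - 16 * kap).
{ pose proof (pow2_ge_0 c); pose proof (pow2_ge_0 A); pose proof (pow2_ge_0 B).
  assert (2 * kap <= A ^ 2 + B ^ 2).
  { destruct (Rle_lt_dec kap 0) as [h0 | h0]; [lra|].
    assert ((2 * kap) ^ 2 <= (A ^ 2 + B ^ 2) ^ 2).
    { pose proof (pow2_ge_0 (A ^ 2 - B ^ 2)); nra. }
    apply Rsqr_incr_0_var; unfold Rsqr; nra. }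
  lra. }
assert (crit : forall s, q s = 0 ->
   (4 / H * ((A * exp (th s)) ^ 2 + kap)) ^ 2 = rho s ^ 2).
{ intros s hq; rewrite <- (speed s), hq; ring. }
split.
- exists (4 * kap / H); split; [|intros x; now apply quadratic_roots].
  intros s; rewrite (is_derive_unique _ _ _ (dh s)), (is_derive_unique _ _ _ (drho s)), speed.
  replace (rho s ^ 2) with (rho s * rho s) at 1 by ring.
  rewrite sqrt_square by (specialize (hr0 s); lra); rewrite rho2.
  specialize (hr0 s); field; lra.
- intros x hx; rewrite <- (quadratic_roots H kap x hH hD).
  (* At a critical point of [rho] the signed radius is [h']. *)
  assert (signed : forall s, q s = 0 ->
     signed_radius h rho s = 4 / H * ((A * exp (th s)) ^ 2 + kap)).
  { intros s hq; unfold signed_radius; rewrite (is_derive_unique _ _ _ (dh s)).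
    specialize (crit s hq); specialize (hr0 s).
    set (y := 4 / H * ((A * exp (th s)) ^ 2 + kap)) in *.
    destruct (Rtotal_order y 0) as [hy | [hy | hy]].
    - rewrite sign_eq_m1 by easy; nra.
    - rewrite hy in crit; nra.
    - rewrite sign_eq_1 by easy; nra. }
  assert (root : forall s, q s = 0 ->
    let y := 4 / H * ((A * exp (th s)) ^ 2 + kap) in y * (1 - y * H) = 4 * kap / H).
  { intros s hq y; transitivity (y - H * y ^ 2); [ring|].
    unfold y at 2; rewrite (crit s hq), rho2; unfold y; field; auto. }
  split.
  + intros hroot.
    assert (Hs : exists s, q s = 0 /\ 4 / H * ((A * exp (th s)) ^ 2 + kap) = x).
    { apply quadratic_roots in hroot; [|easy|easy].
      destruct (Rle_lt_or_eq_dec 0 B hB) as [hB' | hB'].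
      (* [kap = A B] for unduloids and cylinders, [kap = - A B] for nodoids. At the critical point
         [U + W] and [U - W] are [1/2] and [e D / 2] in the first case, [D / 2] and [e / 2] in the
         second. *)
      - assert (Hk : kap = A * B \/ kap = - (A * B)).
        { assert (h0 : (kap - A * B) * (kap + A * B) = 0).
          { transitivity (kap ^ 2 - A ^ 2 * B ^ 2); [ring | rewrite hkap; ring]. }
          apply Rmult_integral in h0; destruct h0; [left | right]; lra. }
        set (E := sqrt (c ^ 2 + (A - B) ^ 2)) in *.
        assert (E0 : 0 <= E) by apply sqrt_pos.
        assert (E2 : E * E = c ^ 2 + (A - B) ^ 2).
        { apply sqrt_sqrt; pose proof (pow2_ge_0 c); pose proof (pow2_ge_0 (A - B)); lra. }
        set (D := sqrt (1 - 16 * kap)) in *.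
        assert (D0 : 0 <= D) by apply sqrt_pos.
        assert (D2 : D * D = 1 - 16 * kap) by now apply sqrt_sqrt.
        assert (He : exists e, (e = 1 \/ e = -1) /\ x = 1 / (2 * H) * (1 + e * D)).
        { destruct hroot as [-> | ->]; [exists 1 | exists (-1)]; split; auto; ring. }
        destruct He as (e & he & ->).
        destruct (hcrit hB' e he) as (s & hq & hs).
        exists s; split; [easy|].
        specialize (UW s); pose proof (exp_pos (th s)); pose proof (exp_pos (- th s)).
        assert (U0 : 0 < A * exp (th s)) by now apply Rmult_lt_0_compat.
        assert (W0 : 0 < B * exp (- th s)) by now apply Rmult_lt_0_compat.
        set (U := A * exp (th s)) in *; set (W := B * exp (- th s)) in *.
        assert (e2 : e * e = 1) by (destruct he as [-> | ->]; ring).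
        transitivity (1 / (2 * H) * (8 * (U ^ 2 + kap))); [field; auto|]; f_equal.
        assert (S2 : (U + W) * (U + W) = E * E + 4 * (A * B)).
        { rewrite <- UW; transitivity ((U - W) * (U - W) + 4 * (U * W)); [ring|].
          rewrite hs; transitivity (e * e * (E * E) + 4 * (U * W)); [ring | rewrite e2; ring]. }
        assert (sq : forall x y, 0 <= x -> 0 <= y -> x * x = y * y -> x = y).
        { intros x y h1 h2 h3; now apply Rsqr_inj. }
        destruct Hk as [Hk | Hk].
        + assert (hS : U + W = 1 / 2) by (apply sq; lra).
          assert (hE : 2 * E = D) by (apply sq; lra).
          rewrite Hk, <- UW, <- hE.
          transitivity (8 * U * (U + W)); [ring|]; rewrite hS.
          transitivity (2 * ((U + W) + (U - W))); [field | rewrite hS, hs; field].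
        + assert (hE : E = 1 / 2) by (apply sq; lra).
          assert (hS : U + W = D / 2) by (apply sq; lra).
          rewrite Hk, <- UW.
          transitivity (4 * ((U + W) + (U - W)) * (U - W)); [ring|]; rewrite hS, hs, hE.
          transitivity (e * D + e * e); [field | rewrite e2; ring].
      (* For [B = 0] the roots are [1 / H] and 0, and [hx] discards the second. *)
      - assert (hk0 : kap = 0) by (rewrite <- hB' in hkap; nra).
        rewrite hk0 in hroot; replace (1 - 16 * 0) with 1 in hroot by ring; rewrite sqrt_1 in hroot.
        destruct (hcrit0 (eq_sym hB')) as [s hq]; exists s; split; [easy|].
        specialize (cons s); rewrite hq, <- hB' in cons.
        destruct hroot as [-> | h0]; [|exfalso; apply hx; rewrite h0; field; auto].
        replace ((A * exp (th s)) ^ 2) with (1 / 4).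
        + rewrite hk0; field; auto.
        + rewrite hk0, <- hB' in hnorm; lra. }
    destruct Hs as (s & hq & <-); exists s; split; [|now rewrite signed].
    rewrite (is_derive_unique _ _ _ (drho s)), hq; ring.
  + intros (s & hd & ->).
    rewrite (is_derive_unique _ _ _ (drho s)) in hd.
    assert (hq : q s = 0) by (specialize (hr0 s); nra).
    rewrite signed by easy; now apply root.
Qed.

(** * Associated family and Delaunay surface of the potential *)

Theorem theorem5p3 (H : R) (hH : H <> 0) (r : R) (hr : 0 < r <= 1)
    (a b : C) (c : R) (ha : a <> 0%C)
    (hnorm : Cmod (a + Cconj b)%C ^ 2 + c ^ 2 = 1 / 4)
    (hab : Im (a * b)%C = 0) :
  let xi := pullback_exp (delaunay_potential a b c) in
  let Phi0 := fun _ : C => mid in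
  dpw_triple r xi Phi0
  /\ forall f : C -> C -> R3,
       dpw_generates H r xi Phi0 0%C f ->
       associated_family H (fun l => on_coords (f l))
       /\ exists (o u v : R3) (h rho : R -> R),
            delaunay H (on_coords (f 1%C)) o u v h rho
            /\ bulge_neck_radii H h rho
                 (1 / (2 * H) * (1 + sqrt (1 - 16 * Re (a * b)%C)))
                 (1 / (2 * H) * (1 - sqrt (1 - 16 * Re (a * b)%C))).
Proof.
intros xi Phi0; split; [apply delaunay_dpw_triple|].
intros f hf; subst xi Phi0.
assert (hA : 0 < Cmod a) by now apply Cmod_gt_0.
assert (A2 : Cmod a ^ 2 = Re a ^ 2 + Im a ^ 2) by apply Cmod2_alt.
assert (B2 : Cmod b ^ 2 = Re b ^ 2 + Im b ^ 2) by apply Cmod2_alt.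
assert (hB : 0 <= Cmod b) by apply Cmod_ge_0.
assert (hn : c ^ 2 + (Re a + Re b) ^ 2 + (Im a - Im b) ^ 2 = 1 / 4).
{ rewrite <- hnorm, Cmod2_alt; unfold Re, Im; simpl; ring. }
assert (him : Re a * Im b + Im a * Re b = 0) by (rewrite <- hab; unfold Re, Im; simpl; ring).
(* The cases [b <> 0] and [b = 0] have different solutions; the two extra clauses keep what each
   later yields, the critical points of the radius and the range of [q]. *)
assert (Hode : exists th q, profile_ode (Cmod a) (Cmod b) c th q
  /\ (0 < Cmod b -> forall e, e = 1 \/ e = -1 -> exists s, q s = 0
     /\ Cmod a * exp (th s) - Cmod b * exp (- th s) = e * sqrt (c ^ 2 + (Cmod a - Cmod b) ^ 2))
  /\ (Cmod b = 0 -> forall y, Rabs y < 1 / 2 -> exists s, q s = y)).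
{ destruct (Rle_lt_or_eq_dec _ _ hB) as [h | h].
  - destruct (profile_ode_pos (Cmod a) (Cmod b) c hA h) as (th & q & h1 & h2).
    exists th, q; split; [easy|]; split; [auto | intros; lra].
  - destruct (profile_ode_zero (Cmod a) c hA) as (th & q & h1 & h2).
    exists th, q; rewrite <- h; split; [easy|]; split; [intros; lra|].
    intros _ y hy; apply h2.
    assert (b0 : b = 0%C) by now apply Cmod_eq_0.
    (* For [b = 0] the normalization reads [|a|^2 + c^2 = 1/4], so [q] takes all values strictly
       between [-1/2] and [1/2]. *)
    replace (Cmod a ^ 2 + c ^ 2) with (1 / 2 * (1 / 2)).
    + rewrite sqrt_square; lra.
    + rewrite A2; rewrite b0 in hn; simpl in hn; simpl; lra. }
destruct Hode as (th & q & hode & hcrit & hsurj).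
assert (frames := generated_moving_frame H r a b c th q f hH hr hode hf).
(* The metric sees only [|a|], and the Hopf differential only the product [(a / l) (b / l)], whence
   the factor [l^-2]. *)
assert (geo : forall l, Cmod l = 1 -> immersion (on_coords (f l)) /\ conformal (on_coords (f l))
  /\ cmc H (on_coords (f l)) /\ forall s t,
     I_ss (on_coords (f l)) s t = 4 / H ^ 2 * Cmod a ^ 2 * exp (th s) ^ 2
     /\ hopf (on_coords (f l)) s t = (RtoC (- (2 / H)) * (a * b) / (l * l))%C).
{ intros l hl; destruct (frames l hl) as (E1 & E2 & E3 & mf).
  assert (l0 : l <> 0%C) by (apply Cmod_gt_0; lra).
  assert (nl : Re (a / l)%C ^ 2 + Im (a / l)%C ^ 2 = Cmod a ^ 2).
  { rewrite <- Cmod2_alt, Cmod_div, hl by easy; f_equal; field. }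
  destruct (moving_frame_geometry hH
    ltac:(rewrite nl; now apply pow_lt) hode mf) as (g1 & g2 & g3 & g4).
  refine (conj g1 (conj g2 (conj g3 _))); intros s t; destruct (g4 s t) as [i1 i2]; split.
  - now rewrite i1, nl.
  - rewrite i2; transitivity (RtoC (- (2 / H)) * ((a / l) * (b / l)))%C.
    + apply C_ext; unfold Re, Im; simpl; ring.
    + field; auto. }
assert (h11 : Cmod 1%C = 1) by apply Cmod_1.
split.
- intros l hl; destruct (geo l hl) as (g1 & g2 & g3 & g4); destruct (geo 1%C h11) as (_ & _ & _ & k4).
  assert (l0 : l <> 0%C) by (apply Cmod_gt_0; lra).
  refine (conj g1 (conj g2 (conj g3 _))); intros s t.
  destruct (g4 s t) as [-> ->]; destruct (k4 s t) as [-> ->]; split; [easy|].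
  field; auto.
- destruct (geo 1%C h11) as (g1 & g2 & g3 & _).
  destruct (frames 1%C h11) as (E1 & E2 & E3 & mf).
  assert (e1 : forall z : C, (z / 1)%C = z) by (intros; field).
  rewrite !e1 in mf.
  destruct (moving_frame_revolution hH hA A2 B2 him hn hode mf)
    as (o & u & v & h & rho & hrev & hrho & dh).
  set (kap := Re a * Re b - Im a * Im b) in *.
  assert (ek : Re (a * b)%C = kap) by reflexivity.
  assert (hk : kap ^ 2 = Cmod a ^ 2 * Cmod b ^ 2).
  { transitivity (kap ^ 2 + (Re a * Im b + Im a * Re b) ^ 2); [rewrite him; ring|].
    rewrite A2, B2; unfold kap; ring. }
  assert (hn' : c ^ 2 + Cmod a ^ 2 + Cmod b ^ 2 + 2 * kap = 1 / 4).
  { rewrite <- hn, A2, B2; unfold kap; ring. }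
  destruct (bulge_neck_of_profile H (Cmod a) (Cmod b) c kap th q h rho hH hA hk hn' hode hrho dh
    hcrit) as (drho & speed & hbn); auto.
  { intros h0; apply (hsurj h0); rewrite Rabs_R0; lra. }
  exists o, u, v, h, rho; split; [|rewrite ek; exact hbn].
  refine (conj hrev (conj g1 (conj g3 _))).
  assert (hH' : 0 < Rabs H) by now apply Rabs_pos_lt.
  pose proof (profile_conserved hode) as cons.
  destruct (Rle_lt_or_eq_dec _ _ hB) as [hb | hb].
  + left.
    (* [|a| e^th] times [|b| e^-th] is [|a| |b|], and the second factor is at most [S], so [rho] has
       a positive lower bound. *)
    set (S := c ^ 2 + Cmod a ^ 2 + Cmod b ^ 2 + 1).
    assert (hS : 0 < S).
    { unfold S; pose proof (pow2_ge_0 c); pose proof (pow2_ge_0 (Cmod a));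
      pose proof (pow2_ge_0 (Cmod b)); lra. }
    apply (revolution_complete _ o u v h rho _ _ (2 / Rabs H * (Cmod a * Cmod b / S)) hrev dh drho speed).
    * apply Rmult_lt_0_compat; [apply Rdiv_lt_0_compat; lra|].
      apply Rdiv_lt_0_compat; [now apply Rmult_lt_0_compat | easy].
    * intros s; rewrite hrho; apply Rmult_le_compat_l; [left; apply Rdiv_lt_0_compat; lra|].
      apply Rle_div_l; [easy|].
      assert (P0 : 0 < exp (th s)) by apply exp_pos.
      assert (M0 : 0 < exp (- th s)) by apply exp_pos.
      assert (PM : exp (th s) * exp (- th s) = 1).
      { rewrite <- exp_plus; replace (th s + - th s) with 0 by ring; apply exp_0. }
      assert (hW : Cmod b * exp (- th s) <= S).
      { specialize (cons s); pose proof (pow2_ge_0 (q s));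
        pose proof (pow2_ge_0 (Cmod a * exp (th s))); unfold S; nra. }
      transitivity (Cmod a * exp (th s) * (Cmod b * exp (- th s))).
      -- right; transitivity (Cmod a * Cmod b * (exp (th s) * exp (- th s))); [rewrite PM; ring | ring].
      -- apply Rmult_le_compat_l; [|easy]; apply Rlt_le; now apply Rmult_lt_0_compat.
  + right.
    assert (k0 : kap = 0) by (rewrite <- hb in hk; nra).
    destruct hode as (t0 & q0 & dt & dq).
    (* With [U = |a| e^th] one has [h' = 4 U^2 / H] and [q' = - 2 U^2], so [h + 2 q / H] is
       constant. The relation [q^2 + U^2 = 1/4], scaled by [4 / H^2], is the equation of a circle of
       radius [1 / |H|]. *)
    apply (revolution_twice_punctured_sphere _ o u v h rho (fun s => - (2 / H) * q s)
      (h 0 + 2 / H * q 0) (1 / Rabs H) hrev).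
    * apply Rdiv_lt_0_compat; lra.
    * intros s.
      assert (hc : h s + 2 / H * q s = h 0 + 2 / H * q 0); [|lra].
      apply (is_derive_zero_const (fun s => h s + 2 / H * q s)); intros x.
      pose proof (is_derive_plus _ _ _ _ _ (dh x) (is_derive_scal _ _ (2 / H) _ (dq x))) as hd.
      replace 0 with (4 / H * ((Cmod a * exp (th x)) ^ 2 + kap) + 2 / H *
        (-2 * ((Cmod a * exp (th x)) ^ 2 - (Cmod b * exp (- th x)) ^ 2))).
      -- exact hd.
      -- rewrite <- hb, k0; field; auto.
    * intros s; specialize (cons s); rewrite hrho, <- hb in *.
      rewrite k0 in hn'.
      assert (H2 : Rabs H ^ 2 = H ^ 2) by apply pow2_abs.
      transitivity (4 / H ^ 2 * (q s ^ 2 + (Cmod a * exp (th s)) ^ 2)).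
      -- replace ((2 / Rabs H * (Cmod a * exp (th s))) ^ 2) with
          (4 / Rabs H ^ 2 * (Cmod a * exp (th s)) ^ 2) by (field; lra).
         rewrite H2; field; auto.
      -- replace (q s ^ 2 + (Cmod a * exp (th s)) ^ 2) with (1 / 4) by lra.
         transitivity (1 / Rabs H ^ 2); [rewrite H2; field; auto | field; lra].
    * intros y hy.
      destruct (hsurj (eq_sym hb) (- H / 2 * y)) as [s hs].
      -- unfold Rdiv; rewrite !Rabs_mult, Rabs_Ropp, (Rabs_pos_eq (/ 2)) by lra.
         apply Rlt_div_r in hy; [|easy]; lra.
      -- exists s; rewrite hs; field; auto.
Qed.
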